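(* Let $\mathcal{H}$ be a quasitriangular Hopf algebra and $\tilde{\mathcal{H}}^*$ its reflection equation dual. Then $\tilde{\mathcal{H}}^*$ is a right $(\mathcal{H}\overset{\mathcal{R}}{\otimes}\mathcal{H})^*$-comodule algebra with the coaction expressed through the coproduct and antipode of $\mathcal{H}^*$ by $$\delta(\eta)=\eta_{(2)}\otimes\bigl(\gamma(\eta_{(1)})\otimes\eta_{(3)}\bigr),\qquad\eta\in\tilde{\mathcal{H}}^*.$$
   Context: Conventions: $\mathbb{K}$ is a commutative algebra over a field of zero characteristic and Hopf algebras are over $\mathbb{K}$, with coproduct $\Delta$, counit $\varepsilon$, antipode $\gamma$. In the infinite dimensional case all algebras are assumed complete in some topology (e.g. $h$-adic) and tensor products are completed. Summation is implicit: $\Delta(x)=x_{(1)}\otimes x_{(2)}$, $\mathcal{R}=\mathcal{R}_1\otimes\mathcal{R}_2$; primes distinguish copies of $\mathcal{R}$. $\mathcal{H}$ is quasitriangular with universal R-matrix $\mathcal{R}\in\mathcal{H}^{\otimes 2}$ (invertible) if $(\Delta\otimes\mathrm{id})(\mathcal{R})=\mathcal{R}_{13}\mathcal{R}_{23}$, $(\mathrm{id}\otimes\Delta)(\mathcal{R})=\mathcal{R}_{13}\mathcal{R}_{12}$, $\mathcal{R}\Delta(x)=\Delta^{op}(x)\mathcal{R}$. $\mathcal{H}^*$ is the dual Hopf algebra, spanned by matrix coefficients of all finite dimensional representations of $\mathcal{H}$ (assumed to separate elements of $\mathcal{H}$). It is an $\mathcal{H}$-bimodule algebra under the coregular actions $x\triangleright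 a=a_{(1)}\langle a_{(2)},x\rangle$, $a\triangleleft x=\langle a_{(1)},x\rangle a_{(2)}$. The reflection equation dual $\tilde{\mathcal{H}}^*$ is $\mathcal{H}^*$ as a vector space with the associative multiplication $$\tilde m(a\otimes b)=m\bigl(\mathcal{R}_1\triangleright a\triangleleft\mathcal{R}_{1'}\otimes b\triangleleft\gamma(\mathcal{R}_2)\triangleleft\mathcal{R}_{2'}\bigr),$$ $m$ being the multiplication of $\mathcal{H}^*$. (It is the twist, by the cocycle $\mathcal{R}_{13}\mathcal{R}_{23}$, of $\mathcal{H}^*$ viewed as a left $\mathcal{H}^{op}\otimes\mathcal{H}$-module algebra via $(x\otimes y)\triangleright a=y\triangleright a\triangleleft\gamma(x)$, where $\mathcal{H}^{op}$ has the opposite coproduct.) The twisted tensor square $\mathcal{H}\overset{\mathcal{R}}{\otimes}\mathcal{H}$ is the Hopf algebra equal to $\mathcal{H}\otimes\mathcal{H}$ as an algebra, with coproduct $\tilde\Delta(z)=\mathcal{R}_{23}^{-1}\Delta_{\mathcal{H}\otimes\mathcal{H}}(z)\mathcal{R}_{23}$, $\mathcal{R}_{23}=(1\otimes\mathcal{R}_1)\otimes(\mathcal{R}_2\otimes1)$. Its dual Hopf algebra $(\mathcal{H}\overset{\mathcal{R}}{\otimes}\mathcal{H})^*$ coincides with $\mathcal{H}^*\otimes\mathcal{H}^*$ as a coalgebra and has multiplication $$(\alpha\otimes\beta)(\eta\otimes\xi)=\alpha\,(\mathcal{R}_2\triangleright\eta\triangleleft\mathcal{R}^{-1}_{2'})\otimes(\mathcal{R}_1\triangleright\beta\triangleleft\mathcal{R}^{-1}_{1'})\,\xi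 .$$ A right comodule algebra over a Hopf algebra $\mathcal{C}$ is an algebra $\mathcal{A}$ with a unital algebra homomorphism $\delta\colon\mathcal{A}\to\mathcal{A}\otimes\mathcal{C}$ such that $(\mathrm{id}\otimes\Delta)\delta=(\delta\otimes\mathrm{id})\delta$ and $(\mathrm{id}\otimes\varepsilon)\delta=\mathrm{id}$. In the claim, $\eta_{(1)}\otimes\eta_{(2)}\otimes\eta_{(3)}$ is the iterated coproduct of $\eta$ in $\mathcal{H}^*$. *)

(* Defs.v *)
From HB Require Import structures.
From mathcomp Require Import all_boot all_algebra.
From mathcomp Require Import generic_quotient boolp classical_sets.

Set Implicit Arguments.
Unset Strict Implicit.
Unset Printing Implicit Defensive.

Import GRing.Theory.

Local Open Scope quotient_scope.
Local Open Scope classical_set_scope.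
Local Open Scope ring_scope.

Definition bilin (K : comNzRingType) (A B C : lmodType K) (f : A -> B -> C) :=
  (forall b, linear (f^~ b)) /\ (forall a, linear (f a)).

(* The tensor product over K.  A list of pairs stands for the sum of the pure
   tensors of its entries, and two lists are identified when every bilinear
   map to every K-module takes the same value on them. *)
Section Tensor.
Variables (K : comNzRingType) (A B : lmodType K).

Definition eval_pairs (C : nmodType) (f : A -> B -> C) (s : seq (A * B)) : C :=
  \sum_(p <- s) f p.1 p.2.

Definition same_tensor (s t : seq (A * B)) : bool :=
  `[< forall (C : lmodType K) (f : A -> B -> C),
        bilin f -> eval_pairs f s = eval_pairs f t >].

Lemma same_tensor_equiv : equiv_class_of same_tensor.
Proof.
split=> [s|s t|t s u].
- exact/asboolP.
- by apply/asboolP/asboolP => h C f /h.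
- by move=> /asboolP h1 /asboolP h2; apply/asboolP => C f hf; rewrite h1 ?h2.
Qed.
Canonical same_tensor_equiv_rel := EquivRelPack same_tensor_equiv.

Definition tensor := {eq_quot same_tensor}.
HB.instance Definition _ := Choice.on tensor.
HB.instance Definition _ := Quotient.on tensor.

Definition tens (a : A) (b : B) : tensor := \pi_tensor [:: (a, b)].

Definition tensor_lift (C : nmodType) (f : A -> B -> C) (z : tensor) : C :=
  eval_pairs f (repr z).

Lemma tensor_liftE (C : lmodType K) (f : A -> B -> C) s :
  bilin f -> tensor_lift f (\pi_tensor s) = eval_pairs f s.
Proof.
move=> hf; rewrite /tensor_lift.
have /eqmodP/asboolP h : repr (\pi_tensor s) = s %[mod tensor] by rewrite reprK.
exact: h.
Qed.

Lemma tensor_ext (y z : tensor) :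
  (forall (C : lmodType K) (f : A -> B -> C), bilin f ->
     tensor_lift f y = tensor_lift f z) -> y = z.
Proof.
move=> h; rewrite -(reprK y) -(reprK z); apply/eqmodP/asboolP => C f /h; exact.
Qed.

Let scale_pairs (k : K) (s : seq (A * B)) := [seq (k *: p.1, p.2) | p <- s].

Definition tensor_zero : tensor := \pi_tensor [::].
Definition tensor_add (y z : tensor) : tensor := \pi_tensor (repr y ++ repr z).
Definition tensor_scale (k : K) (z : tensor) : tensor :=
  \pi_tensor (scale_pairs k (repr z)).
Definition tensor_opp (z : tensor) : tensor := tensor_scale (-1) z.

Let lift0 (C : lmodType K) (f : A -> B -> C) :
  bilin f -> tensor_lift f tensor_zero = 0.
Proof. by move=> hf; rewrite tensor_liftE // /eval_pairs big_nil. Qed.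

Let liftD (C : lmodType K) (f : A -> B -> C) y z : bilin f ->
  tensor_lift f (tensor_add y z) = tensor_lift f y + tensor_lift f z.
Proof. by move=> hf; rewrite tensor_liftE // /eval_pairs big_cat. Qed.

Let liftZ (C : lmodType K) (f : A -> B -> C) k z : bilin f ->
  tensor_lift f (tensor_scale k z) = k *: tensor_lift f z.
Proof.
move=> hf; rewrite tensor_liftE // /tensor_lift /eval_pairs big_map scaler_sumr.
apply: eq_bigr => p _ /=.
have f0 : f 0 p.2 = 0.
  by have /= := hf.1 p.2 (-1) 0 0; rewrite scaler0 addr0 scaleN1r addNr.
by have /= := hf.1 p.2 k p.1 0; rewrite f0 !addr0.
Qed.

Let tensor_addA : associative tensor_add.
Proof. by move=> x y z; apply: tensor_ext => C f hf; rewrite !liftD ?addrA. Qed.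
Let tensor_addC : commutative tensor_add.
Proof. by move=> x y; apply: tensor_ext => C f hf; rewrite !liftD 1?addrC. Qed.
Let tensor_add0 : left_id tensor_zero tensor_add.
Proof. by move=> x; apply: tensor_ext => C f hf; rewrite liftD ?lift0 ?add0r. Qed.
Let tensor_addN : left_inverse tensor_zero tensor_opp tensor_add.
Proof.
move=> x; apply: tensor_ext => C f hf.
by rewrite liftD // liftZ // lift0 // scaleN1r addNr.
Qed.
HB.instance Definition _ :=
  GRing.isZmodule.Build tensor tensor_addA tensor_addC tensor_add0 tensor_addN.

Let tensor_scaleA a b z :
  tensor_scale a (tensor_scale b z) = tensor_scale (a * b) z.
Proof. by apply: tensor_ext => C f hf; rewrite !liftZ ?scalerA. Qed.
Let tensor_scale1 : left_id 1 tensor_scale.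
Proof. by move=> z; apply: tensor_ext => C f hf; rewrite liftZ ?scale1r. Qed.
Let tensor_scaleDr : right_distributive tensor_scale +%R.
Proof.
move=> k y z; apply: tensor_ext => C f hf.
by rewrite liftZ // !liftD // !liftZ // scalerDr.
Qed.
Let tensor_scaleDl z : {morph tensor_scale^~ z : a b / a + b}.
Proof.
move=> a b; apply: tensor_ext => C f hf.
by rewrite liftZ // liftD // !liftZ // scalerDl.
Qed.
HB.instance Definition _ := GRing.Zmodule_isLmodule.Build K tensor
  tensor_scaleA tensor_scale1 tensor_scaleDr tensor_scaleDl.

Lemma tensor_lift_linear (C : lmodType K) (f : A -> B -> C) :
  bilin f -> linear (tensor_lift f).
Proof. by move=> hf k y z; rewrite liftD // liftZ. Qed.

Lemma tensor_lift_tens (C : lmodType K) (f : A -> B -> C) a b :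
  bilin f -> tensor_lift f (tens a b) = f a b.
Proof. by move=> hf; rewrite tensor_liftE // /eval_pairs big_seq1. Qed.

Lemma tens_bilin : bilin tens.
Proof.
have L (C : lmodType K) (f : A -> B -> C) (hf : bilin f) k y z :
    tensor_lift f (k *: y + z) = k *: tensor_lift f y + tensor_lift f z.
  exact: tensor_lift_linear.
split=> [b|a] k u v; apply: tensor_ext => C f hf;
  rewrite L // !tensor_lift_tens //; [exact: hf.1 | exact: hf.2].
Qed.

Lemma tensor_sum (z : tensor) : z = \sum_(p <- repr z) tens p.1 p.2.
Proof.
apply: tensor_ext => C f hf.
have h s : tensor_lift f (\sum_(p <- s) tens p.1 p.2) = eval_pairs f s.
  rewrite /eval_pairs; elim: s => [|p s IHs]; first by rewrite !big_nil lift0.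
  by rewrite !big_cons liftD // tensor_lift_tens // IHs.
by rewrite h.
Qed.

End Tensor.

(* Linear topologies, given by a filter base of submodules.  The discrete
   topology (base {0}) and the adic topologies (base I^n M) are examples. *)
Section LinearTopology.
Variable K : comNzRingType.

Definition is_submodule (M : lmodType K) (U : set M) :=
  U 0 /\ forall k u v, U u -> U v -> U (k *: u + v).

Record lintop (M : lmodType K) := LinTop {
  nbase : set (set M);
  nbase_submodule : forall U, nbase U -> is_submodule U;
  nbase_neq0 : nbase !=set0;
  nbase_directed : forall U V, nbase U -> nbase V ->
    exists2 W, nbase W & W `<=` U `&` V
}.

Definition nidx (M : lmodType K) (t : lintop M) := {U : set M | nbase t U}.

(* Complete and separated: M is the inverse limit of the M / U. *)
Definition complete_top (M : lmodType K) (t : lintop M) :=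
  (forall z : M, (forall U, nbase t U -> U z) -> z = 0) /\
  (forall x : nidx t -> M,
     (forall i j : nidx t, sval i `<=` sval j -> sval j (x i - x j)) ->
     exists l, forall i, sval i (x i - l)).

Definition continuous_lin (M N : lmodType K) (tM : lintop M) (tN : lintop N)
    (f : M -> N) :=
  linear f /\
  forall V, nbase tN V -> exists2 U, nbase tM U & forall x, U x -> V (f x).

(* Uniform continuity of a bilinear map. *)
Definition continuous_bilin (A B C : lmodType K) (tA : lintop A)
    (tB : lintop B) (tC : lintop C) (f : A -> B -> C) :=
  bilin f /\
  forall W, nbase tC W -> exists U V, [/\ nbase tA U, nbase tB V &
    forall a b, U a \/ V b -> W (f a b)].

End LinearTopology.

(* The completion, i.e. the inverse limit of the quotients M / U: an element
   is a compatible family of cosets. *)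
Section Completion.
Variables (K : comNzRingType) (M : lmodType K) (t : lintop M).

Definition coset (U : set M) (m : M) : set M := [set m + u | u in U].

Record completion := Completion {
  coset_at :> nidx t -> set M;
  coset_atP : forall i, exists m, coset_at i = coset (sval i) m;
  coset_at_compat : forall i j, sval i `<=` sval j -> coset_at i `<=` coset_at j
}.
HB.instance Definition _ := gen_eqMixin completion.
HB.instance Definition _ := gen_choiceMixin completion.

Lemma completion_ext (x y : completion) : (forall i, x i = y i) -> x = y.
Proof.
case: x y => [x px cx] [y py cy] /= /funext exy; subst y.
by congr Completion; exact: Prop_irrelevance.
Qed.

Let sub0 (i : nidx t) : sval i 0. Proof. exact: (nbase_submodule (svalP i)).1. Qed.
Let subP (i : nidx t) k u v : sval i u -> sval i v -> sval i (k *: u + v).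
Proof. exact: (nbase_submodule (svalP i)).2. Qed.
Let subD (i : nidx t) u v : sval i u -> sval i v -> sval i (u + v).
Proof. by move=> hu hv; rewrite -(scale1r u); exact: subP. Qed.
Let subZ (i : nidx t) k u : sval i u -> sval i (k *: u).
Proof. by move=> hu; rewrite -[_ *: _]addr0; exact: subP. Qed.
Let subN (i : nidx t) u : sval i u -> sval i (- u).
Proof. by rewrite -scaleN1r; exact: subZ. Qed.

Let cosetE (i : nidx t) m z : coset (sval i) m z <-> sval i (z - m).
Proof.
by split=> [[u hu <-]|h]; [rewrite addrC addKr | exists (z - m); rewrite // addrC subrK].
Qed.

Let lin_coset (i : nidx t) k m n :
  [set k *: u + v | u in coset (sval i) m & v in coset (sval i) n]
    `<=` coset (sval i) (k *: m + n).
Proof.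
move=> _ [u [u' hu' <-]] [v [v' hv' <-]] <-; exists (k *: u' + v'); first exact: subP.
by rewrite scalerDr addrACA.
Qed.

(* The coset k x + y; the sum with U is needed when k is not invertible. *)
Definition lin_at (k : K) (x y : completion) (i : nidx t) : set M :=
  [set z | exists u v, [/\ x i u, y i v & sval i (z - (k *: u + v))]].

Let lin_atE k (x y : completion) i m n : x i = coset (sval i) m -> y i = coset (sval i) n ->
  lin_at k x y i = coset (sval i) (k *: m + n).
Proof.
move=> ex ey; apply/seteqP; split=> z.
  case=> u [v [xu yv hz]]; apply/cosetE.
  have : coset (sval i) (k *: m + n) (k *: u + v).
    by apply: lin_coset; exists u; rewrite -?ex//; exists v; rewrite -?ey.
  by move/cosetE => h; rewrite -[z](subrK (k *: u + v)) -addrA; exact: subD.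
move/cosetE => hz; exists m, n; split => //.
  by rewrite ex; apply/cosetE; rewrite subrr.
by rewrite ey; apply/cosetE; rewrite subrr.
Qed.

Let lin_atP k (x y : completion) i : exists m, lin_at k x y i = coset (sval i) m.
Proof.
have [m em] := coset_atP x i; have [n en] := coset_atP y i.
by exists (k *: m + n); exact: lin_atE.
Qed.

Let lin_at_compat k (x y : completion) (i j : nidx t) :
  sval i `<=` sval j -> lin_at k x y i `<=` lin_at k x y j.
Proof.
move=> sij z [u [v [xu yv hz]]]; exists u, v.
by split; [exact: (coset_at_compat sij)|exact: (coset_at_compat sij)|exact: sij].
Qed.

Definition completion_lin k x y : completion :=
  Completion (lin_atP k x y) (@lin_at_compat k x y).

Let in_completionP (m : M) (i : nidx t) : exists n, coset (sval i) m = coset (sval i) n.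
Proof. by exists m. Qed.
Let in_completion_compat (m : M) (i j : nidx t) :
  sval i `<=` sval j -> coset (sval i) m `<=` coset (sval j) m.
Proof. by move=> sij _ [u /sij hu <-]; exists u. Qed.
Definition in_completion (m : M) : completion :=
  Completion (in_completionP m) (@in_completion_compat m).

Let c0 := in_completion 0.
Let cadd x y := completion_lin 1 x y.
Let cscale k x := completion_lin k x c0.
Let copp x := cscale (-1) x.

Let atP (x : completion) (i : nidx t) : {m | x i = coset (sval i) m}.
Proof. exact: cid (coset_atP x i). Qed.

Let caddE (x y : completion) (i : nidx t) m n : x i = coset (sval i) m -> y i = coset (sval i) n ->
  cadd x y i = coset (sval i) (m + n).
Proof. by move=> ex ey; rewrite -[m]scale1r; exact: lin_atE. Qed.
Let cscaleE k (x : completion) (i : nidx t) m : x i = coset (sval i) m ->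
  cscale k x i = coset (sval i) (k *: m).
Proof. by move=> ex; rewrite -[k *: m]addr0; exact: lin_atE. Qed.

Let caddA : associative cadd.
Proof.
move=> x y z; apply: completion_ext => i.
have [m em] := atP x i; have [n en] := atP y i; have [p ep] := atP z i.
by rewrite (caddE em (caddE en ep)) (caddE (caddE em en) ep) addrA.
Qed.
Let caddC : commutative cadd.
Proof.
move=> x y; apply: completion_ext => i.
have [m em] := atP x i; have [n en] := atP y i.
by rewrite (caddE em en) (caddE en em) addrC.
Qed.
Let cadd0 : left_id c0 cadd.
Proof.
move=> x; apply: completion_ext => i; have [m em] := atP x i.
by rewrite (caddE (erefl (c0 i)) em) add0r.
Qed.
Let caddN : left_inverse c0 copp cadd.
Proof.
move=> x; apply: completion_ext => i; have [m em] := atP x i.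
by rewrite (caddE (cscaleE _ em) em) scaleN1r addNr.
Qed.
HB.instance Definition _ :=
  GRing.isZmodule.Build completion caddA caddC cadd0 caddN.

Let cscaleA a b x : cscale a (cscale b x) = cscale (a * b) x.
Proof.
apply: completion_ext => i; have [m em] := atP x i.
by rewrite (cscaleE _ (cscaleE _ em)) (cscaleE _ em) scalerA.
Qed.
Let cscale1 : left_id 1 cscale.
Proof.
move=> x; apply: completion_ext => i; have [m em] := atP x i.
by rewrite (cscaleE _ em) scale1r.
Qed.
Let cscaleDr : right_distributive cscale +%R.
Proof.
move=> k x y; apply: completion_ext => i.
have [m em] := atP x i; have [n en] := atP y i.
by rewrite (cscaleE _ (caddE em en)) (caddE (cscaleE _ em) (cscaleE _ en)) scalerDr.
Qed.
Let cscaleDl x : {morph cscale^~ x : a b / a + b}.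
Proof.
move=> a b; apply: completion_ext => i; have [m em] := atP x i.
by rewrite (cscaleE _ em) (caddE (cscaleE _ em) (cscaleE _ em)) scalerDl.
Qed.
HB.instance Definition _ := GRing.Zmodule_isLmodule.Build K completion
  cscaleA cscale1 cscaleDr cscaleDl.

Definition ker_at (i : nidx t) : set completion := [set x | x i = sval i].

Let coset0 (i : nidx t) : coset (sval i) 0 = sval i.
Proof. by apply/seteqP; split=> z; rewrite cosetE subr0. Qed.

Let ker_submodule U : range ker_at U -> is_submodule U.
Proof.
case=> i _ <-; split=> [|k x y]; rewrite /ker_at /=; first exact: coset0.
move=> ex ey; have ex' : x i = coset (sval i) 0 by rewrite coset0.
have ey' : y i = coset (sval i) 0 by rewrite coset0.
by have := caddE (cscaleE k ex') ey'; rewrite scaler0 addr0 coset0.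
Qed.
Let ker_neq0 : range ker_at !=set0.
Proof.
have [U hU] := nbase_neq0 t.
by exists (ker_at (exist (fun V => nbase t V) U hU)); exact: imageT.
Qed.
Let ker_mono (i j : nidx t) : sval i `<=` sval j -> ker_at i `<=` ker_at j.
Proof.
move=> sij x; rewrite /ker_at /= => ex; have [m em] := coset_atP x j; rewrite em.
have : coset (sval j) m 0.
  by rewrite -em; apply: (coset_at_compat sij); rewrite ex; exact: sub0.
move/cosetE; rewrite sub0r => /subN; rewrite opprK => hm.
apply/seteqP; split=> z; rewrite cosetE => h.
  by rewrite -[z](subrK m); exact: subD.
by apply: subD => //; exact: subN.
Qed.
Let ker_directed U V : range ker_at U -> range ker_at V ->
  exists2 W, range ker_at W & W `<=` U `&` V.
Proof.
case=> i _ <- [j _ <-].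
have [W hW /= sW] := nbase_directed (svalP i) (svalP j).
exists (ker_at (exist (fun V => nbase t V) W hW)); first exact: imageT.
by move=> x hx; split; apply: ker_mono hx => z /sW[].
Qed.

(* The kernels of the projections to the M / U. *)
Definition completion_top : lintop completion :=
  LinTop ker_submodule ker_neq0 ker_directed.

Let clinE k (x y : completion) (i : nidx t) m n : x i = coset (sval i) m ->
  y i = coset (sval i) n -> (k *: x + y) i = coset (sval i) (k *: m + n).
Proof. by move=> ex ey; exact: caddE (cscaleE k ex) ey. Qed.

Lemma ker_at_subP (x y : completion) i : ker_at i (x - y) <-> x i = y i.
Proof.
have [m em] := atP x i; have [n en] := atP y i.
have e : (x - y) i = coset (sval i) (m - n).
  by have := clinE (-1) en em; rewrite !scaleN1r ![- _ + _]addrC.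
have -> : ker_at i (x - y) = (coset (sval i) (m - n) = sval i) by rewrite -e.
split=> h.
  have : coset (sval i) (m - n) 0 by rewrite h.
  rewrite cosetE sub0r => /subN; rewrite opprK => hmn.
  rewrite em en; apply/seteqP; split=> z; rewrite !cosetE => hz.
    by rewrite -[z](subrK m) -addrA; exact: subD.
  by have := subD hz (subN hmn); rewrite opprB addrA subrK.
have : sval i (m - n) by apply/cosetE; rewrite -en -h em; apply/cosetE; rewrite subrr.
move=> hmn; apply/seteqP; split=> z; rewrite cosetE => hz.
  by rewrite -[z](subrK (m - n)); exact: subD.
by apply: subD => //; exact: subN.
Qed.

Lemma in_completion_linear : linear in_completion.
Proof. by move=> k u v; apply: completion_ext => i; rewrite (clinE k (m := u) (n := v)). Qed.

Lemma in_completion_continuous : continuous_lin t completion_top in_completion.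
Proof.
split=> [|_ [i _ <-]]; first exact: in_completion_linear.
exists (sval i) => [|m hm]; first exact: svalP.
apply/seteqP; split=> z; first by move/cosetE=> h; rewrite -[z](subrK m); exact: subD.
by move=> hz; apply/cosetE; apply: subD => //; exact: subN.
Qed.

Lemma in_completion_dense (x : completion) U :
  nbase completion_top U -> exists m, U (x - in_completion m).
Proof.
case=> i _ <-; have [m em] := coset_atP x i; exists m.
by apply/ker_at_subP; rewrite em.
Qed.

Lemma completion_complete : complete_top completion_top.
Proof.
split=> [z hz|x hx].
  apply: completion_ext => i; rewrite [RHS]coset0.
  by apply: (hz (ker_at i)); exact: imageT.
pose ik (i : nidx t) : nidx completion_top :=
  exist (fun U => nbase completion_top U) (ker_at i) (imageT _ _).
have xP i : exists m, x (ik i) i = coset (sval i) m by exact: coset_atP.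
have xc (i j : nidx t) : sval i `<=` sval j -> x (ik i) i `<=` x (ik j) j.
  move=> sij; have /ker_at_subP <- := hx (ik i) (ik j) (ker_mono sij).
  exact: coset_at_compat.
exists (Completion xP xc) => -[V hV] /=.
have [i eV] : exists i, ker_at i = V by case: (hV) => i _ eV; exists i.
have -> : exist (fun U => nbase completion_top U) V hV = ik i.
  by apply: eq_exist; rewrite /= eV.
by rewrite -eV; apply/ker_at_subP.
Qed.

(* The extension by continuity of a linear map to a complete module. *)
Definition complete_ext (C : lmodType K) (tC : lintop C) (g : M -> C)
    (x : completion) : C :=
  xget 0 [set c | forall O, nbase tC O ->
                    exists i, forall m, x i m -> O (g m - c)].

Section Extension.
Variables (C : lmodType K) (tC : lintop C) (hC : complete_top tC).
Variables (g : M -> C) (hg : continuous_lin t tC g).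

Let OP (O : set C) k u v : nbase tC O -> O u -> O v -> O (k *: u + v).
Proof. by move=> /nbase_submodule[_]; exact. Qed.
Let OD (O : set C) u v : nbase tC O -> O u -> O v -> O (u + v).
Proof. by move=> hO hu hv; rewrite -(scale1r u); exact: OP. Qed.
Let ON (O : set C) u : nbase tC O -> O u -> O (- u).
Proof.
move=> hO hu; rewrite -scaleN1r -[_ *: u]addr0; apply: OP => //.
exact: (nbase_submodule hO).1.
Qed.

Let gB m n : g (m - n) = g m - g n.
Proof. by have := hg.1 (-1) n m; rewrite !scaleN1r !(addrC (- _)). Qed.

Let is_lim (x : completion) (c : C) := forall O, nbase tC O ->
  exists i, forall m, x i m -> O (g m - c).

Let lim_ex x : exists c, is_lim x c.
Proof.
have H (j : nidx tC) : {i : nidx t & {m | x i m & forall n, x i n -> sval j (g n - g m)}}.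
  have [U hU sU] := cid2 (hg.2 _ (svalP j)).
  pose i : nidx t := exist (fun V => nbase t V) U hU.
  have [m em] := cid (coset_atP x i); exists i, m.
    by rewrite em; apply/cosetE; rewrite subrr.
  by move=> n; rewrite em => /cosetE h; rewrite -gB; exact: sU.
pose m j := s2val (projT2 (H j)).
have [j1 j2 s12|l hl] := hC.2 (fun j => g (m j)).
  rewrite /m; case: (H j1) => i1 [m1 x1 h1] /=; case: (H j2) => i2 [m2 x2 h2] /=.
  have [W hW sW] := nbase_directed (svalP i1) (svalP i2).
  pose i : nidx t := exist (fun V => nbase t V) W hW.
  have [n en] := coset_atP x i; have xn : x i n.
    by rewrite en; apply/cosetE; rewrite subrr.
  have s1 : sval i `<=` sval i1 by move=> z /sW[].
  have s2 : sval i `<=` sval i2 by move=> z /sW[].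
  have a1 := s12 _ (h1 _ (coset_at_compat s1 xn)).
  have a2 := h2 _ (coset_at_compat s2 xn).
  by have := OD (svalP j2) (ON (svalP j2) a1) a2; rewrite opprB addrA subrK.
exists l => O hO; pose j : nidx tC := exist (fun V => nbase tC V) O hO.
have := hl j; rewrite /m; case: (H j) => i [n xn hn] /= hnl.
exists i => p /hn hp; rewrite -(subrK (g n) (g p)) -addrA.
exact: (OD (svalP j)).
Qed.

Let lim_uniq x c d : is_lim x c -> is_lim x d -> c = d.
Proof.
move=> hc hd; apply/eqP; rewrite -subr_eq0; apply/eqP/hC.1 => O hO.
have [i hi] := hc O hO; have [j hj] := hd O hO.
have [W hW sW] := nbase_directed (svalP i) (svalP j).
pose k : nidx t := exist (fun V => nbase t V) W hW.
have [n en] := coset_atP x k; have xn : x k n.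
  by rewrite en; apply/cosetE; rewrite subrr.
have s1 : sval k `<=` sval i by move=> z /sW[].
have s2 : sval k `<=` sval j by move=> z /sW[].
have a1 := hi _ (coset_at_compat s1 xn).
have a2 := hj _ (coset_at_compat s2 xn).
by have := OD hO (ON hO a1) a2; rewrite opprB addrA subrK.
Qed.

Let ext_lim x : is_lim x (complete_ext tC g x).
Proof. exact: (xgetPex _ (lim_ex x)). Qed.

Lemma complete_ext_in m : complete_ext tC g (in_completion m) = g m.
Proof.
apply: lim_uniq (ext_lim _) _ => O hO; have [U hU sU] := hg.2 _ hO.
exists (exist (fun V => nbase t V) U hU) => n /cosetE h.
by rewrite -gB; exact: sU.
Qed.

Lemma complete_ext_continuous :
  continuous_lin completion_top tC (complete_ext tC g).
Proof.
split=> [k x y|O hO].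
  apply: lim_uniq (ext_lim _) _ => O hO.
  have [i hi] := ext_lim x hO; have [j hj] := ext_lim y hO.
  have [W hW sW] := nbase_directed (svalP i) (svalP j).
  have [U hU sU] := hg.2 _ hO.
  have [W' hW' sW'] := nbase_directed hW hU.
  pose l : nidx t := exist (fun V => nbase t V) W' hW'.
  have s1 : sval l `<=` sval i by move=> z /sW'[/sW[]].
  have s2 : sval l `<=` sval j by move=> z /sW'[/sW[]].
  have [m em] := coset_atP x l; have [n en] := coset_atP y l.
  exists l => p; rewrite (clinE k em en) => /cosetE hp.
  have a1 : O (g m - complete_ext tC g x).
    by apply/hi/(coset_at_compat s1); rewrite em; apply/cosetE; rewrite subrr.
  have a2 : O (g n - complete_ext tC g y).
    by apply/hj/(coset_at_compat s2); rewrite en; apply/cosetE; rewrite subrr.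
  have a3 : O (g p - g (k *: m + n)) by rewrite -gB; apply: sU; case: (sW' _ hp).
  have := OD hO a3 (OP k hO a1 a2).
  by rewrite hg.1 scalerBr [X in _ + X]addrACA -opprD addrA subrK.
have [U hU sU] := hg.2 _ hO; pose i : nidx t := exist (fun V => nbase t V) U hU.
exists (ker_at i) => [|x xi]; first exact: imageT.
have [j hj] := ext_lim x hO.
have [W hW sW] := nbase_directed (svalP i) (svalP j).
pose k : nidx t := exist (fun V => nbase t V) W hW.
have s1 : sval k `<=` sval i by move=> z /sW[].
have s2 : sval k `<=` sval j by move=> z /sW[].
have [n en] := coset_atP x k; have xn : x k n.
  by rewrite en; apply/cosetE; rewrite subrr.
have a1 : O (g n) by apply: sU; have := coset_at_compat s1 xn; rewrite xi.
have a2 := hj _ (coset_at_compat s2 xn).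
by have := OD hO a1 (ON hO a2); rewrite opprB addrC subrK.
Qed.

Lemma complete_ext_uniq (f : completion -> C) :
  continuous_lin completion_top tC f -> (forall m, f (in_completion m) = g m) ->
  f = complete_ext tC g.
Proof.
move=> [fl fc] fg; apply/funext => x; apply: lim_uniq (ext_lim x) => O hO.
have [_ [i _ <-] hi] := fc _ hO; exists i => m xm; rewrite -fg.
have := fl (-1) x (in_completion m); rewrite !scaleN1r !(addrC (- _)) => <-.
apply: hi; apply/ker_at_subP => /=; have [n en] := coset_atP x i.
rewrite en in xm *; move/cosetE: xm => hmn.
apply/seteqP; split=> z; rewrite !cosetE => hz.
  by rewrite -[z](subrK m) -addrA; exact: subD.
by have := subD hz (subN hmn); rewrite opprB addrA subrK.
Qed.

End Extension.

End Completion.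

(* A (x) B carries the linear topology with base U (x) B + A (x) V. *)
Section CompletedTensor.
Variables (K : comNzRingType) (A B : lmodType K) (tA : lintop A) (tB : lintop B).

Definition tensor_nbhd (U : set A) (V : set B) : set (tensor A B) :=
  [set z | exists2 s : seq (A * B),
     forall p, p \in s -> U p.1 \/ V p.2 & z = \sum_(p <- s) tens p.1 p.2].

Definition tensor_nbase : set (set (tensor A B)) :=
  [set W | exists U V, [/\ nbase tA U, nbase tB V & W = tensor_nbhd U V]].

Let nbhd_submodule W : tensor_nbase W -> is_submodule W.
Proof.
case=> U [V [hU hV ->]]; split; first by exists [::]; rewrite ?big_nil.
move=> k _ _ [s hs ->] [t ht ->]; exists ([seq (k *: p.1, p.2) | p <- s] ++ t).
  move=> p; rewrite mem_cat => /orP[/mapP[q /hs hq ->] /=|/ht//].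
  case: hq => h; [left|by right].
  by rewrite -[_ *: _]addr0; apply: (nbase_submodule hU).2 => //; exact: (nbase_submodule hU).1.
rewrite big_cat big_map scaler_sumr; congr (_ + _); apply: eq_bigr => p _ /=.
have f0 : tens (0 : A) p.2 = 0.
  by have /= := (tens_bilin A B).1 p.2 (-1) 0 0; rewrite scaler0 addr0 scaleN1r addNr.
by have /= := (tens_bilin A B).1 p.2 k p.1 0; rewrite f0 !addr0.
Qed.

Let nbhd_neq0 : tensor_nbase !=set0.
Proof.
have [U hU] := nbase_neq0 tA; have [V hV] := nbase_neq0 tB.
by exists (tensor_nbhd U V), U, V.
Qed.

Let nbhd_directed W W' : tensor_nbase W -> tensor_nbase W' ->
  exists2 X, tensor_nbase X & X `<=` W `&` W'.
Proof.
case=> U [V [hU hV ->]] [U' [V' [hU' hV' ->]]].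
have [X hX sX] := nbase_directed hU hU'; have [Y hY sY] := nbase_directed hV hV'.
exists (tensor_nbhd X Y); first by exists X, Y.
move=> _ [s hs ->]; split; exists s => // p /hs [/sX[]|/sY[]]; by [left|right].
Qed.

Definition tensor_top : lintop (tensor A B) :=
  LinTop nbhd_submodule nbhd_neq0 nbhd_directed.

Definition ctensor : lmodType K := completion tensor_top.
Definition ctensor_top : lintop ctensor := completion_top tensor_top.

Definition ctens (a : A) (b : B) : ctensor := in_completion tensor_top (tens a b).

Definition ctensor_lift (C : lmodType K) (tC : lintop C) (f : A -> B -> C) :
    ctensor -> C :=
  complete_ext tC (tensor_lift f).

Lemma ctensor_complete : complete_top ctensor_top.
Proof. exact: completion_complete. Qed.

Lemma ctens_continuous : continuous_bilin tA tB ctensor_top ctens.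
Proof.
have il := in_completion_linear tensor_top.
split.
  by split=> [b|a] k u v; rewrite /ctens -il;
    [have /= -> := (tens_bilin A B).1 b k u v|have /= -> := (tens_bilin A B).2 a k u v].
move=> W hW; have [_ [U [V [hU hV ->]]] sW] := (in_completion_continuous tensor_top).2 _ hW.
exists U, V; split => // a b hab; apply: sW; exists [:: (a, b)]; last by rewrite big_seq1.
by move=> p; rewrite inE => /eqP ->.
Qed.

Section UniversalProperty.
Variables (C : lmodType K) (tC : lintop C) (hC : complete_top tC).
Variables (f : A -> B -> C) (hf : continuous_bilin tA tB tC f).

Let lift_continuous : continuous_lin tensor_top tC (tensor_lift f).
Proof.
have fl := tensor_lift_linear hf.1; split=> // W hW.
have [U [V [hU hV hUV]]] := hf.2 _ hW.
exists (tensor_nbhd U V) => [|_ [s hs ->]]; first by exists U, V.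
elim: s hs => [|p s IHs] hs.
  rewrite big_nil; have := fl (-1) 0 0; rewrite scaler0 addr0 scaleN1r addNr => ->.
  exact: (nbase_submodule hW).1.
rewrite big_cons -[tens _ _]scale1r fl tensor_lift_tens; last exact: hf.1.
apply: (nbase_submodule hW).2; first by apply/hUV/hs; rewrite mem_head.
by apply: IHs => q qs; apply: hs; rewrite inE qs orbT.
Qed.

Lemma ctensor_lift_ctens a b : ctensor_lift tC f (ctens a b) = f a b.
Proof.
rewrite /ctensor_lift /ctens complete_ext_in //; apply: tensor_lift_tens; exact: hf.1.
Qed.

Lemma ctensor_lift_continuous :
  continuous_lin ctensor_top tC (ctensor_lift tC f).
Proof. exact: complete_ext_continuous. Qed.

Lemma ctensor_lift_uniq (g : ctensor -> C) :
  continuous_lin ctensor_top tC g -> (forall a b, g (ctens a b) = f a b) ->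
  g = ctensor_lift tC f.
Proof.
move=> gc gf; apply: complete_ext_uniq => // z.
have [gl _] := gc; have fl := tensor_lift_linear hf.1.
have il := in_completion_linear tensor_top.
rewrite (tensor_sum z); elim: (repr z) => [|p s IHs].
  rewrite big_nil.
  have i0 : in_completion tensor_top 0 = 0.
    by have := il (-1) 0 0; rewrite scaler0 addr0 scaleN1r addNr.
  rewrite i0; have := fl (-1) 0 0; rewrite scaler0 addr0 scaleN1r addNr => ->.
  by have := gl (-1) 0 0; rewrite scaler0 addr0 scaleN1r addNr => ->.
rewrite big_cons -[tens _ _]scale1r il gl fl IHs tensor_lift_tens; last exact: hf.1.
by congr (_ *: _ + _); exact: gf.
Qed.

End UniversalProperty.
End CompletedTensor.

Notation "a ⊗ b" := (tens a b) (at level 40, left associativity) : ring_scope.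
Notation "a ⊗^ b" := (ctens _ _ a b) (at level 40, left associativity) : ring_scope.

(* Algebras, coalgebras and Hopf algebras over K with algebraic tensor
   products; the operations are unbundled because several products are
   considered on the same module. *)
Section Hopf.
Variable K : comNzRingType.

Record is_algebra (A : lmodType K) (mul : A -> A -> A) (one : A) : Prop := {
  alg_bilin : bilin mul;
  alg_mulA : associative mul;
  alg_mul1l : left_id one mul;
  alg_mul1r : right_id one mul
}.

Definition tensor_mul (A B : lmodType K) (mulA : A -> A -> A)
    (mulB : B -> B -> B) (x y : tensor A B) : tensor A B :=
  tensor_lift (fun a b => tensor_lift (fun c d => mulA a c ⊗ mulB b d) y) x.

Record is_coalgebra (A : lmodType K) (cop : A -> tensor A A) (eps : A -> K)
    : Prop := {
  coalg_cop_linear : linear cop;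
  coalg_eps_linear : scalar eps;
  coalg_coassoc : forall a,
    tensor_lift (fun a1 a2 => tensor_lift (fun b1 b2 => b1 ⊗ (b2 ⊗ a2)) (cop a1))
      (cop a) =
    tensor_lift (fun a1 a2 => a1 ⊗ cop a2) (cop a);
  coalg_counitl : forall a, tensor_lift (fun a1 a2 => eps a1 *: a2) (cop a) = a;
  coalg_counitr : forall a, tensor_lift (fun a1 a2 => eps a2 *: a1) (cop a) = a
}.

Record is_hopf (A : lmodType K) (mul : A -> A -> A) (one : A)
    (cop : A -> tensor A A) (eps : A -> K) (anti : A -> A) : Prop := {
  hopf_algebra : is_algebra mul one;
  hopf_coalgebra : is_coalgebra cop eps;
  hopf_copM : forall a b, cop (mul a b) = tensor_mul mul mul (cop a) (cop b);
  hopf_cop1 : cop one = one ⊗ one;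
  hopf_epsM : forall a b, eps (mul a b) = eps a * eps b;
  hopf_eps1 : eps one = 1;
  hopf_anti_linear : linear anti;
  hopf_antil : forall a,
    tensor_lift (fun a1 a2 => mul (anti a1) a2) (cop a) = eps a *: one;
  hopf_antir : forall a,
    tensor_lift (fun a1 a2 => mul a1 (anti a2)) (cop a) = eps a *: one
}.

Record is_right_comodule_algebra (A : lmodType K) (mulA : A -> A -> A) (oneA : A)
    (C : lmodType K) (mulC : C -> C -> C) (oneC : C) (copC : C -> tensor C C)
    (epsC : C -> K) (coact : A -> tensor A C) : Prop := {
  coact_algebra : is_algebra mulA oneA;
  coact_hopf : exists anti, is_hopf mulC oneC copC epsC anti;
  coact_linear : linear coact;
  coactM : forall a b,
    coact (mulA a b) = tensor_mul mulA mulC (coact a) (coact b);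
  coact1 : coact oneA = oneA ⊗ oneC;
  coact_coassoc : forall a,
    tensor_lift (fun b c => b ⊗ copC c) (coact a) =
    tensor_lift (fun b c => tensor_lift (fun b' c' => b' ⊗ (c' ⊗ c)) (coact b))
      (coact a);
  coact_counit : forall a, tensor_lift (fun b c => epsC c *: b) (coact a) = a
}.

End Hopf.

(* Hopf algebras that are complete for a linear topology, with completed tensor
   products, over a ground ring that is itself complete; all maps are
   continuous.  For discrete topologies the completions are trivial and these
   are the usual Hopf algebras. *)
Section TopologicalHopf.
Variables (K : comNzRingType) (tK : lintop (K^o : lmodType K)).
Variables (H : algType K) (tH : lintop H).

Definition ctensor_mul (A B : lmodType K) (tA : lintop A) (tB : lintop B)
    (mulA : A -> A -> A) (mulB : B -> B -> B) (x y : ctensor tA tB)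
    : ctensor tA tB :=
  ctensor_lift (ctensor_top tA tB) (fun a b =>
    ctensor_lift (ctensor_top tA tB) (fun c d => mulA a c ⊗^ mulB b d) y) x.

Let H2 : lmodType K := ctensor tH tH.
Let tH2 : lintop H2 := ctensor_top tH tH.
Let H3 : lmodType K := ctensor tH2 tH.
Let tH3 : lintop H3 := ctensor_top tH2 tH.

Definition mul2 : H2 -> H2 -> H2 := ctensor_mul *%R *%R.
Definition mul3 : H3 -> H3 -> H3 := ctensor_mul mul2 *%R.

Record is_top_algebra : Prop := {
  top_alg_ground : complete_top tK;
  top_alg_complete : complete_top tH;
  top_alg_mul : continuous_bilin tH tH tH *%R;
  top_alg_unit : continuous_lin tK tH (fun k : K => k%:A)
}.

(* Delta (x) id and id (x) Delta. *)
Definition cop_l (cop : H -> H2) : H2 -> H3 :=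
  ctensor_lift tH3 (fun x y => cop x ⊗^ y).
Definition cop_r (cop : H -> H2) : H2 -> H3 :=
  ctensor_lift tH3 (fun x y =>
    ctensor_lift tH3 (fun y1 y2 => (x ⊗^ y1) ⊗^ y2) (cop y)).
Definition flip : H2 -> H2 := ctensor_lift tH2 (fun x y => y ⊗^ x).

Record is_top_hopf (cop : H -> H2) (eps : H -> K) (anti : H -> H) : Prop := {
  top_hopf_algebra : is_top_algebra;
  top_hopf_cop : continuous_lin tH tH2 cop;
  top_hopf_eps : continuous_lin tH tK (eps : H -> K^o);
  top_hopf_anti : continuous_lin tH tH anti;
  top_hopf_copM : forall x y, cop (x * y) = mul2 (cop x) (cop y);
  top_hopf_cop1 : cop 1 = 1 ⊗^ 1;
  top_hopf_epsM : forall x y, eps (x * y) = eps x * eps y;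
  top_hopf_eps1 : eps 1 = 1;
  top_hopf_coassoc : forall x, cop_l cop (cop x) = cop_r cop (cop x);
  top_hopf_counitl : forall x,
    ctensor_lift tH (fun x1 x2 => eps x1 *: x2) (cop x) = x;
  top_hopf_counitr : forall x,
    ctensor_lift tH (fun x1 x2 => eps x2 *: x1) (cop x) = x;
  top_hopf_antil : forall x,
    ctensor_lift tH (fun x1 x2 => anti x1 * x2) (cop x) = eps x *: 1;
  top_hopf_antir : forall x,
    ctensor_lift tH (fun x1 x2 => x1 * anti x2) (cop x) = eps x *: 1
}.

Definition leg12 : H2 -> H3 := fun R => R ⊗^ 1.
Definition leg13 : H2 -> H3 := ctensor_lift tH3 (fun x y => (x ⊗^ 1) ⊗^ y).
Definition leg23 : H2 -> H3 := ctensor_lift tH3 (fun x y => (1 ⊗^ x) ⊗^ y).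

Record is_universal_Rmatrix (cop : H -> H2) (R Rinv : H2) : Prop := {
  Rmatrix_mulV : mul2 R Rinv = 1 ⊗^ 1;
  Rmatrix_mulVl : mul2 Rinv R = 1 ⊗^ 1;
  Rmatrix_copl : cop_l cop R = mul3 (leg13 R) (leg23 R);
  Rmatrix_copr : cop_r cop R = mul3 (leg13 R) (leg12 R);
  Rmatrix_cop : forall x, mul2 R (cop x) = mul2 (flip (cop x)) R
}.

(* A finite dimensional representation is on a free module K^n. *)
Definition is_representation (n : nat) (rho : H -> 'M[K]_n) :=
  [/\ rho 1 = 1%:M, forall x y, rho (x * y) = rho x *m rho y &
      forall i j, continuous_lin tH tK (fun x => rho x i j : K^o)].

Definition is_matrix_coefficient (f : H -> K) :=
  exists (n : nat) (rho : H -> 'M[K]_n), is_representation rho /\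
  exists i j, f = fun x => rho x i j.

Section Dual.
Variables (D : algType K).

(* <a (x) b, T> for T in the completed square of H. *)
Definition pair2 (pair : D -> H -> K) (a b : D) : H2 -> K :=
  ctensor_lift tK (fun x y => pair a x * pair b y).

(* The pairing identifies D with the span of the matrix coefficients.  The
   coproduct of a matrix coefficient is a finite sum, so that no completion is
   needed for D and its algebraic tensor powers. *)
Record is_dual_hopf (cop : H -> H2) (eps : H -> K) (anti : H -> H)
    (copD : D -> tensor D D) (epsD : D -> K) (antiD : D -> D)
    (pair : D -> H -> K) : Prop := {
  dual_hopf : is_hopf *%R 1 copD epsD antiD;
  dual_linear : forall x, scalar (pair^~ x);
  dual_inj : forall a, (forall x, pair a x = 0) -> a = 0;
  dual_continuous : forall a, continuous_lin tH tK (pair a : H -> K^o);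
  dual_coefficient : forall f, is_matrix_coefficient f ->
    exists a, pair a = f;
  dual_span : forall a, exists (n : nat) (c : 'I_n -> K) (f : 'I_n -> H -> K),
    (forall i, is_matrix_coefficient (f i)) /\
    forall x, pair a x = \sum_(i < n) c i * f i x;
  dual_separates : forall x, (forall a, pair a x = 0) -> x = 0;
  dual_mul : forall a b x, pair (a * b) x = pair2 pair a b (cop x);
  dual_one : forall x, pair 1 x = eps x;
  dual_cop : forall a x y,
    pair a (x * y) = tensor_lift (fun a1 a2 => pair a1 x * pair a2 y) (copD a);
  dual_eps : forall a, epsD a = pair a 1;
  dual_anti : forall a x, pair (antiD a) x = pair a (anti x)
}.

Variables (copD : D -> tensor D D) (epsD : D -> K) (antiD : D -> D).
Variable pair : D -> H -> K.

Definition tflip (A B : lmodType K) : tensor A B -> tensor B A :=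
  tensor_lift (fun a b => b ⊗ a).

(* For u = u1 (x) u2, v = v1 (x) v2 and T in the completed square of H, this is
   (u1 (x) v1) <u2 (x) v2, T>.  Since x |> a = a_(1) <a_(2), x> and
   a <| x = <a_(1), x> a_(2), taking for u either copD a or its flip gives
   T_1 |> a resp. a <| T_1 in the first factor, and likewise v and T_2. *)
Definition contract (T : H2) (u v : tensor D D) : tensor D D :=
  tensor_lift (fun u1 u2 : D =>
    tensor_lift (fun v1 v2 : D => pair2 pair u2 v2 T *: (u1 ⊗ v1)) v) u.

Definition lact (x : H) (a : D) : D :=
  tensor_lift (fun a1 a2 => pair a2 x *: a1) (copD a).
Definition ract (a : D) (x : H) : D :=
  tensor_lift (fun a1 a2 => pair a1 x *: a2) (copD a).

(* T_1 |> a (x) T_2 |> b *)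
Definition act_ll (T : H2) : tensor D D -> tensor D D :=
  tensor_lift (fun a b => contract T (copD a) (copD b)).
(* T_1 |> a (x) b <| T_2 *)
Definition act_lr (T : H2) : tensor D D -> tensor D D :=
  tensor_lift (fun a b => contract T (copD a) (tflip (copD b))).
(* a <| T_1 (x) b <| T_2 *)
Definition act_rr (T : H2) : tensor D D -> tensor D D :=
  tensor_lift (fun a b => contract T (tflip (copD a)) (tflip (copD b))).

(* These agree with the coregular actions on decomposable T. *)
Section Decomposable.
Hypothesis tK_complete : complete_top tK.
Hypothesis copD_linear : linear copD.
Hypothesis pair_linear : forall x, scalar (pair^~ x).
Hypothesis pair_continuous : forall a, continuous_lin tH tK (pair a : H -> K^o).

Lemma pair2_ctens a b x y : pair2 pair a b (x ⊗^ y) = pair a x * pair b y.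
Proof.
apply: (ctensor_lift_ctens (C := K^o) tK_complete); split.
  split=> [v|u] k u1 u2 /=.
    by have /= -> := (pair_continuous a).1 k u1 u2; rewrite mulrDl -mulrA.
  by have /= -> := (pair_continuous b).1 k u1 u2; rewrite mulrDr mulrCA.
move=> I hI; have [U hU sU] := (pair_continuous a).2 _ hI.
have [V hV sV] := (pair_continuous b).2 _ hI; exists U, V; split => // u v [/sU|/sV] h.
  rewrite mulrC -[_ * _]addr0.
  by apply: (nbase_submodule hI).2 => //; exact: (nbase_submodule hI).1.
rewrite -[_ * _]addr0.
by apply: (nbase_submodule hI).2 => //; exact: (nbase_submodule hI).1.
Qed.

Let tens_suml (I : Type) (r : seq I) (F : I -> D) (c : I -> K) (b : D) :
  (\sum_(i <- r) c i *: F i) ⊗ b = \sum_(i <- r) c i *: (F i ⊗ b).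
Proof.
have L := (tens_bilin D D).1 b; elim: r => [|i r IHr].
  by rewrite !big_nil; have /= := L (-1) 0 0; rewrite scaler0 addr0 scaleN1r addNr.
by rewrite !big_cons -IHr; exact: L.
Qed.

Let tens_sumr (I : Type) (r : seq I) (F : I -> D) (c : I -> K) (a : D) :
  a ⊗ (\sum_(i <- r) c i *: F i) = \sum_(i <- r) c i *: (a ⊗ F i).
Proof.
have L := (tens_bilin D D).2 a; elim: r => [|i r IHr].
  by rewrite !big_nil; have /= := L (-1) 0 0; rewrite scaler0 addr0 scaleN1r addNr.
by rewrite !big_cons -IHr; exact: L.
Qed.

Lemma contract_ctens x y u v :
  contract (x ⊗^ y) u v =
  tensor_lift (fun u1 u2 : D => pair u2 x *: u1) u ⊗
  tensor_lift (fun v1 v2 : D => pair v2 y *: v1) v.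
Proof.
rewrite /contract /tensor_lift /eval_pairs tens_suml; apply: eq_bigr => p _.
rewrite tens_sumr scaler_sumr; apply: eq_bigr => q _.
by rewrite pair2_ctens scalerA.
Qed.

Let bilin_l x : bilin (fun a1 a2 : D => pair a2 x *: a1).
Proof.
split=> [a2|a1] k u v /=; first by rewrite scalerDr !scalerA mulrC.
by rewrite pair_linear scalerDl scalerA.
Qed.

Let bilin_r x : bilin (fun a1 a2 : D => pair a1 x *: a2).
Proof.
split=> [a2|a1] k u v /=; last by rewrite scalerDr !scalerA mulrC.
by rewrite pair_linear scalerDl scalerA.
Qed.

Let lift_tflip x (z : tensor D D) :
  tensor_lift (fun a1 a2 : D => pair a2 x *: a1) (tflip z) =
  tensor_lift (fun a1 a2 : D => pair a1 x *: a2) z.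
Proof.
have L := tensor_lift_linear (bilin_l x).
rewrite /tflip {2}/tensor_lift [tensor_lift _ z]/tensor_lift /eval_pairs.
elim: (repr z) => [|p r IHr].
  by rewrite !big_nil; have /= := L (-1) 0 0; rewrite scaler0 addr0 scaleN1r addNr.
by rewrite !big_cons -[_ ⊗ _]scale1r L scale1r IHr tensor_lift_tens.
Qed.

Let lact_linear x : linear (lact x).
Proof. by move=> k u v; rewrite /lact copD_linear tensor_lift_linear. Qed.
Let ract_linear x : linear (ract^~ x).
Proof. by move=> k u v; rewrite /ract copD_linear tensor_lift_linear. Qed.

Let bilin_tens (f g : D -> D) : linear f -> linear g ->
  bilin (fun a b => f a ⊗ g b).
Proof.
move=> fl gl; split=> [b|a] k u v; rewrite ?fl ?gl.
  exact: (tens_bilin D D).1.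
exact: (tens_bilin D D).2.
Qed.

Lemma act_ll_ctens x y a b : act_ll (x ⊗^ y) (a ⊗ b) = lact x a ⊗ lact y b.
Proof.
have -> : act_ll (x ⊗^ y) = tensor_lift (fun a b => lact x a ⊗ lact y b).
  by congr tensor_lift; do 2!apply/funext => ?; exact: contract_ctens.
by rewrite tensor_lift_tens; last exact: bilin_tens.
Qed.

Lemma act_lr_ctens x y a b : act_lr (x ⊗^ y) (a ⊗ b) = lact x a ⊗ ract b y.
Proof.
have -> : act_lr (x ⊗^ y) = tensor_lift (fun a b => lact x a ⊗ ract b y).
  congr tensor_lift; do 2!apply/funext => ?.
  by rewrite contract_ctens lift_tflip.
by rewrite tensor_lift_tens; last exact: (bilin_tens (lact_linear x) (ract_linear y)).
Qed.

Lemma act_rr_ctens x y a b : act_rr (x ⊗^ y) (a ⊗ b) = ract a x ⊗ ract b y.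
Proof.
have -> : act_rr (x ⊗^ y) = tensor_lift (fun a b => ract a x ⊗ ract b y).
  congr tensor_lift; do 2!apply/funext => ?.
  by rewrite contract_ctens !lift_tflip.
by rewrite tensor_lift_tens; last exact: (bilin_tens (ract_linear x) (ract_linear y)).
Qed.

End Decomposable.

(* id (x) gamma *)
Definition anti_r (anti : H -> H) : H2 -> H2 :=
  ctensor_lift tH2 (fun x y => x ⊗^ anti y).

(* The product of the reflection equation dual:
     R_1 |> a <| R_1' times b <| gamma(R_2) <| R_2'. *)
Definition re_mul (anti : H -> H) (R : H2) (a b : D) : D :=
  tensor_lift *%R (act_rr R (act_lr (anti_r anti R) (a ⊗ b))).

(* The dual of the twisted tensor square, on the coalgebra D (x) D: the
   transpose of the coproduct z |-> R_23^-1 (Delta z) R_23, i.e.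
     (al (x) be) (et (x) xi) =
       al (R_2 |> et <| R^-1_2') (x) (R_1 |> be <| R^-1_1') xi. *)
Definition twisted_mul (R Rinv : H2) (z w : tensor D D) : tensor D D :=
  tensor_lift (fun al be =>
    tensor_lift (fun et xi =>
      tensor_lift (fun be' et' => (al * et') ⊗ (be' * xi))
        (act_rr Rinv (act_ll R (be ⊗ et)))) w) z.

Definition square_cop : tensor D D -> tensor (tensor D D) (tensor D D) :=
  tensor_lift (fun al be =>
    tensor_lift (fun al1 al2 =>
      tensor_lift (fun be1 be2 => (al1 ⊗ be1) ⊗ (al2 ⊗ be2)) (copD be))
      (copD al)).

Definition square_eps : tensor D D -> K :=
  tensor_lift (fun al be => epsD al * epsD be).

Definition re_coaction : D -> tensor D (tensor D D) := fun et =>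
  tensor_lift (fun et1 et23 =>
    tensor_lift (fun et2 et3 => et2 ⊗ (antiD et1 ⊗ et3)) (copD et23)) (copD et).

End Dual.
End TopologicalHopf.

(* Main.v *)
(* Everything is transported to the dual D.  Pairing the axioms of R with
   matrix coefficients shows that r(a, b) = <a (x) b, R> is a coquasitriangular
   structure on D, with convolution inverse rb(a, b) = r(S a, b).  The two
   products become
     a . b = r(a_1, b_2) r(a_3, S b_1) a_2 b_3,
     (al (x) be)(et (x) xi) = rb(be_1, et_1) r(be_3, et_3) al et_2 (x) be_2 xi.
   Associativity of the first one is the Yang-Baxter equation for r together
   with its variant for r(-, S -).  The second one is a cocycle twist; since
   al (x) be = (al (x) 1)(1 (x) be), its antipode is
   al (x) be |-> (1 (x) S be)(S al (x) 1).  In delta(a) delta(b) the factors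
   r(a_4, S b_4) and rb(a_5, S b_3) cancel, and what is left is delta(a . b) by
   quasi-commutativity r(a_1, b_1) a_2 b_2 = b_1 a_1 r(a_2, b_2). *)
Require Import Defs.
From mathcomp Require Import all_boot all_algebra.
From mathcomp Require Import boolp classical_sets.
From mathcomp Require Import ring.

Set Implicit Arguments.
Unset Strict Implicit.
Unset Printing Implicit Defensive.

Import GRing.Theory.
Local Open Scope ring_scope.

(** The element [R] lives in a completed tensor product and need not be a finite sum, so it is never
    decomposed: it enters only through the scalars [pair2 tK pair a b R], and each identity between
    continuous functionals is checked on pure tensors and extended by density. Coproducts in [D] are
    finite sums, so the whole argument after this translation is free of topology. The algebra is a
    computation with Sweedler indices. A tensor is a class of lists, and the summands of an iterated
    coproduct depend on the chosen representatives; two such families can be compared only after a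
    multilinear function has been summed over them. This is why multilinearity is carried along
    everywhere. The computations then consist of a few moves: regrouping consecutive legs, inserting
    or removing a counit, collapsing an antipode, and applying a known identity inside a block of
    neighbouring legs. *)

Section Linear.
Variable K : comNzRingType.
Implicit Types (L M N : lmodType K).

(** * Linear maps, finite sums and pure tensors *)

Lemma linear_zero M N (f : M -> N) : linear f -> f 0 = 0.
Proof. by move=> fl; have := fl (-1) 0 0; rewrite scaler0 addr0 scaleN1r addNr. Qed.

Lemma linear_add M N (f : M -> N) : linear f -> {morph f : u v / u + v}.
Proof. by move=> fl u v; have := fl 1 u v; rewrite !scale1r. Qed.

Lemma linear_scale M N (f : M -> N) : linear f -> forall k u, f (k *: u) = k *: f u.
Proof. by move=> fl k u; have := fl k u 0; rewrite (linear_zero fl) !addr0. Qed.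

Lemma linear_fun_sum M N (f : M -> N) I (r : seq I) (G : I -> M) : linear f ->
  f (\sum_(i <- r) G i) = \sum_(i <- r) f (G i).
Proof.
move=> fl; elim: r => [|i r IHr]; first by rewrite !big_nil (linear_zero fl).
by rewrite !big_cons (linear_add fl) IHr.
Qed.

Lemma linear_id M : linear (fun u : M => u).
Proof. by []. Qed.

Lemma linear_comp L M N (f : M -> N) (g : L -> M) :
  linear f -> linear g -> linear (fun u => f (g u)).
Proof. by move=> fl gl k u v; rewrite gl fl. Qed.

Lemma linear_scaler M N (c : K) (g : M -> N) : linear g -> linear (fun u => c *: g u).
Proof. by move=> gl k u v /=; rewrite gl scalerDr !scalerA mulrC. Qed.

Lemma linear_scalel M N (c : M -> K^o) (w : N) :
  linear c -> linear (fun u => (c u : K) *: w).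
Proof. by move=> cl k u v /=; rewrite cl scalerDl scalerA. Qed.

Lemma linear_coefr M (c : K) (g : M -> K^o) : linear g -> linear (fun u => (c * g u : K) : K^o).
Proof. by move=> gl k u v /=; rewrite gl mulrDr mulrCA. Qed.

Lemma linear_coefl M (c : K) (g : M -> K^o) : linear g -> linear (fun u => (g u * c : K) : K^o).
Proof. by move=> gl k u v /=; rewrite gl mulrDl -mulrA. Qed.

Lemma linear_mulr M (D : algType K) (a : D) (g : M -> D) :
  linear g -> linear (fun u => a * g u).
Proof. by move=> gl k u v /=; rewrite gl mulrDr scalerAr. Qed.

Lemma linear_mull M (D : algType K) (a : D) (g : M -> D) :
  linear g -> linear (fun u => g u * a).
Proof. by move=> gl k u v /=; rewrite gl mulrDl scalerAl. Qed.

Lemma linear_tensr L M N (a : M) (g : L -> N) : linear g -> linear (fun u => a ⊗ g u).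
Proof. by move=> gl k u v /=; rewrite gl; exact: (tens_bilin M N).2. Qed.

Lemma linear_tensl L M N (b : N) (g : L -> M) : linear g -> linear (fun u => g u ⊗ b).
Proof. by move=> gl k u v /=; rewrite gl; exact: (tens_bilin M N).1. Qed.

Lemma linear_bigop M N I (r : seq I) (G : I -> M -> N) :
  (forall i, linear (G i)) -> linear (fun u => \sum_(i <- r) G i u).
Proof.
move=> Gl k u v /=; rewrite scaler_sumr -big_split; apply: eq_bigr => i _.
exact: Gl.
Qed.

(** Carries a scalar identity such as the Yang-Baxter equation into the coefficients of a fixed
    vector [w], the untouched coefficients being collected in [k]. *)
Lemma eq_scale_sum3 M (I J T : Type) (rI : seq I) (rJ : seq J) (rL : seq T)
    (f g : I -> J -> T -> K)
    (k : K) (w : M) :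
  \sum_(i <- rI) \sum_(j <- rJ) \sum_(l <- rL) f i j l =
  \sum_(i <- rI) \sum_(j <- rJ) \sum_(l <- rL) g i j l ->
  \sum_(i <- rI) \sum_(j <- rJ) \sum_(l <- rL) (f i j l * k) *: w =
  \sum_(i <- rI) \sum_(j <- rJ) \sum_(l <- rL) (g i j l * k) *: w.
Proof.
have E (h : I -> J -> T -> K) :
    \sum_(i <- rI) \sum_(j <- rJ) \sum_(l <- rL) (h i j l * k) *: w =
    ((\sum_(i <- rI) \sum_(j <- rJ) \sum_(l <- rL) h i j l) * k) *: w.
  by do 3![rewrite mulr_suml scaler_suml; apply: eq_bigr => ? _].
by rewrite !E => ->.
Qed.

Lemma scale_sum2 M (I J : Type) (rI : seq I) (rJ : seq J) (f : I -> J -> K) (k : K) (w : M) :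
  \sum_(i <- rI) \sum_(j <- rJ) (f i j * k) *: w =
  ((\sum_(i <- rI) \sum_(j <- rJ) f i j) * k) *: w.
Proof. by do 2![rewrite mulr_suml scaler_suml; apply: eq_bigr => ? _]. Qed.

Lemma tens_suml L M I (r : seq I) (G : I -> L) (b : M) :
  (\sum_(i <- r) G i) ⊗ b = \sum_(i <- r) G i ⊗ b.
Proof. exact: (linear_fun_sum _ _ (linear_tensl b (@linear_id L))). Qed.

Lemma tens_sumr L M I (r : seq I) (G : I -> M) (a : L) :
  a ⊗ (\sum_(i <- r) G i) = \sum_(i <- r) a ⊗ G i.
Proof. exact: (linear_fun_sum _ _ (linear_tensr a (@linear_id M))). Qed.

Lemma tensZl L M k (a : L) (b : M) : (k *: a) ⊗ b = k *: (a ⊗ b).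
Proof. exact: (linear_scale (linear_tensl b (@linear_id L))). Qed.

Lemma tensZr L M k (a : L) (b : M) : a ⊗ (k *: b) = k *: (a ⊗ b).
Proof. exact: (linear_scale (linear_tensr a (@linear_id M))). Qed.

Lemma linear_tensor_lift L M N (f : L -> M -> N) (X : lmodType K) (g : X -> tensor L M) :
  bilin f -> linear g -> linear (fun x => tensor_lift f (g x)).
Proof. by move=> fb; apply: linear_comp; exact: tensor_lift_linear. Qed.

Lemma tensor_linear_ext L M N (f g : tensor L M -> N) : linear f -> linear g ->
  (forall a b, f (a ⊗ b) = g (a ⊗ b)) -> forall z, f z = g z.
Proof.
move=> fl gl fg z; rewrite (tensor_sum z) !linear_fun_sum //.
exact: eq_bigr.
Qed.

Lemma tensor_lift_sum L M N (f : L -> M -> N) z :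
  tensor_lift f z = \sum_(p <- repr z) f p.1 p.2.
Proof. by []. Qed.

Lemma linear_lift L M N (X : lmodType K) (f : L -> M -> N) (g : N -> X) z :
  linear g -> g (tensor_lift f z) = tensor_lift (fun a b => g (f a b)) z.
Proof. exact: linear_fun_sum. Qed.

Lemma eq_tensor_lift L M N (f g : L -> M -> N) z : f =2 g -> tensor_lift f z = tensor_lift g z.
Proof. by move=> fg; apply: eq_bigr => p _. Qed.

End Linear.

(** * Legs of iterated coproducts *)

Definition scons T (x : T) (s : nat -> T) : nat -> T :=
  fun n => if n is m.+1 then s m else x.

(** Legs are kept in streams rather than in tuples, so that regrouping requires no cast between
    lengths. The index [k] stands for [k.+1] entries, since a [k]-fold coproduct has one leg more
    than [k]. *)
Fixpoint prepend T k (u s : nat -> T) : nat -> T :=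
  scons (u 0%N) (if k is k'.+1 then prepend k' (fun j => u j.+1) s else s).

(* The legs [s] with [s i] replaced by the [k.+1] legs [u]. *)
Fixpoint splice T i k (u s : nat -> T) : nat -> T :=
  if i is i'.+1 then scons (s 0%N) (splice i' k u (fun j => s j.+1))
  else prepend k u (fun j => s j.+1).

Fixpoint remove T i (s : nat -> T) : nat -> T :=
  if i is i'.+1 then scons (s 0%N) (remove i' (fun j => s j.+1)) else fun j => s j.+1.

(** Linearity in each of the entries [0, ..., n]. The tail [s] ranges over all streams, which makes
    the condition pass to [F (scons d s)] by mere projection and lets it follow the recursion of
    [legs]. *)
Fixpoint multilinear (K : comNzRingType) (D M : lmodType K) n (F : (nat -> D) -> M) : Prop :=
  (forall s, linear (fun d => F (scons d s))) /\
  (if n is m.+1 then forall d, multilinear m (fun s => F (scons d s)) else True).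
Arguments multilinear {K D M} n F.

Section Sweedler.
Variables (K : comNzRingType) (D : lmodType K).
Variables (cop : D -> tensor D D) (eps : D -> K).
Hypothesis coalgD : is_coalgebra cop eps.

(* The summands [a_1 (x) ... (x) a_(n+1)] of the iterated coproduct of [a]; the
   leg [a_(i+1)] is entry [i], and the entries after the last leg are 0. *)
Fixpoint legs n (a : D) : seq (nat -> D) :=
  if n is m.+1 then [seq scons p.1 s | p <- repr (cop a), s <- legs m p.2]
  else [:: scons a (fun=> 0)].

Arguments legs : simpl never.

Section Sums.
Variable M : lmodType K.
Implicit Types F : (nat -> D) -> M.

Lemma sum_legs0 a F : \sum_(s <- legs 0 a) F s = F (scons a (fun=> 0)).
Proof. by rewrite big_seq1. Qed.

Lemma sum_legsS n a F : \sum_(s <- legs n.+1 a) F s =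
  tensor_lift (fun a1 a2 => \sum_(s <- legs n a2) F (scons a1 s)) (cop a).
Proof. by rewrite /= big_allpairs_dep. Qed.

Lemma sum_legs1 a F : \sum_(s <- legs 1 a) F s =
  tensor_lift (fun a1 a2 => F (scons a1 (scons a2 (fun=> 0)))) (cop a).
Proof. by rewrite sum_legsS; apply: eq_tensor_lift => a1 a2; exact: sum_legs0. Qed.

Lemma multilinear_prependl n k F s : multilinear (n + k).+1 F ->
  multilinear k (fun u => F (prepend k u s)).
Proof.
elim: k F => [|k IHk] F [F1 FS]; first by split=> // u; exact: F1.
split=> [u|d]; first exact: (F1 (prepend k u s)).
apply: (IHk (fun u => F (scons d u))); rewrite -addnS; exact: FS.
Qed.

Lemma multilinear_prependr n k F u : multilinear (n + k).+1 F ->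
  multilinear n (fun s => F (prepend k u s)).
Proof.
elim: k u F => [|k IHk] u F [_ FS]; first by rewrite addn0 in FS; exact: FS.
apply: (IHk _ (fun s => F (scons (u 0%N) s))); rewrite -addnS; exact: FS.
Qed.

Lemma multilinear_sum n I (r : seq I) (G : I -> (nat -> D) -> M) :
  (forall i, multilinear n (G i)) -> multilinear n (fun s => \sum_(i <- r) G i s).
Proof.
elim: n G => [|n IHn] G Gm.
  by split=> // s; apply: linear_bigop => i; exact: (Gm i).1.
split=> [s|d]; first by apply: linear_bigop => i; exact: (Gm i).1.
by apply: (IHn (fun i s => G i (scons d s))) => i; exact: (Gm i).2.
Qed.

(** The list [legs n a] itself is not linear in [a], because [repr] is an arbitrary choice. The sum
    is: it is the lift of a bilinear map evaluated at [cop a], by induction on [n]. *)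
Lemma legs_linear n F : multilinear n F -> linear (fun a => \sum_(s <- legs n a) F s).
Proof.
elim: n F => [|n IHn] F [F0 FS].
  by move=> k u v; rewrite !sum_legs0; exact: F0.
move=> k u v; rewrite !sum_legsS.
have fb : bilin (fun a1 a2 => \sum_(s <- legs n a2) F (scons a1 s)).
  by split=> [a2|a1]; [apply: linear_bigop => s; exact: F0 | exact: (IHn _ (FS a1))].
by rewrite (coalg_cop_linear coalgD) tensor_lift_linear.
Qed.

Lemma bilin_legs n (F : D -> (nat -> D) -> M) :
  (forall s, linear (F^~ s)) -> (forall d, multilinear n (F d)) ->
  bilin (fun a1 a2 => \sum_(s <- legs n a2) F a1 s).
Proof.
move=> Fl Fr; split=> [a2|a1]; first by apply: linear_bigop => s; exact: Fl.
exact: legs_linear.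
Qed.

(** The trilinear [B] induces a linear map on the triple tensor product, namely the lift of [T];
    applying it to the coassociativity axiom gives the claim. *)
Lemma coassoc_lift (B : D -> D -> D -> M) :
  (forall y z, linear (fun x => B x y z)) -> (forall x z, linear (fun y => B x y z)) ->
  (forall x y, linear (B x y)) -> forall a,
  tensor_lift (fun a1 a2 => tensor_lift (fun x y => B x y a2) (cop a1)) (cop a) =
  tensor_lift (fun a1 a2 => tensor_lift (fun y z => B a1 y z) (cop a2)) (cop a).
Proof.
move=> B1 B2 B3 a; pose T x := tensor_lift (fun y z => B x y z).
have Tb x : bilin (fun y z => B x y z) by split=> [z|y]; [exact: B2 | exact: B3].
have TB : bilin T.
  split=> [t|x]; last exact: tensor_lift_linear.
  by apply: (@linear_bigop _ _ _ _ _ (fun p x => B x p.1 p.2)) => p; exact: B1.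
have TL := tensor_lift_linear TB.
have := congr1 (tensor_lift T) (coalg_coassoc coalgD a); rewrite !(linear_lift _ _ TL).
under eq_tensor_lift => a1 a2.
  rewrite (linear_lift _ _ TL).
  under eq_tensor_lift => x y do rewrite (tensor_lift_tens _ _ TB) /T (tensor_lift_tens _ _ (Tb _)).
  over.
move=> ->; apply: eq_tensor_lift => a1 a2.
by rewrite (tensor_lift_tens _ _ TB).
Qed.

(** General coassociativity: all ways of iterating the coproduct agree. Legs before position [i] are
    peeled off one by one; at position 0 the block grows by induction on [k], one use of
    coassociativity per leg. The equation for [m] is a hypothesis so that numerals can be supplied
    and closed by computation. *)
Lemma sum_split i k n m : m = (n + k)%N -> (i <= n)%N -> forall a F, multilinear m F ->
  \sum_(s <- legs m a) F s =
  \sum_(s <- legs n a) \sum_(u <- legs k (s i)) F (splice i k u s).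
Proof.
move=> -> {m}; elim: i n => [|i IHi] n.
  move=> _; elim: k => [|k IHk] a F Fm.
    rewrite addn0; apply: eq_bigr => s _; rewrite sum_legs0; congr F.
    by apply/funext => -[|j].
  move: Fm; rewrite addnS => -[F1 FS]; rewrite sum_legsS.
  under eq_tensor_lift => a1 a2 do rewrite (IHk _ _ (FS _)).
  case: n {IHk} F1 FS => [|n] F1 FS.
    rewrite sum_legs0 sum_legsS; apply: eq_tensor_lift => a1 a2.
    by rewrite sum_legs0.
  (* Here [x] is the first leg of the block, [y] is still to be expanded into the other [k.+1] legs
     of the block, and [z] carries the legs after it. Coassociativity turns [x] and [y] into the two
     legs of a single element, the one the block comes from. *)
  pose B x y z := \sum_(s <- legs n z) \sum_(u <- legs k y) F (scons x (prepend k u s)).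
  transitivity (tensor_lift (fun a1 a2 => tensor_lift (B a1) (cop a2)) (cop a)).
    by apply: eq_tensor_lift => a1 a2; exact: sum_legsS.
  rewrite -[LHS](@coassoc_lift B).
  - rewrite sum_legsS; apply: eq_tensor_lift => a1 a2.
    rewrite /tensor_lift /eval_pairs exchange_big.
    by apply: eq_bigr => s _; rewrite sum_legsS.
  - by move=> y z; apply: linear_bigop => s; apply: linear_bigop => u; exact: F1.
  - move=> x z; apply: linear_bigop => s; apply: legs_linear.
    exact: (@multilinear_prependl n k (fun v => F (scons x v)) s (FS x)).
  - move=> x y; apply: legs_linear; apply: multilinear_sum => u.
    exact: (@multilinear_prependr n k (fun v => F (scons x v)) u (FS x)).
case: n => // n /IHi {}IHi a F [F1 FS]; rewrite addSn !sum_legsS.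
apply: eq_tensor_lift => a1 a2; exact: (IHi a2 (fun s => F (scons a1 s)) (FS a1)).
Qed.

(** Allows an identity about [k.+1] neighbouring legs of [a] and [l.+1] neighbouring legs of [b] to
    be used inside a longer sum: both blocks are regrouped into one leg each, where the identity
    applies. *)
Lemma sum_block2 i j k l n m n' m' (F G : (nat -> D) -> (nat -> D) -> M) a b :
  n' = (n + k)%N -> (i <= n)%N -> m' = (m + l)%N -> (j <= m)%N ->
  (forall t, multilinear n' (F^~ t)) -> (forall s, multilinear m' (F s)) ->
  (forall t, multilinear n' (G^~ t)) -> (forall s, multilinear m' (G s)) ->
  (forall s t,
    \sum_(x <- legs k (s i)) \sum_(y <- legs l (t j)) F (splice i k x s) (splice j l y t) =
    \sum_(x <- legs k (s i)) \sum_(y <- legs l (t j)) G (splice i k x s) (splice j l y t)) ->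
  \sum_(s <- legs n' a) \sum_(t <- legs m' b) F s t =
  \sum_(s <- legs n' a) \sum_(t <- legs m' b) G s t.
Proof.
move=> nE i_n mE j_m F1 F2 G1 G2 FG.
have E (F' : (nat -> D) -> (nat -> D) -> M) :
    (forall t, multilinear n' (F'^~ t)) -> (forall s, multilinear m' (F' s)) ->
    \sum_(s <- legs n' a) \sum_(t <- legs m' b) F' s t =
    \sum_(s <- legs n a) \sum_(t <- legs m b) \sum_(x <- legs k (s i))
      \sum_(y <- legs l (t j)) F' (splice i k x s) (splice j l y t).
  move=> F1' F2'; under eq_bigr => s _ do rewrite (sum_split mE j_m b (F2' s)).
  rewrite (sum_split nE i_n); last first.
    by apply: multilinear_sum => t; apply: multilinear_sum => y; exact: F1'.
  by apply: eq_bigr => s _; rewrite exchange_big.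
by rewrite !E //; apply: eq_bigr => s _; apply: eq_bigr => t _.
Qed.

(** The same device for three elements and blocks of two legs, the shape of the Yang-Baxter
    equation. *)
Lemma sum_block3 i j l n (F G : (nat -> D) -> (nat -> D) -> (nat -> D) -> M) a b c :
  (i <= n)%N -> (j <= n)%N -> (l <= n)%N ->
  (forall t u, multilinear n.+1 (fun s => F s t u)) ->
  (forall s u, multilinear n.+1 (fun t => F s t u)) ->
  (forall s t, multilinear n.+1 (F s t)) ->
  (forall t u, multilinear n.+1 (fun s => G s t u)) ->
  (forall s u, multilinear n.+1 (fun t => G s t u)) ->
  (forall s t, multilinear n.+1 (G s t)) ->
  (forall s t u,
    \sum_(x <- legs 1 (s i)) \sum_(y <- legs 1 (t j)) \sum_(z <- legs 1 (u l))
      F (splice i 1 x s) (splice j 1 y t) (splice l 1 z u) =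
    \sum_(x <- legs 1 (s i)) \sum_(y <- legs 1 (t j)) \sum_(z <- legs 1 (u l))
      G (splice i 1 x s) (splice j 1 y t) (splice l 1 z u)) ->
  \sum_(s <- legs n.+1 a) \sum_(t <- legs n.+1 b) \sum_(u <- legs n.+1 c) F s t u =
  \sum_(s <- legs n.+1 a) \sum_(t <- legs n.+1 b) \sum_(u <- legs n.+1 c) G s t u.
Proof.
move=> i_n j_n l_n F1 F2 F3 G1 G2 G3 FG.
have E (F' : (nat -> D) -> (nat -> D) -> (nat -> D) -> M) :
    (forall t u, multilinear n.+1 (fun s => F' s t u)) ->
    (forall s u, multilinear n.+1 (fun t => F' s t u)) ->
    (forall s t, multilinear n.+1 (F' s t)) ->
    \sum_(s <- legs n.+1 a) \sum_(t <- legs n.+1 b) \sum_(u <- legs n.+1 c) F' s t u =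
    \sum_(s <- legs n a) \sum_(t <- legs n b) \sum_(u <- legs n c)
      \sum_(x <- legs 1 (s i)) \sum_(y <- legs 1 (t j)) \sum_(z <- legs 1 (u l))
        F' (splice i 1 x s) (splice j 1 y t) (splice l 1 z u).
  have nE : n.+1 = (n + 1)%N by rewrite addn1.
  move=> F1' F2' F3'.
  under eq_bigr => s _ do under eq_bigr => t _ do rewrite (sum_split nE l_n c (F3' s t)).
  under eq_bigr => s _.
    rewrite (sum_split nE j_n); last first.
      by apply: multilinear_sum => u; apply: multilinear_sum => z; exact: F2'.
    over.
  rewrite (sum_split nE i_n); last first.
    by do 4!apply: multilinear_sum => ?; exact: F1'.
  apply: eq_bigr => s _; rewrite exchange_big; apply: eq_bigr => t _.
  by under eq_bigr => x _ do rewrite exchange_big; rewrite exchange_big.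
by rewrite !E //; do 3!apply: eq_bigr => ? _.
Qed.

Lemma counitl (f : D -> M) a : linear f ->
  tensor_lift (fun a1 a2 => eps a1 *: f a2) (cop a) = f a.
Proof.
move=> fl; rewrite -[in RHS](coalg_counitl coalgD a) (linear_lift _ _ fl).
by apply: eq_tensor_lift => a1 a2; rewrite linear_scale.
Qed.

Lemma counitr (f : D -> M) a : linear f ->
  tensor_lift (fun a1 a2 => eps a2 *: f a1) (cop a) = f a.
Proof.
move=> fl; rewrite -[in RHS](coalg_counitr coalgD a) (linear_lift _ _ fl).
by apply: eq_tensor_lift => a1 a2; rewrite linear_scale.
Qed.

(** Read from right to left it inserts a leg at a chosen position, which makes room for a cancelling
    pair. The left counit law serves every position except the last, where the innermost coproduct
    needs the right one. *)
Lemma sum_counit i n F a : (i <= n.+1)%N -> multilinear n F ->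
  \sum_(s <- legs n.+1 a) eps (s i) *: F (remove i s) = \sum_(s <- legs n a) F s.
Proof.
elim: i n F a => [|i IHi] n F a.
  move=> _ Fm; rewrite sum_legsS -(counitl _ (legs_linear Fm)).
  by apply: eq_tensor_lift => a1 a2; rewrite scaler_sumr.
case: n => [|n] in_n [F1 FS].
  case: i in_n IHi => // _ _; rewrite sum_legs1 sum_legs0.
  rewrite -[RHS](@counitr (fun d => F (scons d (fun=> 0)))) //.
rewrite !sum_legsS; apply: eq_tensor_lift => a1 a2.
exact: (IHi n (fun s => F (scons a1 s)) a2 in_n (FS a1)).
Qed.
End Sums.
End Sweedler.

(** Extension point of [linearity]: each section redefines it to include the linear maps available
    there. *)
Ltac linear_hook := fail.
Ltac linearity := repeat first
  [ exact: linear_id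
  | match goal with
    | |- multilinear _ _ =>
      lazy beta iota zeta delta [multilinear scons splice prepend remove]
    | |- _ /\ _ => apply: conj
    | |- True => exact: I
    | |- forall _, _ => intro
    end
  | linear_hook
  | apply: linear_bigop => ?
  | apply: linear_scaler | apply: linear_scalel
  | apply: linear_coefr | apply: linear_coefl
  | apply: linear_mulr | apply: linear_mull
  | apply: linear_tensr | apply: linear_tensl
  ].

Ltac legs_simpl := lazy beta iota delta [splice prepend scons remove].

(* [split_at a i k n]: of the [n + k + 1] legs of [a], those numbered
   [i, ..., i + k] are regrouped as the legs of one element. *)
Ltac split_in M a i k n :=
  let m := eval compute in (n + k)%N in
  lazymatch goal with coalg : is_coalgebra _ _ |- _ =>
    rewrite (@sum_split _ _ _ _ coalg M i k n m (erefl _) isT a);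
    [legs_simpl | by linearity]
  end.
Tactic Notation "split_at" constr(a) constr(i) constr(k) constr(n) :=
  split_in uconstr:(_) a i k n.

(** * Products on tensor products *)

Lemma tensor_bilin_ext (K : comNzRingType) (L M L' M' N : lmodType K)
    (f g : tensor L M -> tensor L' M' -> N) : bilin f -> bilin g ->
  (forall a b c d, f (a ⊗ b) (c ⊗ d) = g (a ⊗ b) (c ⊗ d)) -> f =2 g.
Proof.
move=> [fl fr] [gl gr] fg x y; move: x; apply: tensor_linear_ext => // a b.
by move: y; apply: tensor_linear_ext.
Qed.

Lemma tensor_assoc_ext (K : comNzRingType) (L M : lmodType K)
    (mul : tensor L M -> tensor L M -> tensor L M) : bilin mul ->
  (forall a b c d e f, mul (a ⊗ b) (mul (c ⊗ d) (e ⊗ f)) =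
                       mul (mul (a ⊗ b) (c ⊗ d)) (e ⊗ f)) -> associative mul.
Proof.
move=> [ml mr] mulA x y z; move: y z; apply: tensor_bilin_ext => [||c d e f].
- by split=> u; apply: (linear_comp (mr x)).
- by split=> u; [apply: (linear_comp (ml u)) | exact: mr].
move: x; apply: tensor_linear_ext => [||a b //]; first exact: ml.
by apply: (linear_comp (ml _)); exact: ml.
Qed.

Section TensorMul.
Variables (K : comNzRingType) (A B : lmodType K).
Variables (mulA : A -> A -> A) (mulB : B -> B -> B).
Hypotheses (bA : bilin mulA) (bB : bilin mulB).
Notation mul := (tensor_mul mulA mulB).

Let bilin_inner a b : bilin (fun c d => mulA a c ⊗ mulB b d).
Proof. by split=> x; linearity; [exact: bA.2 | exact: bB.2]. Qed.

Let bilin_outer y : bilin (fun a b => tensor_lift (fun c d => mulA a c ⊗ mulB b d) y).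
Proof. by split=> x; apply: linear_bigop => p; linearity; [exact: bA.1 | exact: bB.1]. Qed.

Lemma tensor_mul_bilin : bilin mul.
Proof.
split=> [y|x]; first exact: tensor_lift_linear.
by apply: linear_bigop => p; exact: tensor_lift_linear.
Qed.

Lemma tensor_mul_tens a b c d : mul (a ⊗ b) (c ⊗ d) = mulA a c ⊗ mulB b d.
Proof. by rewrite /tensor_mul !tensor_lift_tens. Qed.

Lemma tensor_mulA : associative mulA -> associative mulB -> associative mul.
Proof.
move=> aA aB; apply: tensor_assoc_ext => [|a b c d e f]; first exact: tensor_mul_bilin.
by rewrite !tensor_mul_tens aA aB.
Qed.

Lemma tensor_mul1l oneA oneB : left_id oneA mulA -> left_id oneB mulB ->
  left_id (oneA ⊗ oneB) mul.
Proof.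
move=> iA iB z.
apply: (@tensor_linear_ext _ _ _ _ (mul (oneA ⊗ oneB)) id) => // [|a b].
  exact: tensor_mul_bilin.2.
by rewrite tensor_mul_tens iA iB.
Qed.

Lemma tensor_mul1r oneA oneB : right_id oneA mulA -> right_id oneB mulB ->
  right_id (oneA ⊗ oneB) mul.
Proof.
move=> iA iB z.
apply: (@tensor_linear_ext _ _ _ _ (mul^~ (oneA ⊗ oneB)) id) => // [|a b].
  exact: tensor_mul_bilin.1.
by rewrite tensor_mul_tens iA iB.
Qed.
End TensorMul.

(** * The antipode of a Hopf algebra *)

Section HopfAlgebra.
Variables (K : comNzRingType) (D : algType K).
Variables (cop : D -> tensor D D) (eps : D -> K) (anti : D -> D).
Hypothesis hopfD : is_hopf *%R 1 cop eps anti.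

Let coalgD := hopf_coalgebra hopfD.
Let copL := coalg_cop_linear coalgD.
Let epsL : linear (eps : D -> K^o) := coalg_eps_linear coalgD.
Let antiL := hopf_anti_linear hopfD.
Notation legs := (legs cop).

Lemma bilin_mul : bilin (fun a b : D => a * b).
Proof. by split=> c; linearity. Qed.

Lemma linear_legs (N M : lmodType K) n (F : (nat -> D) -> M) (g : N -> D) :
  linear g -> multilinear n F -> linear (fun x => \sum_(s <- legs n (g x)) F s).
Proof. by move=> gl Fm; exact: (linear_comp (legs_linear coalgD Fm) gl). Qed.

Ltac linear_hook ::= first [apply: linear_legs | apply: (linear_comp antiL)
  | apply: (linear_comp epsL)].

Lemma anti_lift_l (M : lmodType K) (f : D -> M) a : linear f ->
  tensor_lift (fun a1 a2 => f (anti a1 * a2)) (cop a) = eps a *: f 1.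
Proof. by move=> fl; rewrite -(linear_lift _ _ fl) (hopf_antil hopfD) linear_scale. Qed.

Lemma anti_lift_r (M : lmodType K) (f : D -> M) a : linear f ->
  tensor_lift (fun a1 a2 => f (a1 * anti a2)) (cop a) = eps a *: f 1.
Proof. by move=> fl; rewrite -(linear_lift _ _ fl) (hopf_antir hopfD) linear_scale. Qed.

Let mul2 := tensor_mul ( *%R : D -> D -> D) ( *%R : D -> D -> D).
Let mul2l y : linear (mul2^~ y) := (tensor_mul_bilin bilin_mul bilin_mul).1 y.
Let mul2r x : linear (mul2 x) := (tensor_mul_bilin bilin_mul bilin_mul).2 x.

Lemma sum_legs_mul (M : lmodType K) n (F : (nat -> D) -> M) a b : multilinear n F ->
  \sum_(s <- legs n (a * b)) F s =
  \sum_(s <- legs n a) \sum_(t <- legs n b) F (fun i => s i * t i).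
Proof.
elim: n F a b => [|n IHn] F a b Fm.
  (* The streams also agree beyond the last leg, because the padding satisfies [0 * 0 = 0]. *)
  rewrite !sum_legs0; congr F; apply/funext => -[|i] //=; by rewrite mul0r.
have [F1 FS] := Fm.
pose G a1 a2 := \sum_(s <- legs n a2) F (scons a1 s).
have Gb : bilin G by exact: (bilin_legs coalgD (F := fun d s => F (scons d s)) F1 FS).
rewrite sum_legsS -/G (hopf_copM hopfD) /tensor_mul (linear_lift _ _ (tensor_lift_linear Gb)).
rewrite sum_legsS; apply: eq_tensor_lift => a1 a2.
rewrite (linear_lift _ _ (tensor_lift_linear Gb)).
under eq_tensor_lift => b1 b2 do rewrite (tensor_lift_tens _ _ Gb) /G (IHn _ _ _ (FS _)).
rewrite [LHS]exchange_big; apply: eq_bigr => s _.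
rewrite sum_legsS [RHS]tensor_lift_sum; apply: eq_bigr => p _.
apply: eq_bigr => t _; congr F.
by apply/funext => -[|i].
Qed.

Lemma sum_antil (M : lmodType K) (f : D -> M) a : linear f ->
  \sum_(s <- legs 1 a) f (anti (s 0%N) * s 1%N) = eps a *: f 1.
Proof. by move=> fl; rewrite sum_legs1; exact: anti_lift_l. Qed.

Lemma sum_antir (M : lmodType K) (f : D -> M) a : linear f ->
  \sum_(s <- legs 1 a) f (s 0%N * anti (s 1%N)) = eps a *: f 1.
Proof. by move=> fl; rewrite sum_legs1; exact: anti_lift_r. Qed.

Lemma sum_counit1l (M : lmodType K) (f : D -> M) a : linear f ->
  \sum_(s <- legs 1 a) eps (s 0%N) *: f (s 1%N) = f a.
Proof. by move=> fl; rewrite sum_legs1; exact: (counitl coalgD). Qed.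

Lemma sum_counit1r (M : lmodType K) (f : D -> M) a : linear f ->
  \sum_(s <- legs 1 a) eps (s 1%N) *: f (s 0%N) = f a.
Proof. by move=> fl; rewrite sum_legs1; exact: (counitr coalgD). Qed.

Let flip_anti a := \sum_(s <- legs 1 a) anti (s 1%N) ⊗ anti (s 0%N).

Let flip_antiL : linear flip_anti.
Proof. apply: (legs_linear coalgD); linearity. Qed.

Let cop_sum a : cop a = \sum_(s <- legs 1 a) s 0%N ⊗ s 1.
Proof. by rewrite sum_legs1 [LHS]tensor_sum. Qed.

Let mul2_tens a b c d : mul2 (a ⊗ b) (c ⊗ d) = (a * c) ⊗ (b * d).
Proof. exact: (tensor_mul_tens bilin_mul bilin_mul). Qed.

(** Says that [flip_anti] is a right inverse of [cop] for convolution with values in [D ⊗ D]. *)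
Let cop_flip_anti a :
  \sum_(s <- legs 1 a) mul2 (cop (s 0%N)) (flip_anti (s 1%N)) = eps a *: (1 ⊗ 1).
Proof.
(* The antipode pairs are nested: legs 1 and 2 collapse first, after which legs 0 and 3 become
   neighbours and collapse too. *)
transitivity (\sum_(s <- legs 3 a) (s 0%N * anti (s 3%N)) ⊗ (s 1%N * anti (s 2%N))).
  split_at a 2%N 1%N 2%N; split_at a 0%N 1%N 1%N; apply: eq_bigr => s _.
  rewrite cop_sum (linear_fun_sum _ _ (mul2l _)); apply: eq_bigr => t _.
  by rewrite (linear_fun_sum _ _ (mul2r _)); apply: eq_bigr => u _; rewrite mul2_tens.
split_at a 1%N 1%N 2%N.
under eq_bigr => s _.
  rewrite (sum_antir (f := fun x => s 0%N * anti (s 2%N) ⊗ x)); last by linearity.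
  over.
rewrite (@sum_counit _ _ _ _ coalgD _ 1 1 (fun s => s 0%N * anti (s 1%N) ⊗ 1)) //;
  last by linearity.
by rewrite (sum_antir (f := fun x => x ⊗ 1)); last by linearity.
Qed.

Ltac linear_hook ::= first [apply: linear_legs | apply: (linear_comp antiL)
  | apply: (linear_comp epsL) | apply: (linear_comp copL)
  | apply: (linear_comp (mul2l _)) | apply: (linear_comp (mul2r _))
  | apply: (linear_comp flip_antiL)].

(** Uniqueness of convolution inverses: [cop] composed with [anti] is a left inverse of [cop], as
    [cop] is multiplicative, and [flip_anti] is a right inverse. The product of the three, bracketed
    in both ways, identifies them. *)
Lemma cop_anti a : cop (anti a) = \sum_(s <- legs 1 a) anti (s 1%N) ⊗ anti (s 0%N).
Proof.
have copM x y : cop (x * y) = mul2 (cop x) (cop y) by exact: (hopf_copM hopfD).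
have mulA : associative mul2 by apply: (tensor_mulA bilin_mul bilin_mul); exact: mulrA.
have mul1 : left_id (1 ⊗ 1) mul2.
  by apply: (tensor_mul1l bilin_mul bilin_mul); exact: mul1r.
have mul1' : right_id (1 ⊗ 1) mul2.
  by apply: (tensor_mul1r bilin_mul bilin_mul); exact: mulr1.
rewrite -/(flip_anti a) -[LHS](@sum_counit1r _ (fun x => cop (anti x))); last by linearity.
transitivity (\sum_(s <- legs 2 a)
    mul2 (mul2 (cop (anti (s 0%N))) (cop (s 1%N))) (flip_anti (s 2%N))).
  split_at a 1%N 1%N 1%N; apply: eq_bigr => s _.
  under eq_bigr => u _ do rewrite -mulA.
  rewrite -(linear_fun_sum _ _ (mul2r _)) cop_flip_anti (linear_scale (mul2r _)).
  by rewrite mul1'.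
split_at a 0%N 1%N 1%N.
under eq_bigr => s _.
  under eq_bigr => u _ do rewrite -copM.
  rewrite (sum_antil (f := fun x => mul2 (cop x) (flip_anti (s 1%N)))); last by linearity.
  rewrite (hopf_cop1 hopfD) mul1; over.
exact: sum_counit1l.
Qed.

Lemma sum_legs1_anti (M : lmodType K) (F : (nat -> D) -> M) a : multilinear 1 F ->
  \sum_(s <- legs 1 (anti a)) F s =
  \sum_(s <- legs 1 a) F (scons (anti (s 1%N)) (scons (anti (s 0%N)) (fun=> 0))).
Proof.
move=> [F1 F2]; rewrite sum_legs1 cop_anti.
have Fb : bilin (fun a1 a2 => F (scons a1 (scons a2 (fun=> 0)))).
  by split=> x; [exact: F1 | exact: (F2 x).1].
rewrite (linear_fun_sum _ _ (tensor_lift_linear Fb)).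
by apply: eq_bigr => s _; rewrite tensor_lift_tens.
Qed.

Lemma sum_legs2_anti (M : lmodType K) (F : (nat -> D) -> M) a : multilinear 2 F ->
  \sum_(s <- legs 2 (anti a)) F s = \sum_(s <- legs 2 a)
    F (scons (anti (s 2%N)) (scons (anti (s 1%N)) (scons (anti (s 0%N)) (fun=> 0)))).
Proof.
move=> Fm; have [F1 F2] := Fm.
pose G d x := \sum_(t <- legs 1 x) F (scons d t).
have Gb : bilin G by exact: (@bilin_legs _ _ _ _ coalgD _ 1 (fun d s => F (scons d s)) F1 F2).
rewrite sum_legsS -/G cop_anti (linear_fun_sum _ _ (tensor_lift_linear Gb)).
rewrite (@sum_split _ _ _ _ coalgD _ 0 1 1 2) //.
  apply: eq_bigr => s _; rewrite tensor_lift_tens // /G sum_legs1_anti //; exact: F2.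
have F3 x y z : linear (fun d => F (scons x (scons y (scons d z)))) := ((F2 x).2 y).1 z.
have F2' x z : linear (fun d => F (scons x (scons d z))) := (F2 x).1 z.
split=> [s|x]; first exact: (linear_comp (F3 (anti (s 1%N)) (anti (s 0%N)) (fun=> 0)) antiL).
split=> [s|y]; first exact: (linear_comp (F2' (anti (s 0%N)) (scons (anti x) (fun=> 0))) antiL).
by split=> // s; exact: (linear_comp (F1 (scons (anti y) (scons (anti x) (fun=> 0)))) antiL).
Qed.

(** Again two convolution inverses, this time of the multiplication: the sum of S(a_1 b_1) a_2 b_2
    S(b_3) S(a_3) collapses from the right to S(ab) and from the left to S(b) S(a). *)
Lemma anti_mul a b : anti (a * b) = anti b * anti a.
Proof.
transitivity (\sum_(s <- legs 2 a) \sum_(t <- legs 2 b)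
  (anti (s 0%N * t 0%N) * (s 1%N * (t 1%N * anti (t 2%N)) * anti (s 2%N)))).
  under eq_bigr => s _.
    split_at b 1%N 1%N 1%N.
    under eq_bigr => t _.
      rewrite (sum_antir (f := fun x => anti (s 0%N * t 0%N) * (s 1%N * x * anti (s 2%N))));
        last by linearity.
      over.
    rewrite (@sum_counit1r _ (fun x => anti (s 0%N * x) * (s 1%N * 1 * anti (s 2%N))));
      last by linearity.
    rewrite mulr1; over.
  rewrite -[a in LHS]mulr1; split_at a 1%N 1%N 1%N.
  under eq_bigr => s _.
    rewrite (sum_antir (f := fun x => anti (s 0%N * b) * x)); last by linearity.
    rewrite mulr1; over.
  by rewrite (@sum_counit1r _ (fun x => anti (x * b))) ?mulr1; last by linearity.
symmetry; split_at a 0%N 1%N 1%N.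
under eq_bigr => s _.
  under eq_bigr => u _.
    split_at b 0%N 1%N 1%N; over.
  rewrite exchange_big.
  under eq_bigr => t _.
    under eq_bigr => u _ do under eq_bigr => v _ do rewrite !mulrA -(mulrA (anti _)).
    rewrite -(@sum_legs_mul _ 1 (fun w => anti (w 0%N) * w 1%N * anti (t 1%N) * anti (s 1%N)));
      last by linearity.
    rewrite (sum_antil (f := fun w => w * anti (t 1%N) * anti (s 1%N))); last by linearity.
    rewrite (hopf_epsM hopfD) -scalerA mul1r; over.
  rewrite -scaler_sumr (sum_counit1l (f := fun w => anti w * anti (s 1%N))); last by linearity.
  over.
by rewrite (sum_counit1l (f := fun w => anti b * anti w)); last by linearity.
Qed.

Lemma anti1 : anti 1 = 1.
Proof.
have := hopf_antil hopfD 1; rewrite (hopf_cop1 hopfD) tensor_lift_tens.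
  by rewrite mulr1 (hopf_eps1 hopfD) scale1r.
by split=> x; linearity.
Qed.

Lemma eps_anti a : eps (anti a) = eps a.
Proof.
rewrite -[LHS](@sum_counit1r K^o (fun x => eps (anti x))); last by linearity.
transitivity (\sum_(s <- legs 1 a) eps (anti (s 0%N) * s 1%N)).
  by apply: eq_bigr => s _; rewrite (hopf_epsM hopfD) [LHS]mulrC.
by rewrite (sum_antil (f := eps : D -> K^o)) // (hopf_eps1 hopfD) [LHS]mulr1.
Qed.

End HopfAlgebra.

(** The axioms of a universal R-matrix read on the dual. [cqt_mull] and [cqt_mulr] are the two
    hexagon identities, [cqt_mulr] reversing the factors because R_13 stands before R_12; [cqt_comm]
    expresses that R intertwines the coproduct and its opposite. *)
Record is_coquasitriangular (K : comNzRingType) (D : algType K) (cop : D -> tensor D D)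
    (eps : D -> K) (r rb : D -> D -> K) : Prop := {
  cqt_linearl : forall b, linear (r^~ b : D -> K^o);
  cqt_linearr : forall a, linear (r a : D -> K^o);
  cqt_inv_linearl : forall b, linear (rb^~ b : D -> K^o);
  cqt_inv_linearr : forall a, linear (rb a : D -> K^o);
  cqt_mull : forall a b c,
    r (a * b) c = \sum_(s <- legs cop 1 c) r a (s 0%N) * r b (s 1%N);
  cqt_mulr : forall a b c,
    r a (b * c) = \sum_(s <- legs cop 1 a) r (s 0%N) c * r (s 1%N) b;
  cqt_inv : forall a b,
    \sum_(s <- legs cop 1 a) \sum_(t <- legs cop 1 b) r (s 0%N) (t 0%N) * rb (s 1%N) (t 1%N) =
    eps a * eps b;
  cqt_invl : forall a b,
    \sum_(s <- legs cop 1 a) \sum_(t <- legs cop 1 b) rb (s 0%N) (t 0%N) * r (s 1%N) (t 1%N) =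
    eps a * eps b;
  cqt_comm : forall a b,
    \sum_(s <- legs cop 1 a) \sum_(t <- legs cop 1 b) r (s 0%N) (t 0%N) *: (s 1%N * t 1%N) =
    \sum_(s <- legs cop 1 a) \sum_(t <- legs cop 1 b) r (s 1%N) (t 1%N) *: (t 0%N * s 0%N)
}.

(** * Coquasitriangular structures and the product of the reflection equation dual *)

Section Coquasitriangular.
Variables (K : comNzRingType) (D : algType K).
Variables (cop : D -> tensor D D) (eps : D -> K) (anti : D -> D).
Hypothesis hopfD : is_hopf *%R 1 cop eps anti.
Variables (r rb : D -> D -> K).
Hypothesis cqt : is_coquasitriangular cop eps r rb.
Notation legs := (legs cop).

Let rL := cqt_linearl cqt.
Let rR := cqt_linearr cqt.
Let rbL := cqt_inv_linearl cqt.
Let rbR := cqt_inv_linearr cqt.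
Let r_mull := cqt_mull cqt.
Let r_mulr := cqt_mulr cqt.
Let r_rb := cqt_inv cqt.
Let r_comm := cqt_comm cqt.
Let coalgD := hopf_coalgebra hopfD.
Let copL := coalg_cop_linear coalgD.
Let epsL : linear (eps : D -> K^o) := coalg_eps_linear coalgD.
Let antiL := hopf_anti_linear hopfD.

Ltac linear_hook ::= first [apply: (linear_legs hopfD) | apply: (linear_comp antiL)
  | apply: (linear_comp epsL) | apply: (linear_comp copL)
  | apply: (linear_comp (rL _)) | apply: (linear_comp (rR _))
  | apply: (linear_comp (rbL _)) | apply: (linear_comp (rbR _))].

Local Tactic Notation "splitK_at" constr(a) constr(i) constr(k) constr(n) :=
  split_in (K^o : lmodType K) a i k n.

Lemma r_comm_map (M : lmodType K) (f : D -> M) a b : linear f ->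
  \sum_(s <- legs 1 a) \sum_(t <- legs 1 b) r (s 0%N) (t 0%N) *: f (s 1%N * t 1%N) =
  \sum_(s <- legs 1 a) \sum_(t <- legs 1 b) r (s 1%N) (t 1%N) *: f (t 0%N * s 0%N).
Proof.
move=> fl; have := congr1 f (r_comm a b); rewrite !(linear_fun_sum _ _ fl).
under eq_bigr => s _.
  rewrite (linear_fun_sum _ _ fl); under eq_bigr => t _ do rewrite (linear_scale fl).
  over.
move=> ->; apply: eq_bigr => s _; rewrite (linear_fun_sum _ _ fl).
by apply: eq_bigr => t _; rewrite (linear_scale fl).
Qed.

Lemma sum_legs_one1 (M : lmodType K) (F : (nat -> D) -> M) : multilinear 1 F ->
  \sum_(s <- legs 1 1) F s = F (scons 1 (scons 1 (fun=> 0))).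
Proof.
move=> [F1 F2]; rewrite sum_legs1 (hopf_cop1 hopfD) tensor_lift_tens //.
by split=> x; [exact: F1 | exact: (F2 x).1].
Qed.

Lemma sum_legs_one2 (M : lmodType K) (F : (nat -> D) -> M) : multilinear 2 F ->
  \sum_(s <- legs 2 1) F s = F (scons 1 (scons 1 (scons 1 (fun=> 0)))).
Proof.
move=> Fm; have [F1 F2] := Fm.
rewrite sum_legsS (hopf_cop1 hopfD) tensor_lift_tens.
  rewrite sum_legs_one1 //; exact: F2.
exact: (@bilin_legs _ _ _ _ coalgD _ 1 (fun d s => F (scons d s)) F1 F2).
Qed.

Lemma sum_counit1rK a (f : D -> K^o) : linear f ->
  \sum_(s <- legs 1 a) f (s 0%N) * eps (s 1%N) = f a.
Proof.
move=> fl; rewrite -[RHS](sum_counit1r hopfD _ fl).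
by apply: eq_bigr => s _; exact: mulrC.
Qed.

Lemma sum_counit1lK a (f : D -> K^o) : linear f ->
  \sum_(s <- legs 1 a) eps (s 0%N) * f (s 1%N) = f a.
Proof. by move=> fl; rewrite -[RHS](sum_counit1l hopfD _ fl). Qed.

(* [r 1] is idempotent for the convolution product, and invertible. *)
Lemma r1l b : r 1 b = eps b.
Proof.
have r_rb1 c : \sum_(t <- legs 1 c) r 1 (t 0%N) * rb 1 (t 1%N) = eps c.
  have := r_rb 1 c; rewrite (hopf_eps1 hopfD) mul1r => <-.
  by rewrite (@sum_legs_one1 K^o) //; linearity.
rewrite -r_rb1 -[LHS](@sum_counit1rK b (r 1)) //.
transitivity (\sum_(t <- legs 2 b) r 1 (t 0%N) * (r 1 (t 1%N) * rb 1 (t 2%N)) : K^o).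
  splitK_at b 1%N 1%N 1%N; apply: eq_bigr => s _.
  by rewrite -big_distrr /= r_rb1.
splitK_at b 0%N 1%N 1%N; apply: eq_bigr => s _.
under eq_bigr => t _ do rewrite mulrA.
by rewrite -big_distrl /= -r_mull mulr1.
Qed.

Lemma r1r a : r a 1 = eps a.
Proof.
have r_rb1 c : \sum_(t <- legs 1 c) r (t 0%N) 1 * rb (t 1%N) 1 = eps c.
  have := r_rb c 1; rewrite (hopf_eps1 hopfD) mulr1 => <-.
  by apply: eq_bigr => s _; rewrite (@sum_legs_one1 K^o) //; linearity.
rewrite -r_rb1 -[LHS](@sum_counit1rK a (r^~ 1)) //.
transitivity (\sum_(t <- legs 2 a) r (t 0%N) 1 * (r (t 1%N) 1 * rb (t 2%N) 1) : K^o).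
  splitK_at a 1%N 1%N 1%N; apply: eq_bigr => s _.
  by rewrite -big_distrr /= r_rb1.
splitK_at a 0%N 1%N 1%N; apply: eq_bigr => s _.
under eq_bigr => t _ do rewrite mulrA.
by rewrite -big_distrl /= -r_mulr mulr1.
Qed.

(** By multiplicativity in the first slot and r(1, b) = eps(b), the form r(S -, -) is a left
    convolution inverse of r, while [rb] is a right one. The triple product bracketed in two ways
    identifies them; [E] is one of the bracketings. *)
Lemma rbE a b : rb a b = r (anti a) b.
Proof.
have E : \sum_(s <- legs 2 a) \sum_(t <- legs 2 b)
    r (anti (s 0%N)) (t 0%N) * (r (s 1%N) (t 1%N) * rb (s 2%N) (t 2%N)) = r (anti a) b.
  splitK_at a 1%N 1%N 1%N.
  rewrite -[RHS](@sum_counit1rK a (fun x => r (anti x) b)); last by linearity.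
  apply: eq_bigr => s _.
  under eq_bigr => u _ do splitK_at b 1%N 1%N 1%N.
  rewrite exchange_big -[X in X * _](@sum_counit1rK b (r (anti (s 0%N)))) // big_distrl.
  apply: eq_bigr => t _.
  under eq_bigr => u _ do rewrite -big_distrr /=.
  by rewrite -big_distrr /= r_rb -mulrA [eps (s 1%N) * _]mulrC.
rewrite -E; symmetry.
transitivity (\sum_(s <- legs 2 a) \sum_(t <- legs 2 b)
    r (anti (s 0%N)) (t 0%N) * r (s 1%N) (t 1%N) * rb (s 2%N) (t 2%N)).
  by apply: eq_bigr => s _; apply: eq_bigr => t _; rewrite mulrA.
splitK_at a 0%N 1%N 1%N.
rewrite -[RHS](@sum_counit1lK a (rb^~ b)) //; apply: eq_bigr => s _.
under eq_bigr => u _ do splitK_at b 0%N 1%N 1%N.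
rewrite exchange_big -[rb _ b](@sum_counit1lK b (rb (s 1%N))) // big_distrr.
apply: eq_bigr => t _ /=.
under eq_bigr => u _ do rewrite -big_distrl /= -r_mull.
rewrite -big_distrl mulrA /=; congr (_ * _).
rewrite -[eps (t 0%N)]r1l; exact: (sum_antil hopfD (f := r^~ (t 0%N) : D -> K^o)).
Qed.

(** Compared with r, the order of the factors is reversed, because S is an antihomomorphism. In the
    second slot, by contrast, the reversal in [cqt_mulr] is undone by the flipped coproduct of
    S(a). *)
Lemma rb_mull a b c : rb (a * b) c = \sum_(s <- legs 1 c) rb b (s 0%N) * rb a (s 1%N).
Proof.
by rewrite rbE (anti_mul hopfD) r_mull; apply: eq_bigr => s _; rewrite !rbE.
Qed.

Lemma rb_mulr a b c : rb a (b * c) = \sum_(s <- legs 1 a) rb (s 0%N) b * rb (s 1%N) c.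
Proof.
rewrite rbE r_mulr (@sum_legs1_anti _ _ _ _ _ hopfD K^o); last by linearity.
by apply: eq_bigr => s _; rewrite !rbE mulrC.
Qed.

Lemma rb1l b : rb 1 b = eps b.
Proof. by rewrite rbE (anti1 hopfD) r1l. Qed.

Lemma rb1r a : rb a 1 = eps a.
Proof. by rewrite rbE r1r (eps_anti hopfD). Qed.

Lemma r_anti_mull a b c :
  r (a * b) (anti c) = \sum_(s <- legs 1 c) r a (anti (s 1%N)) * r b (anti (s 0%N)).
Proof. by rewrite r_mull (@sum_legs1_anti _ _ _ _ _ hopfD K^o); last by linearity. Qed.

Lemma r_anti_mulr a b c :
  r a (anti (b * c)) = \sum_(s <- legs 1 a) r (s 0%N) (anti b) * r (s 1%N) (anti c).
Proof. by rewrite (anti_mul hopfD) r_mulr. Qed.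

(** Apply r(-, c) to the quasi-commutativity of [a] and [b], and expand both sides by
    multiplicativity in the first slot. *)
Lemma Yang_Baxter a b c :
  \sum_(s <- legs 1 a) \sum_(t <- legs 1 b) \sum_(u <- legs 1 c)
    (r (s 0%N) (t 0%N) * r (s 1%N) (u 0%N) * r (t 1%N) (u 1%N)) =
  \sum_(s <- legs 1 a) \sum_(t <- legs 1 b) \sum_(u <- legs 1 c)
    (r (t 0%N) (u 0%N) * r (s 0%N) (u 1%N) * r (s 1%N) (t 1%N)).
Proof.
have := @r_comm_map K^o (fun x => r x c) a b (rL c).
under eq_bigr => s _ do under eq_bigr => t _ do rewrite r_mull scaler_sumr.
under [X in _ = X -> _]eq_bigr => s _ do under eq_bigr => t _ do rewrite r_mull scaler_sumr.
move=> E; transitivity (\sum_(s <- legs 1 a) \sum_(t <- legs 1 b) \sum_(u <- legs 1 c)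
    r (s 0%N) (t 0%N) *: (r (s 1%N) (u 0%N) * r (t 1%N) (u 1%N) : K^o)).
  by do 3![apply: eq_bigr => ? _]; rewrite -mulrA.
rewrite E; do 3![apply: eq_bigr => ? _].
exact: mulrC.
Qed.

(** Apply r(a, S -) to the quasi-commutativity of [b] and [c]. S and the second slot of r each
    reverse products, so r(-, S -) preserves their order there. *)
Lemma Yang_Baxter_anti a b c :
  \sum_(s <- legs 1 a) \sum_(t <- legs 1 b) \sum_(u <- legs 1 c)
    r (t 0%N) (u 0%N) * (r (s 0%N) (anti (t 1%N)) * r (s 1%N) (anti (u 1%N))) =
  \sum_(s <- legs 1 a) \sum_(t <- legs 1 b) \sum_(u <- legs 1 c)
    r (t 1%N) (u 1%N) * (r (s 0%N) (anti (u 0%N)) * r (s 1%N) (anti (t 0%N))).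
Proof.
have fl : linear (fun x => r a (anti x) : K^o) by linearity.
have := r_comm_map b c fl.
under eq_bigr => s _ do under eq_bigr => t _ do rewrite r_anti_mulr scaler_sumr.
under [X in _ = X -> _]eq_bigr => s _ do under eq_bigr => t _ do rewrite r_anti_mulr scaler_sumr.
under eq_bigr => s _ do rewrite exchange_big.
under [X in _ = X -> _]eq_bigr => s _ do rewrite exchange_big.
by rewrite exchange_big [X in _ = X -> _]exchange_big.
Qed.

Definition re_prod a b := \sum_(s <- legs 2 a) \sum_(t <- legs 2 b)
  (r (s 0%N) (t 1%N) * r (s 2%N) (anti (t 0%N))) *: (s 1%N * t 2%N).

Lemma re_prod_bilin : bilin re_prod.
Proof. by split=> x; rewrite /re_prod; linearity. Qed.

(** Expands a reflection product whose left argument is an ordinary product, as it arises in an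
    iterated product. S flips the coproduct of its leg of [c], whence the descending indices 1, 0
    next to the ascending 2, 3. *)
Lemma re_prod_mull x y c : re_prod (x * y) c =
  \sum_(p <- legs 2 x) \sum_(q <- legs 2 y) \sum_(u <- legs 4 c)
    (r (p 0%N) (u 2%N) * r (q 0%N) (u 3%N) *
     (r (p 2%N) (anti (u 1%N)) * r (q 2%N) (anti (u 0%N)))) *:
      (p 1%N * q 1%N * u 4%N).
Proof.
rewrite /re_prod (sum_legs_mul hopfD); last by linearity.
apply: eq_bigr => p _; apply: eq_bigr => q _; symmetry.
split_at c 0%N 1%N 3%N; split_at c 1%N 1%N 2%N; apply: eq_bigr => u _.
rewrite r_mull r_anti_mull mulr_suml scaler_suml; apply: eq_bigr => v _.
by rewrite mulr_sumr scaler_suml.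
Qed.

Lemma re_prod_mulr a y z : re_prod a (y * z) =
  \sum_(p <- legs 4 a) \sum_(t <- legs 2 y) \sum_(u <- legs 2 z)
    (r (p 0%N) (u 1%N) * r (p 1%N) (t 1%N) *
     (r (p 3%N) (anti (t 0%N)) * r (p 4%N) (anti (u 0%N)))) *:
      (p 2%N * (t 2%N * u 2%N)).
Proof.
rewrite /re_prod; symmetry; split_at a 3%N 1%N 3%N; split_at a 0%N 1%N 2%N; apply: eq_bigr => s _.
rewrite (sum_legs_mul hopfD); last by linearity.
under eq_bigr => p _ do rewrite exchange_big.
rewrite exchange_big; apply: eq_bigr => t _.
under eq_bigr => p _ do rewrite exchange_big.
rewrite exchange_big; apply: eq_bigr => u _.
rewrite r_mulr r_anti_mulr mulr_suml scaler_suml; apply: eq_bigr => v _.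
by rewrite mulr_sumr scaler_suml.
Qed.

Lemma re_prodA : associative re_prod.
Proof.
move=> a b c; symmetry; have [rel rer] := re_prod_bilin.
(* Full expansion of the bracketing (a . b) . c; each element contributes five legs. *)
transitivity (\sum_(s <- legs 4 a) \sum_(t <- legs 4 b) \sum_(u <- legs 4 c)
  (r (s 0%N) (t 1%N) * r (s 1%N) (u 2%N) * r (t 2%N) (u 3%N) *
    (r (s 3%N) (anti (u 1%N)) * r (s 4%N) (anti (t 0%N)) * r (t 4%N) (anti (u 0%N)))) *:
  (s 2%N * t 3%N * u 4%N)).
  rewrite {2}/re_prod (linear_fun_sum _ _ (rel c)); symmetry.
  split_at a 1%N 2%N 2%N; apply: eq_bigr => s _.
  rewrite (linear_fun_sum _ _ (rel c)).
  under eq_bigr => p _ do split_at b 2%N 2%N 2%N.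
  rewrite exchange_big; apply: eq_bigr => t _.
  rewrite (linear_scale (rel c)) re_prod_mull scaler_sumr; apply: eq_bigr => p _.
  rewrite scaler_sumr; apply: eq_bigr => q _.
  rewrite scaler_sumr; apply: eq_bigr => u _.
  rewrite scalerA; congr (_ *: _).
  by ring.
transitivity (\sum_(s <- legs 4 a) \sum_(t <- legs 4 b) \sum_(u <- legs 4 c)
  (r (t 1%N) (u 2%N) * r (s 0%N) (u 3%N) * r (s 1%N) (t 2%N) *
    (r (s 3%N) (anti (u 1%N)) * r (s 4%N) (anti (t 0%N)) * r (t 4%N) (anti (u 0%N)))) *:
  (s 2%N * t 3%N * u 4%N)).
  (* Yang-Baxter acts on legs 0, 1 of [a], legs 1, 2 of [b] and legs 2, 3 of [c]. *)
  apply: (@sum_block3 _ _ _ _ coalgD _ 0 1 2 3) => //; [by linearity .. | ].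
  move=> s t u; legs_simpl; apply: eq_scale_sum3.
  exact: Yang_Baxter.
transitivity (\sum_(s <- legs 4 a) \sum_(t <- legs 4 b) \sum_(u <- legs 4 c)
  (r (t 0%N) (u 1%N) * (r (s 3%N) (anti (t 1%N)) * r (s 4%N) (anti (u 2%N))) *
    (r (s 0%N) (u 3%N) * r (s 1%N) (t 2%N) * r (t 4%N) (anti (u 0%N)))) *:
  (s 2%N * t 3%N * u 4%N)).
  transitivity (\sum_(s <- legs 4 a) \sum_(t <- legs 4 b) \sum_(u <- legs 4 c)
    (r (t 1%N) (u 2%N) * (r (s 3%N) (anti (u 1%N)) * r (s 4%N) (anti (t 0%N))) *
      (r (s 0%N) (u 3%N) * r (s 1%N) (t 2%N) * r (t 4%N) (anti (u 0%N)))) *: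
    (s 2%N * t 3%N * u 4%N)).
    by do 3![apply: eq_bigr => ? _]; congr (_ *: _); ring.
  (* The factor r(t_1, u_2) just produced by Yang-Baxter is the one that the variant with S
     consumes, now on legs 3, 4 of [a], legs 0, 1 of [b] and legs 1, 2 of [c]. *)
  apply: (@sum_block3 _ _ _ _ coalgD _ 3 0 1 3) => //; [by linearity .. | ].
  move=> s t u; legs_simpl; apply: eq_scale_sum3; symmetry.
  exact: Yang_Baxter_anti.
(* The sum reached is already the expansion of a . (b . c); only regrouping remains. *)
rewrite {2}/re_prod (linear_fun_sum _ _ (rer a)).
under [RHS]eq_bigr => t _.
  rewrite (linear_fun_sum _ _ (rer a)).
  under eq_bigr => u _ do rewrite (linear_scale (rer a)) re_prod_mulr scaler_sumr.
  rewrite exchange_big; over.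
rewrite [RHS]exchange_big; apply: eq_bigr => s _.
split_at b 1%N 2%N 2%N; apply: eq_bigr => t _.
under [LHS]eq_bigr => p _ do split_at c 2%N 2%N 2%N.
rewrite [LHS]exchange_big; apply: eq_bigr => u _.
rewrite scaler_sumr; apply: eq_bigr => p _.
rewrite scaler_sumr; apply: eq_bigr => q _.
by rewrite scalerA; congr (_ *: _); [ring | rewrite mulrA].
Qed.

Lemma re_prod1l : left_id 1 re_prod.
Proof.
move=> b; rewrite /re_prod sum_legs_one2; last by linearity.
rewrite -[RHS](sum_counit1l hopfD _ (@linear_id _ D)).
rewrite -(@sum_counit _ _ _ _ coalgD _ 0 1); [ | by [] | by linearity].
by apply: eq_bigr => s _; legs_simpl; rewrite !r1l (eps_anti hopfD) mul1r scalerA mulrC.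
Qed.

Lemma re_prod1r : right_id 1 re_prod.
Proof.
move=> a; rewrite /re_prod; under eq_bigr => s _.
  rewrite sum_legs_one2; last by linearity.
  legs_simpl; rewrite (anti1 hopfD) !r1r mulr1; over.
rewrite -[RHS](sum_counit1r hopfD _ (@linear_id _ D)).
rewrite -(@sum_counit _ _ _ _ coalgD _ 0 1); [ | by [] | by linearity].
by apply: eq_bigr => s _; legs_simpl; rewrite scalerA.
Qed.

End Coquasitriangular.

(** * The tensor square as a coalgebra *)

Section SquareCoalgebra.
Variables (K : comNzRingType) (D : algType K).
Variables (cop : D -> tensor D D) (eps : D -> K).
Hypothesis coalgD : is_coalgebra cop eps.
Notation legs := (legs cop).
Notation scop := (square_cop cop).
Notation seps := (square_eps eps).

Let copL := coalg_cop_linear coalgD.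
Let epsL : linear (eps : D -> K^o) := coalg_eps_linear coalgD.

Let linear_legs (N M : lmodType K) n (F : (nat -> D) -> M) (g : N -> D) :
  linear g -> multilinear n F -> linear (fun x => \sum_(s <- legs n (g x)) F s).
Proof. by move=> gl Fm; exact: (linear_comp (legs_linear coalgD Fm) gl). Qed.

Ltac linear_hook ::= first [apply: linear_legs | apply: (linear_comp copL)
  | apply: (linear_comp epsL)].

Let scop_sum a b := \sum_(s <- legs 1 a) \sum_(t <- legs 1 b)
  (s 0%N ⊗ t 0%N) ⊗ (s 1%N ⊗ t 1%N).

Let scop_sum_bilin : bilin scop_sum.
Proof. by split=> x; rewrite /scop_sum; linearity. Qed.

Let scop_lift : scop = tensor_lift scop_sum.
Proof.
congr tensor_lift; do 2!apply/funext => ?; rewrite /scop_sum.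
by rewrite sum_legs1; apply: eq_tensor_lift => ? ?; rewrite sum_legs1.
Qed.

Lemma square_cop_linear : linear scop.
Proof. by rewrite scop_lift; exact: tensor_lift_linear. Qed.

Lemma square_copE a b : scop (a ⊗ b) =
  \sum_(s <- legs 1 a) \sum_(t <- legs 1 b) (s 0%N ⊗ t 0%N) ⊗ (s 1%N ⊗ t 1%N).
Proof. by rewrite scop_lift tensor_lift_tens. Qed.

Lemma square_cop_lift (M : lmodType K) (f : tensor D D -> tensor D D -> M) a b : bilin f ->
  tensor_lift f (scop (a ⊗ b)) =
  \sum_(s <- legs 1 a) \sum_(t <- legs 1 b) f (s 0%N ⊗ t 0%N) (s 1%N ⊗ t 1%N).
Proof.
move=> fb; have fl := tensor_lift_linear fb; rewrite square_copE (linear_fun_sum _ _ fl).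
apply: eq_bigr => s _; rewrite (linear_fun_sum _ _ fl); apply: eq_bigr => t _.
exact: tensor_lift_tens.
Qed.

Let seps_bilin : bilin (fun a b => eps a * eps b : K^o).
Proof. by split=> x; linearity. Qed.

Lemma square_eps_linear : linear (seps : tensor D D -> K^o).
Proof. exact: (tensor_lift_linear seps_bilin). Qed.

Lemma square_epsE a b : seps (a ⊗ b) = eps a * eps b.
Proof. exact: (tensor_lift_tens _ _ seps_bilin). Qed.

Let counit1l (M : lmodType K) (f : D -> M) a : linear f ->
  \sum_(s <- legs 1 a) eps (s 0%N) *: f (s 1%N) = f a.
Proof. by move=> fl; rewrite sum_legs1; exact: (counitl coalgD). Qed.

Let counit1r (M : lmodType K) (f : D -> M) a : linear f ->
  \sum_(s <- legs 1 a) eps (s 1%N) *: f (s 0%N) = f a.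
Proof. by move=> fl; rewrite sum_legs1; exact: (counitr coalgD). Qed.

Lemma square_coalgebra : is_coalgebra scop seps.
Proof.
split; [exact: square_cop_linear | exact: square_eps_linear | | |].
- pose f3 (a1 a2 : tensor D D) := tensor_lift (fun b1 b2 => b1 ⊗ (b2 ⊗ a2)) (scop a1).
  have b3 (a2 : tensor D D) : bilin (fun b1 b2 : tensor D D => b1 ⊗ (b2 ⊗ a2)).
    by split=> x; linearity.
  have f3b : bilin f3.
    split=> x; first exact: (linear_tensor_lift (b3 x) square_cop_linear).
    by apply: linear_bigop => p; linearity.
  have fr : bilin (fun a1 a2 : tensor D D => a1 ⊗ scop a2).
    by split=> x; [linearity | apply: linear_tensr; exact: square_cop_linear].
  apply: tensor_linear_ext => [||a b].
  + exact: (linear_tensor_lift f3b square_cop_linear).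
  + exact: (linear_tensor_lift fr square_cop_linear).
  rewrite !square_cop_lift //.
  under eq_bigr => s _ do under eq_bigr => t _ do rewrite /f3 square_cop_lift //.
  transitivity (\sum_(s <- legs 2 a) \sum_(t <- legs 2 b)
    (s 0%N ⊗ t 0%N) ⊗ ((s 1%N ⊗ t 1%N) ⊗ (s 2%N ⊗ t 2%N))).
    symmetry; split_at a 0%N 1%N 1%N; apply: eq_bigr => s _.
    rewrite exchange_big /=; split_at b 0%N 1%N 1%N; apply: eq_bigr => t _.
    by rewrite exchange_big.
  split_at a 1%N 1%N 1%N; apply: eq_bigr => s _.
  rewrite exchange_big /=; split_at b 1%N 1%N 1%N; apply: eq_bigr => t _.
  rewrite square_copE tens_sumr exchange_big; apply: eq_bigr => u _.
  by rewrite tens_sumr.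
- have fb : bilin (fun a1 a2 : tensor D D => seps a1 *: a2).
    by split=> x; [exact: (linear_scalel x square_eps_linear) | linearity].
  apply: (@tensor_linear_ext _ _ _ _ _ id) => // [|a b].
    exact: (linear_tensor_lift fb square_cop_linear).
  rewrite square_cop_lift // -(@counit1l _ (fun x => x ⊗ b)); last by linearity.
  apply: eq_bigr => s _; rewrite -(@counit1l _ (fun x => s 1%N ⊗ x)); last by linearity.
  by rewrite scaler_sumr; apply: eq_bigr => t _; rewrite square_epsE scalerA.
- have fb : bilin (fun a1 a2 : tensor D D => seps a2 *: a1).
    by split=> x; [linearity | exact: (linear_scalel x square_eps_linear)].
  apply: (@tensor_linear_ext _ _ _ _ _ id) => // [|a b].
    exact: (linear_tensor_lift fb square_cop_linear).
  rewrite square_cop_lift // -(@counit1r _ (fun x => x ⊗ b)); last by linearity.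
  apply: eq_bigr => s _; rewrite -(@counit1r _ (fun x => s 0%N ⊗ x)); last by linearity.
  by rewrite scaler_sumr; apply: eq_bigr => t _; rewrite square_epsE scalerA.
Qed.

End SquareCoalgebra.

(** * The dual of the twisted tensor square as a Hopf algebra *)

Section TwistedHopf.
Variables (K : comNzRingType) (D : algType K).
Variables (cop : D -> tensor D D) (eps : D -> K) (anti : D -> D).
Hypothesis hopfD : is_hopf *%R 1 cop eps anti.
Variables (r rb : D -> D -> K).
Hypothesis cqt : is_coquasitriangular cop eps r rb.
(** The product is known only through bilinearity and its values on pure tensors, which keeps the
    completed tensor products of [H] out of this section. *)
Variable tw : tensor D D -> tensor D D -> tensor D D.
Hypothesis tw_bilin : bilin tw.
Notation legs := (legs cop).
Hypothesis twE : forall al be et xi, tw (al ⊗ be) (et ⊗ xi) =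
  \sum_(s <- legs 2 be) \sum_(t <- legs 2 et)
    (rb (s 0%N) (t 0%N) * r (s 2%N) (t 2%N)) *: ((al * t 1%N) ⊗ (s 1%N * xi)).

Let coalgD := hopf_coalgebra hopfD.
Let copL := coalg_cop_linear coalgD.
Let epsL : linear (eps : D -> K^o) := coalg_eps_linear coalgD.
Let antiL := hopf_anti_linear hopfD.
Let rL := cqt_linearl cqt.
Let rR := cqt_linearr cqt.
Let rbL := cqt_inv_linearl cqt.
Let rbR := cqt_inv_linearr cqt.
Let twL := tw_bilin.1.
Let twR := tw_bilin.2.

Ltac linear_hook ::= first [apply: (linear_legs hopfD) | apply: (linear_comp antiL)
  | apply: (linear_comp epsL) | apply: (linear_comp copL)
  | apply: (linear_comp (rL _)) | apply: (linear_comp (rR _))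
  | apply: (linear_comp (rbL _)) | apply: (linear_comp (rbR _))
  | apply: (linear_comp (twL _)) | apply: (linear_comp (twR _))
  | match goal with B : bilin _ |- _ =>
      first [apply: (linear_comp (B.1 _)) | apply: (linear_comp (B.2 _))]
    end ].

(** Since [rb] and [r] split a product in opposite orders, the factors belonging to [xi] enclose
    those belonging to [x]. This nesting is what makes iterated products match. [G] stands for the
    tensor built from the middle legs. *)
Let tw_expand_l (M : lmodType K) (G : D -> D -> M) x xi si : bilin G ->
  \sum_(w <- legs 2 (x * xi)) \sum_(v <- legs 2 si)
    (rb (w 0%N) (v 0%N) * r (w 2%N) (v 2%N)) *: G (w 1%N) (v 1%N) =
  \sum_(p <- legs 2 x) \sum_(u <- legs 2 xi) \sum_(v <- legs 4 si)
    (rb (u 0%N) (v 0%N) * rb (p 0%N) (v 1%N) * (r (p 2%N) (v 3%N) * r (u 2%N) (v 4%N))) *: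
      G (p 1%N * u 1%N) (v 2%N).
Proof.
move=> Gb; rewrite (sum_legs_mul hopfD); last by linearity.
apply: eq_bigr => p _; apply: eq_bigr => u _; symmetry.
split_at si 3%N 1%N 3%N; split_at si 0%N 1%N 2%N; apply: eq_bigr => v _.
rewrite (rb_mull hopfD cqt) (cqt_mull cqt) mulr_suml scaler_suml; apply: eq_bigr => y _.
by rewrite mulr_sumr scaler_suml.
Qed.

Let tw_expand_r (M : lmodType K) (G : D -> D -> M) be et x : bilin G ->
  \sum_(s <- legs 2 be) \sum_(w <- legs 2 (et * x))
    (rb (s 0%N) (w 0%N) * r (s 2%N) (w 2%N)) *: G (s 1%N) (w 1%N) =
  \sum_(s <- legs 4 be) \sum_(t <- legs 2 et) \sum_(p <- legs 2 x)
    (rb (s 0%N) (t 0%N) * rb (s 1%N) (p 0%N) * (r (s 3%N) (p 2%N) * r (s 4%N) (t 2%N))) *: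
      G (s 2%N) (t 1%N * p 1%N).
Proof.
move=> Gb; symmetry; split_at be 3%N 1%N 3%N; split_at be 0%N 1%N 2%N; apply: eq_bigr => s _.
rewrite (sum_legs_mul hopfD); last by linearity.
under eq_bigr => y _ do rewrite exchange_big.
rewrite exchange_big; apply: eq_bigr => t _.
under eq_bigr => y _ do rewrite exchange_big.
rewrite exchange_big; apply: eq_bigr => p _.
rewrite (rb_mulr hopfD cqt) (cqt_mulr cqt) mulr_suml scaler_suml; apply: eq_bigr => y _.
by rewrite mulr_sumr scaler_suml.
Qed.

(** Both bracketings expand, by multiplicativity of r and [rb] in each slot, to one sum in which
    [be] and [si] have five legs, [et] and [xi] three. *)
Lemma twA : associative tw.
Proof.
apply: tensor_assoc_ext => // al be et xi si ta.
transitivity (\sum_(s <- legs 4 be) \sum_(t <- legs 2 et) \sum_(u <- legs 2 xi)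
    \sum_(v <- legs 4 si)
  (rb (s 0%N) (t 0%N) * r (s 4%N) (t 2%N) * (rb (u 0%N) (v 0%N) * rb (s 1%N) (v 1%N) *
    (r (s 3%N) (v 3%N) * r (u 2%N) (v 4%N)))) *: ((al * t 1%N * v 2%N) ⊗ (s 2%N * u 1%N * ta))).
  rewrite (twE et xi) (linear_fun_sum _ _ (twR _)).
  under eq_bigr => u _.
    rewrite (linear_fun_sum _ _ (twR _)).
    under eq_bigr => v _.
      rewrite (linear_scale (twR _)) twE.
      rewrite (@tw_expand_r _ (fun s t => (al * t) ⊗ (s * (u 1%N * ta)))); last first.
        by split=> z; linearity.
      rewrite scaler_sumr.
      under eq_bigr => s _.
        rewrite scaler_sumr; under eq_bigr => t _ do rewrite scaler_sumr.
        over.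
      over.
    rewrite exchange_big.
    under eq_bigr => s _ do rewrite exchange_big.
    over.
  rewrite exchange_big; apply: eq_bigr => s _.
  rewrite exchange_big; apply: eq_bigr => t _; apply: eq_bigr => u _; symmetry.
  split_at si 1%N 2%N 2%N; apply: eq_bigr => v _; apply: eq_bigr => p _.
  by rewrite scalerA !mulrA; congr (_ *: _); ring.
rewrite (twE al be) (linear_fun_sum _ _ (twL _)); split_at be 1%N 2%N 2%N.
apply: eq_bigr => s _; rewrite exchange_big (linear_fun_sum _ _ (twL _)).
apply: eq_bigr => t _; rewrite (linear_scale (twL _)) twE.
rewrite (@tw_expand_l _ (fun p v => (al * t 1%N * v) ⊗ (p * ta))); last first.
  by split=> z; linearity.
rewrite scaler_sumr; apply: eq_bigr => p _.
rewrite scaler_sumr; apply: eq_bigr => u _.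
rewrite scaler_sumr; apply: eq_bigr => v _.
by rewrite scalerA.
Qed.

Lemma tw1l : left_id (1 ⊗ 1) tw.
Proof.
apply: (@tensor_linear_ext _ _ _ _ (tw (1 ⊗ 1)) id) => // a b.
rewrite twE (sum_legs_one2 hopfD); last by linearity.
rewrite -(sum_counit1l hopfD (f := fun x => x ⊗ b)); last by linearity.
rewrite -(@sum_counit _ _ _ _ coalgD _ 2 1); [ | by [] | by linearity].
apply: eq_bigr => s _; legs_simpl.
by rewrite (rb1l hopfD cqt) (r1l hopfD cqt) !mul1r scalerA mulrC.
Qed.

Lemma tw1r : right_id (1 ⊗ 1) tw.
Proof.
apply: (@tensor_linear_ext _ _ _ _ (tw^~ (1 ⊗ 1)) id) => // a b.
rewrite twE; under eq_bigr => s _.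
  rewrite (sum_legs_one2 hopfD); last by linearity.
  legs_simpl; rewrite (rb1r hopfD cqt) (r1r hopfD cqt) !mulr1; over.
rewrite -(sum_counit1l hopfD (f := fun x => a ⊗ x)); last by linearity.
rewrite -(@sum_counit _ _ _ _ coalgD _ 2 1); [ | by [] | by linearity].
by apply: eq_bigr => s _; legs_simpl; rewrite scalerA mulrC.
Qed.

Lemma tens_sum22 (L M : lmodType K) (I J I' J' : Type) (rI : seq I) (rJ : seq J)
    (rI' : seq I') (rJ' : seq J') (f : I -> J -> K) (A : I -> J -> L)
    (g : I' -> J' -> K) (B : I' -> J' -> M) :
  (\sum_(i <- rI) \sum_(j <- rJ) f i j *: A i j) ⊗
    (\sum_(i' <- rI') \sum_(j' <- rJ') g i' j' *: B i' j') =
  \sum_(i <- rI) \sum_(i' <- rI') \sum_(j <- rJ) \sum_(j' <- rJ')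
    (f i j * g i' j') *: (A i j ⊗ B i' j').
Proof.
rewrite tens_suml; apply: eq_bigr => i _; rewrite tens_suml [RHS]exchange_big.
apply: eq_bigr => j _; rewrite tens_sumr; apply: eq_bigr => i' _.
by rewrite tens_sumr; apply: eq_bigr => j' _; rewrite tensZl tensZr scalerA.
Qed.

Lemma tw_cop x y :
  square_cop cop (tw x y) = tensor_mul tw tw (square_cop cop x) (square_cop cop y).
Proof.
have scopL := square_cop_linear coalgD.
have mulB := tensor_mul_bilin tw_bilin tw_bilin.
move: x y; apply: tensor_bilin_ext => [||al be et xi].
- by split=> z; apply: (linear_comp scopL).
- by split=> z; [apply: (linear_comp (mulB.1 _)) | apply: (linear_comp (mulB.2 _))].
transitivity (\sum_(x <- legs 1 al) \sum_(y <- legs 1 xi)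
    \sum_(s <- legs 3 be) \sum_(t <- legs 3 et) (rb (s 0%N) (t 0%N) * r (s 3%N) (t 3%N)) *:
    (((x 0%N * t 1%N) ⊗ (s 1%N * y 0%N)) ⊗ ((x 1%N * t 2%N) ⊗ (s 2%N * y 1%N)))).
  rewrite twE (linear_fun_sum _ _ scopL).
  under eq_bigr => s _.
    rewrite (linear_fun_sum _ _ scopL); under eq_bigr => t _.
      rewrite (linear_scale scopL) (square_copE coalgD) (sum_legs_mul hopfD); last by linearity.
      under eq_bigr => x _.
        under eq_bigr => t' _.
          rewrite (sum_legs_mul hopfD); last by linearity.
          rewrite exchange_big; over.
        rewrite exchange_big; over.
      rewrite scaler_sumr; under eq_bigr => x _ do rewrite scaler_sumr; over.
    rewrite exchange_big; under eq_bigr => x _ do rewrite exchange_big.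
    over.
  rewrite exchange_big; apply: eq_bigr => x _.
  rewrite exchange_big; apply: eq_bigr => y _.
  symmetry; under [LHS]eq_bigr => s _ do split_at et 1%N 1%N 2%N.
  split_at be 1%N 1%N 2%N; apply: eq_bigr => s _.
  rewrite exchange_big; apply: eq_bigr => t _.
  rewrite exchange_big scaler_sumr; apply: eq_bigr => t' _.
  by rewrite scaler_sumr.
rewrite !(square_copE coalgD) (linear_fun_sum _ _ (mulB.1 _)); apply: eq_bigr => x _.
rewrite (linear_fun_sum _ _ (mulB.1 _)).
under [RHS]eq_bigr => s _.
  rewrite (linear_fun_sum _ _ (mulB.2 _)); under eq_bigr => t _.
    rewrite (linear_fun_sum _ _ (mulB.2 _)); under eq_bigr => y _ do
      rewrite (tensor_mul_tens tw_bilin tw_bilin) !twE tens_sum22.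
    over.
  rewrite exchange_big; over.
cbv beta; rewrite [RHS]exchange_big; apply: eq_bigr => y _.
(* Multiplying the two halves of the coproducts leaves r(s_2, t_2), from the first half, next to
   rb(s_3, t_3), from the second. These are convolution inverse, and removing the resulting counits
   leaves four legs of [be] and of [et]. *)
transitivity (\sum_(s <- legs 5 be) \sum_(t <- legs 5 et)
    (r (s 2%N) (t 2%N) * rb (s 3%N) (t 3%N) * (rb (s 0%N) (t 0%N) * r (s 5%N) (t 5%N))) *:
    (((x 0%N * t 1%N) ⊗ (s 1%N * y 0%N)) ⊗ ((x 1%N * t 4%N) ⊗ (s 4%N * y 1%N)))).
  symmetry; under [LHS]eq_bigr => s _ do split_at et 2%N 1%N 4%N.
  split_at be 2%N 1%N 4%N; under eq_bigr => s _.
    rewrite exchange_big; under eq_bigr => t _ do rewrite scale_sum2 (cqt_inv cqt).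
    over.
  symmetry; under [LHS]eq_bigr => s _.
    rewrite -(@sum_counit _ _ _ _ coalgD _ 2 3); [ | by [] | by linearity].
    over.
  rewrite -(@sum_counit _ _ _ _ coalgD _ 2 3); [ | by [] | by linearity].
  apply: eq_bigr => s _; legs_simpl; rewrite scaler_sumr; apply: eq_bigr => t _.
  by rewrite !scalerA !mulrA.
under [LHS]eq_bigr => s _ do (split_at et 3%N 2%N 3%N; split_at et 0%N 2%N 1%N).
split_at be 3%N 2%N 3%N; split_at be 0%N 2%N 1%N; apply: eq_bigr => s _.
under [LHS]eq_bigr => s' _ do rewrite exchange_big.
rewrite [LHS]exchange_big; apply: eq_bigr => t _.
do 4![apply: eq_bigr => ? _]; congr (_ *: _); ring.
Qed.

(** The counit removes the middle legs, and the remaining coefficients form the convolution product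
    of [rb] with r, which is trivial. *)
Lemma tw_eps x y : square_eps eps (tw x y) = square_eps eps x * square_eps eps y.
Proof.
have sepsL := square_eps_linear coalgD.
move: x y; apply: (@tensor_bilin_ext _ _ _ _ _ K^o) => [||al be et xi].
- by split=> z; apply: (linear_comp sepsL).
- by split=> z; [apply: linear_coefl | apply: linear_coefr].
rewrite twE (linear_fun_sum _ _ sepsL) !(square_epsE coalgD).
transitivity ((eps al * eps xi) *: (eps be * eps et : K^o)); last first.
  by rewrite /GRing.scale /=; ring.
rewrite -(cqt_invl cqt be et) -(@sum_counit _ _ _ _ coalgD K^o 1 1); [ | by [] | by linearity].
rewrite scaler_sumr; apply: eq_bigr => s _; legs_simpl.
rewrite -(@sum_counit _ _ _ _ coalgD K^o 1 1); [ | by [] | by linearity].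
rewrite (linear_fun_sum _ _ sepsL) !scaler_sumr; apply: eq_bigr => t _; legs_simpl.
rewrite (linear_scale sepsL) (square_epsE coalgD) !(hopf_epsM hopfD).
by rewrite /GRing.scale /=; ring.
Qed.

Let tw_mull a b c : tw (a ⊗ 1) (b ⊗ c) = (a * b) ⊗ c.
Proof.
rewrite twE (sum_legs_one2 hopfD); last by linearity.
rewrite -(sum_counit1l hopfD (f := fun x => (a * x) ⊗ c)); last by linearity.
rewrite -(@sum_counit _ _ _ _ coalgD _ 2 1); [ | by [] | by linearity].
apply: eq_bigr => s _; legs_simpl.
by rewrite (rb1l hopfD cqt) (r1l hopfD cqt) !mul1r scalerA mulrC.
Qed.

Let tw_mulr a b c : tw (a ⊗ b) (1 ⊗ c) = a ⊗ (b * c).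
Proof.
rewrite twE; under eq_bigr => s _.
  rewrite (sum_legs_one2 hopfD); last by linearity.
  legs_simpl; rewrite (rb1r hopfD cqt) (r1r hopfD cqt) !mulr1; over.
rewrite -(sum_counit1l hopfD (f := fun x => a ⊗ (x * c))); last by linearity.
rewrite -(@sum_counit _ _ _ _ coalgD _ 2 1); [ | by [] | by linearity].
by apply: eq_bigr => s _; legs_simpl; rewrite scalerA mulrC.
Qed.

(** Not the componentwise antipode: elements of the two factors commute under [tw] only up to [rb]
    and r, so the antihomomorphism has to be applied to the factorization of [al ⊗ be]. *)
Definition tw_anti : tensor D D -> tensor D D :=
  tensor_lift (fun al be => tw (1 ⊗ anti be) (anti al ⊗ 1)).

Let tw_anti_bilin : bilin (fun al be => tw (1 ⊗ anti be) (anti al ⊗ 1)).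
Proof. by split=> x; linearity. Qed.

Let tw_antiE al be : tw_anti (al ⊗ be) = tw (1 ⊗ anti be) (anti al ⊗ 1).
Proof. exact: tensor_lift_tens. Qed.

Let tw_antiL : linear tw_anti.
Proof. exact: tensor_lift_linear. Qed.

Lemma tw_hopf : is_hopf tw (1 ⊗ 1) (square_cop cop) (square_eps eps) tw_anti.
Proof.
have scopL := square_cop_linear coalgD.
have sepsL := square_eps_linear coalgD.
split.
- by split; [exact: tw_bilin | exact: twA | exact: tw1l | exact: tw1r].
- exact: square_coalgebra.
- exact: tw_cop.
- rewrite (square_copE coalgD) (sum_legs_one1 hopfD); last by linearity.
  by rewrite (sum_legs_one1 hopfD) //; linearity.
- exact: tw_eps.
- by rewrite (square_epsE coalgD) (hopf_eps1 hopfD) mulr1.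
- exact: tw_antiL.
- have fb : bilin (fun a1 a2 => tw (tw_anti a1) a2).
    by split=> x; [apply: (linear_comp (twL _)); exact: tw_antiL | exact: twR].
  apply: tensor_linear_ext => [||al be].
  + exact: (linear_tensor_lift fb scopL).
  + exact: (linear_scalel (1 ⊗ 1) sepsL).
  rewrite (square_cop_lift coalgD) // (square_epsE coalgD) -scalerA exchange_big.
  have -> : eps be *: (1 ⊗ 1) = \sum_(t <- legs 1 be) (1 : D) ⊗ (anti (t 0%N) * t 1%N).
    by rewrite (sum_antil hopfD (f := fun x => 1 ⊗ x)) //; linearity.
  rewrite scaler_sumr; apply: eq_bigr => t _.
  (* In this order the two [al] terms are adjacent and enclosed by the [be] terms, so [al] collapses
     first. *)
  transitivity (\sum_(s <- legs 1 al)
      tw (1 ⊗ anti (t 0%N)) (tw ((anti (s 0%N) * s 1%N) ⊗ 1) (1 ⊗ t 1%N))).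
    apply: eq_bigr => s _; rewrite tw_antiE -tw_mull -!twA tw_mulr mul1r.
    by rewrite !tw_mull.
  rewrite (sum_antil hopfD (f := fun x => tw (1 ⊗ anti (t 0%N)) (tw (x ⊗ 1) (1 ⊗ t 1%N)))).
    by rewrite tw1l tw_mulr.
  by linearity.
- have fb : bilin (fun a1 a2 => tw a1 (tw_anti a2)).
    by split=> x; [exact: twL | apply: (linear_comp (twR _)); exact: tw_antiL].
  apply: tensor_linear_ext => [||al be].
  + exact: (linear_tensor_lift fb scopL).
  + exact: (linear_scalel (1 ⊗ 1) sepsL).
  rewrite (square_cop_lift coalgD) // (square_epsE coalgD) mulrC -scalerA.
  have -> : eps al *: (1 ⊗ 1) = \sum_(s <- legs 1 al) (s 0%N * anti (s 1%N)) ⊗ (1 : D).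
    by rewrite (sum_antir hopfD (f := fun x => x ⊗ 1)) //; linearity.
  rewrite scaler_sumr; apply: eq_bigr => s _.
  (* On this side the [be] terms are the inner ones and collapse first. *)
  transitivity (\sum_(t <- legs 1 be)
      tw (s 0%N ⊗ 1) (tw (1 ⊗ (t 0%N * anti (t 1%N))) (anti (s 1%N) ⊗ 1))).
    apply: eq_bigr => t _; rewrite tw_antiE -tw_mulr -!twA.
    have -> : s 0%N ⊗ t 0%N = tw (s 0%N ⊗ 1) (1 ⊗ t 0%N) by rewrite tw_mulr mul1r.
    by rewrite -!twA.
  rewrite (sum_antir hopfD (f := fun x => tw (s 0%N ⊗ 1) (tw (1 ⊗ x) (anti (s 1%N) ⊗ 1)))).
    by rewrite tw1l tw_mull.
  by linearity.
Qed.

(** * The coaction *)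

Notation rmul := (re_prod cop anti r).
Notation coaction := (re_coaction cop anti).

Lemma re_coactionE a : coaction a = \sum_(s <- legs 2 a) s 1%N ⊗ (anti (s 0%N) ⊗ s 2%N).
Proof.
rewrite sum_legsS; apply: eq_tensor_lift => a1 a2; by rewrite sum_legs1.
Qed.

Lemma re_coaction_linear : linear coaction.
Proof. by move=> k u v; rewrite !re_coactionE; apply: (legs_linear coalgD); linearity. Qed.

Lemma re_coaction_lift (M : lmodType K) (f : D -> tensor D D -> M) a : bilin f ->
  tensor_lift f (coaction a) = \sum_(s <- legs 2 a) f (s 1%N) (anti (s 0%N) ⊗ s 2%N).
Proof.
move=> fb; rewrite re_coactionE (linear_fun_sum _ _ (tensor_lift_linear fb)).
by apply: eq_bigr => s _; rewrite tensor_lift_tens.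
Qed.

Lemma re_coactionM a b :
  coaction (rmul a b) = tensor_mul rmul tw (coaction a) (coaction b).
Proof.
have reB := re_prod_bilin hopfD cqt.
have mulB := tensor_mul_bilin reB tw_bilin.
transitivity (\sum_(s <- legs 4 a) \sum_(t <- legs 4 b)
    (r (s 0%N) (t 1%N) * r (s 4%N) (anti (t 0%N))) *:
    ((s 2%N * t 3%N) ⊗ (anti (s 1%N * t 2%N) ⊗ (s 3%N * t 4%N)))).
  rewrite /re_prod (linear_fun_sum _ _ re_coaction_linear); symmetry.
  split_at a 1%N 2%N 2%N; apply: eq_bigr => s _.
  under eq_bigr => p _ do split_at b 2%N 2%N 2%N.
  rewrite exchange_big (linear_fun_sum _ _ re_coaction_linear); apply: eq_bigr => t _.
  rewrite (linear_scale re_coaction_linear) re_coactionE.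
  rewrite (sum_legs_mul hopfD); last by linearity.
  rewrite scaler_sumr; apply: eq_bigr => p _.
  by rewrite scaler_sumr.
transitivity (\sum_(s <- legs 4 a) \sum_(t <- legs 4 b)
    (r (s 1%N) (t 2%N) * r (s 4%N) (anti (t 0%N))) *:
    ((s 2%N * t 3%N) ⊗ (anti (t 1%N * s 0%N) ⊗ (s 3%N * t 4%N)))).
  (* S reverses products, whereas delta(a) delta(b) contains S(a_1) times S(b_2) in this order.
     Quasi-commutativity on legs 0, 1 of [a] and legs 1, 2 of [b] exchanges the factors under S. *)
  apply: (@sum_block2 _ _ _ _ coalgD _ 0 1 1 1 3 3) => //; [by linearity .. | ].
  move=> s t; legs_simpl.
  have fl : linear (fun z => r (s 3%N) (anti (t 0%N)) *:
      ((s 1%N * t 2%N) ⊗ (anti z ⊗ (s 2%N * t 3%N)))).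
    by linearity.
  have := r_comm_map cqt (s 0%N) (t 1%N) fl.
  under eq_bigr => x _ do under eq_bigr => y _ do rewrite scalerA.
  under [X in _ = X -> _]eq_bigr => x _ do under eq_bigr => y _ do rewrite scalerA.
  exact.
transitivity (\sum_(s <- legs 6 a) \sum_(t <- legs 6 b)
    (r (s 3%N) (anti (t 3%N)) * rb (s 4%N) (anti (t 2%N)) *
     (r (s 1%N) (t 4%N) * r (s 6%N) (anti (t 0%N)))) *:
    ((s 2%N * t 5%N) ⊗ ((anti (s 0%N) * anti (t 1%N)) ⊗ (s 5%N * t 6%N)))).
  (* The inverse law at [x] and S(y); the flipped coproduct of S(y) brings leg 1 of [y] before leg
     0. *)
  have r_rb_anti x y : \sum_(s <- legs 1 x) \sum_(t <- legs 1 y)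
      r (s 0%N) (anti (t 1%N)) * rb (s 1%N) (anti (t 0%N)) = eps x * eps y.
    rewrite -[eps y](eps_anti hopfD) -(cqt_inv cqt); apply: eq_bigr => s _.
    by rewrite (@sum_legs1_anti _ _ _ _ _ hopfD K^o); last by linearity.
  symmetry; under [LHS]eq_bigr => s _ do split_at b 2%N 1%N 5%N.
  split_at a 3%N 1%N 5%N; under eq_bigr => s _.
    rewrite exchange_big; under eq_bigr => t _ do rewrite scale_sum2 r_rb_anti.
    over.
  symmetry; under [LHS]eq_bigr => s _.
    rewrite -(@sum_counit _ _ _ _ coalgD _ 2 4); [ | by [] | by linearity].
    over.
  rewrite -(@sum_counit _ _ _ _ coalgD _ 3 4); [ | by [] | by linearity].
  apply: eq_bigr => s _; legs_simpl; rewrite scaler_sumr; apply: eq_bigr => t _.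
  by rewrite (anti_mul hopfD) !scalerA !mulrA.
rewrite !re_coactionE (linear_fun_sum _ _ (mulB.1 _)).
(* Origin of the seven legs: delta gives three, [rmul] triples the middle leg on both sides, and
   [tw] triples the last leg of [a] and the first leg of [b], the latter under S. *)
under [LHS]eq_bigr => s _ do (split_at b 0%N 2%N 4%N; split_at b 1%N 2%N 2%N).
split_at a 4%N 2%N 4%N; split_at a 1%N 2%N 2%N; apply: eq_bigr => s _.
rewrite (linear_fun_sum _ _ (mulB.2 _)).
under [LHS]eq_bigr => p _ do rewrite exchange_big.
rewrite [LHS]exchange_big; apply: eq_bigr => t _.
rewrite (tensor_mul_tens reB tw_bilin) twE.
under [X in _ = _ ⊗ X]eq_bigr => x _.
  rewrite (sum_legs2_anti hopfD); last by linearity.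
  over.
rewrite tens_sum22; do 4![apply: eq_bigr => ? _].
by legs_simpl; congr (_ *: _); ring.
Qed.

Lemma re_coaction1 : coaction 1 = 1 ⊗ (1 ⊗ 1).
Proof.
rewrite re_coactionE (sum_legs_one2 hopfD); last by linearity.
by legs_simpl; rewrite (anti1 hopfD).
Qed.

(** Both sides are one sum over five legs: the flipped coproduct of S(a_1) orders the antipodes as
    the nested coactions do. *)
Lemma re_coaction_coassoc a :
  tensor_lift (fun b c => b ⊗ square_cop cop c) (coaction a) =
  tensor_lift (fun b c => tensor_lift (fun b' c' => b' ⊗ (c' ⊗ c)) (coaction b)) (coaction a).
Proof.
have scopL := square_cop_linear coalgD.
have b3 (c : tensor D D) : bilin (fun (b' : D) (c' : tensor D D) => b' ⊗ (c' ⊗ c)).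
  by split=> x; linearity.
rewrite !re_coaction_lift; last by split=> x; [linearity | apply: linear_tensr].
  transitivity (\sum_(s <- legs 4 a)
      s 2%N ⊗ ((anti (s 1%N) ⊗ s 3%N) ⊗ (anti (s 0%N) ⊗ s 4%N))).
    symmetry; split_at a 3%N 1%N 3%N; split_at a 0%N 1%N 2%N; apply: eq_bigr => s _.
    rewrite (square_copE coalgD) (sum_legs1_anti hopfD); last by linearity.
    rewrite tens_sumr; apply: eq_bigr => x _; rewrite tens_sumr.
    by apply: eq_bigr => y _; legs_simpl.
  by split_at a 1%N 2%N 2%N; apply: eq_bigr => s _; rewrite re_coaction_lift.
split=> x; first exact: (linear_tensor_lift (b3 x) re_coaction_linear).
by apply: linear_bigop => p; linearity.
Qed.

Lemma re_coaction_counit a :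
  tensor_lift (fun b c => square_eps eps c *: b) (coaction a) = a.
Proof.
have sepsL := square_eps_linear coalgD.
rewrite re_coaction_lift; last by split=> x; [linearity | exact: linear_scalel].
rewrite -[RHS](sum_counit1l hopfD _ (@linear_id _ D)).
rewrite -(@sum_counit _ _ _ _ coalgD _ 2 1); [ | by [] | by linearity].
apply: eq_bigr => s _; legs_simpl.
by rewrite (square_epsE coalgD) (eps_anti hopfD) scalerA mulrC.
Qed.

Theorem re_comodule_algebra :
  is_right_comodule_algebra rmul 1 tw (1 ⊗ 1) (square_cop cop) (square_eps eps) coaction.
Proof.
split.
- split; [exact: (re_prod_bilin hopfD cqt) | exact: (re_prodA hopfD cqt)
    | exact: (re_prod1l hopfD cqt) | exact: (re_prod1r hopfD cqt)].
- by exists tw_anti; exact: tw_hopf.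
- exact: re_coaction_linear.
- exact: re_coactionM.
- exact: re_coaction1.
- exact: re_coaction_coassoc.
- exact: re_coaction_counit.
Qed.

End TwistedHopf.

(** * Continuous maps on completed tensor products *)

Section Continuity.
Variable K : comNzRingType.

Lemma nbase_zero (M : lmodType K) (t : lintop M) W : nbase t W -> W 0.
Proof. by case/nbase_submodule. Qed.

Lemma nbase_add (M : lmodType K) (t : lintop M) W u v : nbase t W -> W u -> W v -> W (u + v).
Proof. by case/nbase_submodule => _ h hu hv; rewrite -[u]scale1r; exact: h. Qed.

Lemma nbase_scale (M : lmodType K) (t : lintop M) W k u : nbase t W -> W u -> W (k *: u).
Proof. by case/nbase_submodule => h0 h hu; rewrite -[_ *: _]addr0; exact: h. Qed.

Lemma nbase_sum (M : lmodType K) (t : lintop M) W I (r : seq I) (F : I -> M) :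
  nbase t W -> (forall i, W (F i)) -> W (\sum_(i <- r) F i).
Proof.
move=> hW hF; elim: r => [|i r IHr]; first by rewrite big_nil; exact: nbase_zero hW.
by rewrite big_cons; exact: (nbase_add hW).
Qed.

Lemma continuous_comp (L M N : lmodType K) (tL : lintop L) (tM : lintop M) (tN : lintop N)
    (f : M -> N) (g : L -> M) : continuous_lin tM tN f -> continuous_lin tL tM g ->
  continuous_lin tL tN (fun x => f (g x)).
Proof.
move=> [fl fc] [gl gc]; split=> [|W /fc[V /gc[U hU gU] fV]].
  exact: linear_comp.
by exists U => // x /gU /fV.
Qed.

Lemma continuous_sum (M N : lmodType K) (tM : lintop M) (tN : lintop N) I (r : seq I)
    (F : I -> M -> N) : (forall i, continuous_lin tM tN (F i)) ->
  continuous_lin tM tN (fun x => \sum_(i <- r) F i x).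
Proof.
move=> Fc; split=> [|W hW]; first by apply: linear_bigop => i; exact: (Fc i).1.
elim: r => [|i r [U hU hr]].
  have [U hU] := nbase_neq0 tM; exists U => // x _; rewrite big_nil.
  exact: nbase_zero hW.
have [V hV hi] := (Fc i).2 _ hW; have [X hX sX] := nbase_directed hU hV.
exists X => // x /sX[/hr hx /hi hy]; rewrite big_cons; exact: (nbase_add hW).
Qed.

Lemma continuous_scale (M N : lmodType K) (tM : lintop M) (tN : lintop N) k (f : M -> N) :
  continuous_lin tM tN f -> continuous_lin tM tN (fun x => k *: f x).
Proof.
move=> [fl fc]; split=> [|W hW]; first exact: linear_scaler.
by have [U hU fU] := fc _ hW; exists U => // x /fU; exact: nbase_scale hW.
Qed.

Lemma continuous_add (M N : lmodType K) (tM : lintop M) (tN : lintop N) (f g : M -> N) :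
  continuous_lin tM tN f -> continuous_lin tM tN g ->
  continuous_lin tM tN (fun x => f x + g x).
Proof.
move=> [fl fc] [gl gc]; split=> [k u v|W hW] /=.
  by rewrite fl gl scalerDr addrACA.
have [U hU fU] := fc _ hW; have [V hV gV] := gc _ hW.
have [X hX sX] := nbase_directed hU hV.
by exists X => // x /sX[/fU hf /gV hg]; exact: (nbase_add hW).
Qed.

Lemma continuous_bilin_comp (A B M N : lmodType K) (tA : lintop A) (tB : lintop B)
    (tM : lintop M) (tN : lintop N) (f : A -> B -> M) (g : M -> N) :
  continuous_bilin tA tB tM f -> continuous_lin tM tN g ->
  continuous_bilin tA tB tN (fun a b => g (f a b)).
Proof.
move=> [[fl fr] fc] [gl gc]; split.
  by split=> x; [apply: (linear_comp gl (fl x)) | apply: (linear_comp gl (fr x))].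
move=> W /gc[V /fc[U [U' [hU hU' fUV]]] gV].
by exists U, U'; split => // a b /fUV /gV.
Qed.

Lemma continuous_bilin_precomp (A B A' B' N : lmodType K) (tA : lintop A) (tB : lintop B)
    (tA' : lintop A') (tB' : lintop B') (tN : lintop N) (f : A -> B -> N)
    (g : A' -> A) (h : B' -> B) :
  continuous_bilin tA tB tN f -> continuous_lin tA' tA g -> continuous_lin tB' tB h ->
  continuous_bilin tA' tB' tN (fun a b => f (g a) (h b)).
Proof.
move=> [[fl fr] fc] [gl gc] [hl hc]; split.
  by split=> x; [apply: (linear_comp (fl _) gl) | apply: (linear_comp (fr _) hl)].
move=> W /fc[U [V [/gc[U' hU' gU] /hc[V' hV' hV] fUV]]].
by exists U', V'; split => // a b [/gU|/hV] ?; apply: fUV; [left | right].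
Qed.

Lemma continuous_bilin_flip (A B N : lmodType K) (tA : lintop A) (tB : lintop B)
    (tN : lintop N) (f : A -> B -> N) : continuous_bilin tA tB tN f ->
  continuous_bilin tB tA tN (fun b a => f a b).
Proof.
move=> [[fl fr] fc]; split=> [//|W /fc[U [V [hU hV fUV]]]].
by exists V, U; split => // b a h; apply: fUV; case: h; [right | left].
Qed.

Lemma continuous_bilin_l (A B N : lmodType K) (tA : lintop A) (tB : lintop B)
    (tN : lintop N) (f : A -> B -> N) b : continuous_bilin tA tB tN f ->
  continuous_lin tA tN (f^~ b).
Proof.
move=> [[fl fr] fc]; split=> [|W /fc[U [V [hU hV fUV]]]]; first exact: fl.
by exists U => // a Ua; apply: fUV; left.
Qed.

Lemma continuous_bilin_r (A B N : lmodType K) (tA : lintop A) (tB : lintop B)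
    (tN : lintop N) (f : A -> B -> N) a : continuous_bilin tA tB tN f ->
  continuous_lin tB tN (f a).
Proof.
by move=> fc; exact: (continuous_bilin_l a (continuous_bilin_flip fc)).
Qed.

Lemma continuous_id (M : lmodType K) (t : lintop M) : continuous_lin t t (fun x => x).
Proof. by split=> // W hW; exists W. Qed.

Section CompletedTensor.
Variables (A B C : lmodType K) (tA : lintop A) (tB : lintop B) (tC : lintop C).
Hypothesis hC : complete_top tC.
Notation T := (ctensor_top tA tB).

(** Both maps are the continuous extension of the same bilinear map, hence equal. Identities about
    elements of a completed tensor product are reduced to pure tensors in this way. *)
Lemma ctensor_linear_ext (f g : ctensor tA tB -> C) :
  continuous_lin T tC f -> continuous_lin T tC g ->
  (forall a b, f (a ⊗^ b) = g (a ⊗^ b)) -> f =1 g.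
Proof.
move=> fc gc fg z.
have gb := continuous_bilin_comp (ctens_continuous tA tB) gc.
by rewrite (ctensor_lift_uniq hC gb fc fg) -(ctensor_lift_uniq hC gb gc).
Qed.

Lemma ctensor_lift_param (X : lmodType K) (F : X -> A -> B -> C) (z : ctensor tA tB) :
  (forall x, continuous_bilin tA tB tC (F x)) -> (forall a b, linear (fun x => F x a b)) ->
  linear (fun x => ctensor_lift tC (F x) z).
Proof.
move=> Fc Fl k u v; move: z; apply: ctensor_linear_ext => [||a b].
- exact: ctensor_lift_continuous.
- apply: continuous_add; last exact: ctensor_lift_continuous.
  by apply: continuous_scale; exact: ctensor_lift_continuous.
by rewrite !ctensor_lift_ctens //; exact: Fl.
Qed.

Section Bound.
Variables (f : A -> B -> C) (fc : continuous_bilin tA tB tC f).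
Variables (W : set C) (hW : nbase tC W).

Let lift_in (s : seq (A * B)) :
  ctensor_lift tC f (in_completion (tensor_top tA tB) (\sum_(p <- s) p.1 ⊗ p.2)) =
  \sum_(p <- s) f p.1 p.2.
Proof.
have il := in_completion_linear (tensor_top tA tB).
have fl := (ctensor_lift_continuous hC fc).1.
rewrite (linear_fun_sum _ _ il) (linear_fun_sum _ _ fl).
by apply: eq_bigr => p _; exact: ctensor_lift_ctens.
Qed.

(** Values at finite sums of pure tensors lie in the submodule [W], and every [z] differs from such
    a sum by an element mapped into [W]. *)
Lemma ctensor_lift_bound : (forall a b, W (f a b)) ->
  forall z : ctensor tA tB, W (ctensor_lift tC f z).
Proof.
move=> fW z; have [fl /(_ _ hW)[X hX fX]] := ctensor_lift_continuous hC fc.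
have [m hm] := in_completion_dense z hX.
rewrite -[z](subrK (in_completion (tensor_top tA tB) m)) (linear_add fl).
apply: (nbase_add hW); first exact: fX.
by rewrite (tensor_sum m) lift_in; apply: (nbase_sum _ hW) => p.
Qed.

(* The neighbourhood depends on [U] and [V] only, not on [f]: this gives the
   uniformity needed for lifts of lifts. *)
Lemma ctensor_lift_nbhd (U : set A) (V : set B) (i : nidx (tensor_top tA tB)) :
  sval i = tensor_nbhd U V -> (forall a b, U a \/ V b -> W (f a b)) ->
  forall z : ctensor tA tB, ker_at i z -> W (ctensor_lift tC f z).
Proof.
move=> ei fW z zi; have [fl /(_ _ hW)[X hX fX]] := ctensor_lift_continuous hC fc.
have hi : nbase T (ker_at i) by exact: imageT.
have [Y hY sY] := nbase_directed hX hi.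
have [m /sY[/fX hm /ker_at_subP him]] := in_completion_dense z hY.
rewrite -[z](subrK (in_completion (tensor_top tA tB) m)) (linear_add fl).
apply: (nbase_add hW) => //.
have : sval i m.
  rewrite -[sval i]zi him; exists 0; last by rewrite addr0.
  exact: (nbase_submodule (svalP i)).1.
rewrite ei => -[s hs ->]; rewrite lift_in.
elim: s hs => [|p s IHs] hs; first by rewrite big_nil; exact: nbase_zero hW.
rewrite big_cons; apply: (nbase_add hW); first by apply/fW/hs; rewrite mem_head.
by apply: IHs => q qs; apply: hs; rewrite inE qs orbT.
Qed.
End Bound.
End CompletedTensor.

Definition nbhd_index (A B : lmodType K) (tA : lintop A) (tB : lintop B) U V
    (hU : nbase tA U) (hV : nbase tB V) : nidx (tensor_top tA tB) :=
  exist (fun X => nbase (tensor_top tA tB) X) (tensor_nbhd U V)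
    (ex_intro _ U (ex_intro _ V (And3 hU hV erefl))).

Section CompletedProduct.
Variables (A B : lmodType K) (tA : lintop A) (tB : lintop B).
Variables (mulA : A -> A -> A) (mulB : B -> B -> B).
Hypotheses (cA : continuous_bilin tA tA tA mulA) (cB : continuous_bilin tB tB tB mulB).
Notation T := (ctensor_top tA tB).
Let hT : complete_top T := @ctensor_complete _ _ _ tA tB.
Let tc := ctens_continuous tA tB.

Let inner_continuous a b : continuous_bilin tA tB T (fun c d => mulA a c ⊗^ mulB b d).
Proof.
exact: (continuous_bilin_precomp tc (continuous_bilin_r a cA) (continuous_bilin_r b cB)).
Qed.

Let inner a b : ctensor tA tB -> ctensor tA tB :=
  ctensor_lift T (fun c d => mulA a c ⊗^ mulB b d).

(** The neighbourhoods are chosen before [y]; this uniformity gives the continuity of the product in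
    its left argument. *)
Let inner_nbhd W : nbase T W -> exists U V, [/\ nbase tA U, nbase tB V &
  forall a b, U a \/ V b -> forall y, W (inner a b y)].
Proof.
move=> hW; have [U [V [hU hV sW]]] := tc.2 _ hW.
have [U1 [U2 [hU1 hU2 sU]]] := cA.2 _ hU; have [V1 [V2 [hV1 hV2 sV]]] := cB.2 _ hV.
exists U1, V1; split=> // a b hab y; apply: (ctensor_lift_bound hT _ hW) => // c d.
by apply: sW; case: hab => h; [left; apply: sU; left | right; apply: sV; left].
Qed.

Let inner_bilin y : bilin (fun a b => inner a b y).
Proof.
split=> [b|a].
  apply: (@ctensor_lift_param _ _ _ _ _ _ hT _ (fun a c d => mulA a c ⊗^ mulB b d)) => // c d.
  exact: (linear_comp (tc.1.1 _) (cA.1.1 c)).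
apply: (@ctensor_lift_param _ _ _ _ _ _ hT _ (fun b c d => mulA a c ⊗^ mulB b d)) => // c d.
exact: (linear_comp (tc.1.2 _) (cB.1.1 d)).
Qed.

Let outer_continuous y : continuous_bilin tA tB T (fun a b => inner a b y).
Proof.
split=> [|W /inner_nbhd[U [V [hU hV sW]]]]; first exact: inner_bilin.
by exists U, V; split=> // a b h; exact: sW.
Qed.

Lemma ctensor_mul_ctens a b c d :
  ctensor_mul (tA := tA) (tB := tB) mulA mulB (a ⊗^ b) (c ⊗^ d) = mulA a c ⊗^ mulB b d.
Proof.
rewrite /ctensor_mul (ctensor_lift_ctens hT (outer_continuous _)).
exact: (ctensor_lift_ctens hT (inner_continuous a b)).
Qed.

Lemma ctensor_mul_continuous : continuous_bilin T T T (ctensor_mul mulA mulB).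
Proof.
split.
  split=> [y|x]; first exact: (ctensor_lift_continuous hT (outer_continuous y)).1.
  apply: (@ctensor_lift_param _ _ _ _ _ _ hT _ (fun y a b => inner a b y)) => // a b.
  exact: (ctensor_lift_continuous hT (inner_continuous a b)).1.
move=> W hW; have [U1 [V1 [hU1 hV1 s1]]] := inner_nbhd hW.
have [U [V [hU hV sW]]] := tc.2 _ hW.
have [U0 [U2 [_ hU2 sU]]] := cA.2 _ hU; have [V0 [V2 [_ hV2 sV]]] := cB.2 _ hV.
exists (ker_at (nbhd_index hU1 hV1)), (ker_at (nbhd_index hU2 hV2)).
split; [exact: imageT | exact: imageT | move=> x y [hx|hy]].
  apply: (ctensor_lift_nbhd hT (outer_continuous y) hW _ _ hx) => // a b h.
  exact: s1.
apply: (ctensor_lift_bound hT (outer_continuous y) hW) => a b.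
apply: (ctensor_lift_nbhd hT (inner_continuous a b) hW _ _ hy) => // c d h.
by apply: sW; case: h => h; [left; apply: sU; right | right; apply: sV; right].
Qed.
End CompletedProduct.

(** * Functionals on completed tensor products *)

Section Functionals.
Variable tK : lintop (K^o : lmodType K).
Hypothesis hK : complete_top tK.

Lemma functional_mul_continuous (A B : lmodType K) (tA : lintop A) (tB : lintop B)
    (f : A -> K^o) (g : B -> K^o) : continuous_lin tA tK f -> continuous_lin tB tK g ->
  continuous_bilin tA tB tK (fun a b => (f a : K) * (g b : K) : K^o).
Proof.
move=> [fl fc] [gl gc]; split.
  by split=> x; [apply: linear_coefl | apply: linear_coefr].
move=> W hW; have [U hU fU] := fc _ hW; have [V hV gV] := gc _ hW.
exists U, V; split=> // a b [/fU|/gV] h; last exact: (nbase_scale (f a) hW h).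
by rewrite mulrC; exact: (nbase_scale (g b) hW h).
Qed.

Variables (A B : lmodType K) (tA : lintop A) (tB : lintop B).

Definition ctensor_eval (f : A -> K) (g : B -> K) : ctensor tA tB -> K^o :=
  ctensor_lift tK (fun a b => f a * g b : K^o).

Lemma ctensor_eval_continuous f g : continuous_lin tA tK f -> continuous_lin tB tK g ->
  continuous_lin (ctensor_top tA tB) tK (ctensor_eval f g).
Proof.
move=> fc gc; exact: (ctensor_lift_continuous hK (functional_mul_continuous fc gc)).
Qed.

Lemma ctensor_evalE f g a b : continuous_lin tA tK f -> continuous_lin tB tK g ->
  ctensor_eval f g (a ⊗^ b) = f a * g b.
Proof.
move=> fc gc; exact: (ctensor_lift_ctens hK (functional_mul_continuous fc gc)).
Qed.

(** Functionals with a finite coproduct turn even a product in the completion into a finite sum. The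
    two algebras are arbitrary, so that the lemma serves [mul2] and, with a tensor square as first
    factor, [mul3]. *)
Lemma ctensor_eval_mul (mulA : A -> A -> A) (mulB : B -> B -> B)
    (I J : Type) (rI : seq I) (rJ : seq J)
    (f : A -> K^o) (f1 f2 : I -> A -> K^o) (g : B -> K^o) (g1 g2 : J -> B -> K^o) :
  continuous_bilin tA tA tA mulA -> continuous_bilin tB tB tB mulB ->
  continuous_lin tA tK f -> continuous_lin tB tK g ->
  (forall i, continuous_lin tA tK (f1 i)) -> (forall i, continuous_lin tA tK (f2 i)) ->
  (forall j, continuous_lin tB tK (g1 j)) -> (forall j, continuous_lin tB tK (g2 j)) ->
  (forall x y, f (mulA x y) = \sum_(i <- rI) (f1 i x : K) * f2 i y) ->
  (forall x y, g (mulB x y) = \sum_(j <- rJ) (g1 j x : K) * g2 j y) ->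
  forall S T, ctensor_eval f g (ctensor_mul mulA mulB S T) =
    \sum_(i <- rI) \sum_(j <- rJ)
      (ctensor_eval (f1 i) (g1 j) S : K) * ctensor_eval (f2 i) (g2 j) T.
Proof.
move=> cA cB fc gc f1c f2c g1c g2c fM gM S T.
have mc := ctensor_mul_continuous cA cB; have ec := ctensor_eval_continuous fc gc.
have e1 i j := ctensor_eval_continuous (f1c i) (g1c j).
have e2 i j := ctensor_eval_continuous (f2c i) (g2c j).
move: S; apply: (ctensor_linear_ext hK) => [||a b].
- by apply: (continuous_comp ec); exact: (continuous_bilin_l T mc).
- apply: continuous_sum => i; apply: continuous_sum => j.
  exact: (continuous_bilin_l (ctensor_eval (f2 i) (g2 j) T)
    (functional_mul_continuous (e1 i j) (continuous_id tK))).
move: T; apply: (ctensor_linear_ext hK) => [||c d].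
- by apply: (continuous_comp ec); exact: (continuous_bilin_r (a ⊗^ b) mc).
- apply: continuous_sum => i; apply: continuous_sum => j.
  exact: (continuous_bilin_r (ctensor_eval (f1 i) (g1 j) (a ⊗^ b))
    (functional_mul_continuous (continuous_id tK) (e2 i j))).
rewrite ctensor_mul_ctens // ctensor_evalE // fM gM mulr_suml.
apply: eq_bigr => i _; rewrite mulr_sumr; apply: eq_bigr => j _.
by rewrite !ctensor_evalE //; ring.
Qed.
End Functionals.
End Continuity.

(** * Pairing the structure of H with the dual *)

Section Duality.
Variables (K : comNzRingType) (tK : lintop (K^o : lmodType K)).
Variables (H : algType K) (tH : lintop H).
Variables (cop : H -> ctensor tH tH) (eps : H -> K) (anti : H -> H).
Hypothesis hopfH : is_top_hopf tK cop eps anti.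
Variables (D : algType K) (copD : D -> tensor D D) (epsD : D -> K) (antiD : D -> D).
Variable pair : D -> H -> K.
Hypothesis dualD : is_dual_hopf tK cop eps anti copD epsD antiD pair.

Let hopfD := dual_hopf dualD.
Let coalgD := hopf_coalgebra hopfD.
Let copL := coalg_cop_linear coalgD.
Let epsL : linear (epsD : D -> K^o) := coalg_eps_linear coalgD.
Let antiL := hopf_anti_linear hopfD.
Let hK := top_alg_ground (top_hopf_algebra hopfH).
Let mulc := top_alg_mul (top_hopf_algebra hopfH).
Let pairL x : linear (pair^~ x : D -> K^o) := dual_linear dualD x.
Let pairC a : continuous_lin tH tK (pair a : H -> K^o) := dual_continuous dualD a.
Let copc := top_hopf_cop hopfH.
Let antic := top_hopf_anti hopfH.

Notation legs := (legs copD).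
Notation H2 := (ctensor tH tH).
Notation tH2 := (ctensor_top tH tH).
Notation H3 := (ctensor tH2 tH).
Notation tH3 := (ctensor_top tH2 tH).
Let tc2 := ctens_continuous tH tH.
Let tc3 := ctens_continuous tH2 tH.
Let h2 : complete_top tH2 := @ctensor_complete _ _ _ tH tH.
Let h3 : complete_top tH3 := @ctensor_complete _ _ _ tH2 tH.

Let ev a b : H2 -> K^o := pair2 tK pair a b.

Let evC a b : continuous_lin tH2 tK (ev a b).
Proof. exact: (ctensor_eval_continuous hK (pairC a) (pairC b)). Qed.

Let evE a b x y : ev a b (x ⊗^ y) = pair a x * pair b y.
Proof. exact: (ctensor_evalE hK _ _ (pairC a) (pairC b)). Qed.

Lemma pair2_linearl b (T : H2) : linear (fun a => pair2 tK pair a b T : K^o).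
Proof.
move=> k u v; move: T; apply: (ctensor_linear_ext hK); [exact: evC | | move=> x y].
  by apply: continuous_add; [apply: continuous_scale |]; exact: evC.
rewrite [LHS]evE [pair2 _ _ _ _ _]evE [pair2 _ _ _ _ _]evE [pair (_ + _) x]pairL mulrDl.
by congr (_ + _); exact: esym (mulrA _ _ _).
Qed.

Lemma pair2_linearr a (T : H2) : linear (fun b => pair2 tK pair a b T : K^o).
Proof.
move=> k u v; move: T; apply: (ctensor_linear_ext hK); [exact: evC | | move=> x y].
  by apply: continuous_add; [apply: continuous_scale |]; exact: evC.
rewrite [LHS]evE [pair2 _ _ _ _ _]evE [pair2 _ _ _ _ _]evE [pair (_ + _) y]pairL mulrDr.
by congr (_ + _); exact: mulrCA.
Qed.

Lemma pair_mul a x y : pair a (x * y) = \sum_(s <- legs 1 a) pair (s 0%N) x * pair (s 1%N) y.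
Proof. by rewrite (dual_cop dualD) (@sum_legs1 _ _ _ K^o). Qed.

Lemma pair2_mul a b (S T : H2) : pair2 tK pair a b (mul2 S T) =
  \sum_(s <- legs 1 a) \sum_(t <- legs 1 b)
    pair2 tK pair (s 0%N) (t 0%N) S * pair2 tK pair (s 1%N) (t 1%N) T.
Proof.
apply: (ctensor_eval_mul hK mulc mulc (pairC a) (pairC b)
  (f1 := fun s => pair (s 0%N)) (f2 := fun s => pair (s 1%N))
  (g1 := fun s => pair (s 0%N)) (g2 := fun s => pair (s 1%N))) => [i|i|j|j|x y|x y] //.
- exact: pair_mul.
- exact: pair_mul.
Qed.

Lemma pair2_flip a b (T : H2) : pair2 tK pair a b (flip T) = pair2 tK pair b a T.
Proof.
have fc : continuous_bilin tH tH tH2 (fun x y => y ⊗^ x) by exact: (continuous_bilin_flip tc2).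
move: T; apply: (ctensor_linear_ext hK); last move=> x y.
- exact: (continuous_comp (evC a b) (ctensor_lift_continuous h2 fc)).
- exact: evC.
by rewrite /flip (ctensor_lift_ctens h2 fc) [LHS]evE [RHS]evE mulrC.
Qed.

Lemma pair2_anti_r a b (T : H2) : pair2 tK pair a b (anti_r anti T) = pair2 tK pair a (antiD b) T.
Proof.
have fc : continuous_bilin tH tH tH2 (fun x y => x ⊗^ anti y).
  exact: (continuous_bilin_precomp tc2 (continuous_id tH) antic).
move: T; apply: (ctensor_linear_ext hK); last move=> x y.
- exact: (continuous_comp (evC a b) (ctensor_lift_continuous h2 fc)).
- exact: evC.
by rewrite /anti_r (ctensor_lift_ctens h2 fc) [LHS]evE [RHS]evE (dual_anti dualD).
Qed.

Let pair_one a : pair a 1 = epsD a.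
Proof. by rewrite (dual_eps dualD). Qed.

Let pair2_cop a b x : pair2 tK pair a b (cop x) = pair (a * b) x.
Proof. by rewrite (dual_mul dualD). Qed.

Definition pair3 a b c : H3 -> K^o := ctensor_eval tK (pair2 tK pair a b) (pair c).

Let ev3C a b c : continuous_lin tH3 tK (pair3 a b c).
Proof. exact: (ctensor_eval_continuous hK (evC a b) (pairC c)). Qed.

Let ev3E a b c z y : pair3 a b c (z ⊗^ y) = pair2 tK pair a b z * pair c y.
Proof. exact: (ctensor_evalE hK _ _ (evC a b) (pairC c)). Qed.

Lemma pair3_mul a b c S T : pair3 a b c (mul3 S T) =
  \sum_(s <- legs 1 a) \sum_(t <- legs 1 b) \sum_(u <- legs 1 c)
    (pair3 (s 0%N) (t 0%N) (u 0%N) S : K) * pair3 (s 1%N) (t 1%N) (u 1%N) T.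
Proof.
transitivity (\sum_(p <- [seq (s, t) | s <- legs 1 a, t <- legs 1 b])
    \sum_(u <- legs 1 c)
    (pair3 (p.1 0%N) (p.2 0%N) (u 0%N) S : K) * pair3 (p.1 1%N) (p.2 1%N) (u 1%N) T).
  apply: (ctensor_eval_mul hK (ctensor_mul_continuous mulc mulc) mulc (evC a b) (pairC c)
    (f1 := fun p => ev (p.1 0%N) (p.2 0%N)) (f2 := fun p => ev (p.1 1%N) (p.2 1%N))
    (g1 := fun u => pair (u 0%N)) (g2 := fun u => pair (u 1%N))) => [i|i|j|j|x y|x y] //.
  - by rewrite big_allpairs; exact: pair2_mul.
  - exact: pair_mul.
by rewrite big_allpairs.
Qed.

Lemma pair3_cop_l a b c (T : H2) : pair3 a b c (cop_l cop T) = pair2 tK pair (a * b) c T.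
Proof.
have fc : continuous_bilin tH tH tH3 (fun x y => cop x ⊗^ y).
  exact: (continuous_bilin_precomp tc3 copc (continuous_id tH)).
move: T; apply: (ctensor_linear_ext hK); last move=> x y.
- exact: (continuous_comp (ev3C a b c) (ctensor_lift_continuous h3 fc)).
- exact: evC.
by rewrite /cop_l (ctensor_lift_ctens h3 fc) ev3E [RHS]evE pair2_cop.
Qed.

Let assoc_r x : H2 -> H3 := ctensor_lift tH3 (fun y1 y2 => (x ⊗^ y1) ⊗^ y2).

Let inner_continuous x : continuous_bilin tH tH tH3 (fun y1 y2 => (x ⊗^ y1) ⊗^ y2).
Proof.
exact: (continuous_bilin_precomp tc3 (continuous_bilin_r x tc2) (continuous_id tH)).
Qed.

(** Joint continuity is needed because [cop_r] is a lift whose integrand is itself a lift; the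
    neighbourhood for [T] must not depend on [x]. *)
Let assoc_r_continuous : continuous_bilin tH tH2 tH3 assoc_r.
Proof.
split.
  split=> [T|x]; last exact: (ctensor_lift_continuous h3 (inner_continuous x)).1.
  apply: (@ctensor_lift_param _ _ _ _ _ _ _ h3 _ (fun x y1 y2 => (x ⊗^ y1) ⊗^ y2)) => // y z.
  exact: (linear_comp (tc3.1.1 _) (tc2.1.1 y)).
move=> W hW; have [U2 [V [hU2 hV sW]]] := tc3.2 _ hW.
have [U [V1 [hU hV1 sU]]] := tc2.2 _ hU2.
exists U, (ker_at (nbhd_index hV1 hV)); split=> //; first exact: imageT.
move=> x T [hx|hT].
  apply: (ctensor_lift_bound h3 (inner_continuous x) hW) => y z.
  by apply: sW; left; apply: sU; left.
apply: (ctensor_lift_nbhd h3 (inner_continuous x) hW _ _ hT) => // y z h.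
by apply: sW; case: h => h; [left; apply: sU; right | right].
Qed.

Let pair3_assoc_r a b c x T : pair3 a b c (assoc_r x T) = pair a x * pair2 tK pair b c T.
Proof.
move: T; apply: (ctensor_linear_ext hK); last move=> y z.
- exact: (continuous_comp (ev3C a b c) (continuous_bilin_r x assoc_r_continuous)).
- exact: (continuous_scale (pair a x) (evC b c)).
rewrite /assoc_r (ctensor_lift_ctens h3 (inner_continuous x)) ev3E.
by rewrite [pair2 _ _ _ _ _]evE [pair2 _ _ _ _ _]evE mulrA.
Qed.

Lemma pair3_cop_r a b c (T : H2) : pair3 a b c (cop_r cop T) = pair2 tK pair a (b * c) T.
Proof.
have fc : continuous_bilin tH tH tH3 (fun x y => assoc_r x (cop y)).
  exact: (continuous_bilin_precomp assoc_r_continuous (continuous_id tH) copc).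
move: T; apply: (ctensor_linear_ext hK); last move=> x y.
- exact: (continuous_comp (ev3C a b c) (ctensor_lift_continuous h3 fc)).
- exact: evC.
rewrite /cop_r -/(assoc_r _ _) (ctensor_lift_ctens h3 fc) pair3_assoc_r pair2_cop.
by rewrite [RHS]evE.
Qed.

Lemma pair3_leg12 a b c (T : H2) : pair3 a b c (leg12 T) = pair2 tK pair a b T * epsD c.
Proof. by rewrite /leg12 ev3E pair_one. Qed.

Lemma pair3_leg13 a b c (T : H2) : pair3 a b c (leg13 T) = epsD b * pair2 tK pair a c T.
Proof.
have fc : continuous_bilin tH tH tH3 (fun x y => (x ⊗^ 1) ⊗^ y).
  exact: (continuous_bilin_precomp tc3 (continuous_bilin_l 1 tc2) (continuous_id tH)).
move: T; apply: (ctensor_linear_ext hK); last move=> x y.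
- exact: (continuous_comp (ev3C a b c) (ctensor_lift_continuous h3 fc)).
- exact: (continuous_scale (epsD b) (evC a c)).
rewrite /leg13 (ctensor_lift_ctens h3 fc) ev3E [pair2 _ _ _ _ _]evE [pair2 _ _ _ _ _]evE.
by rewrite pair_one mulrAC mulrC.
Qed.

Lemma pair3_leg23 a b c (T : H2) : pair3 a b c (leg23 T) = epsD a * pair2 tK pair b c T.
Proof.
have fc : continuous_bilin tH tH tH3 (fun x y => (1 ⊗^ x) ⊗^ y).
  exact: (continuous_bilin_precomp tc3 (continuous_bilin_r 1 tc2) (continuous_id tH)).
move: T; apply: (ctensor_linear_ext hK); last move=> x y.
- exact: (continuous_comp (ev3C a b c) (ctensor_lift_continuous h3 fc)).
- exact: (continuous_scale (epsD a) (evC b c)).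
rewrite /leg23 (ctensor_lift_ctens h3 fc) ev3E [pair2 _ _ _ _ _]evE [pair2 _ _ _ _ _]evE.
by rewrite pair_one mulrA.
Qed.

Ltac linear_hook ::= first [apply: (linear_legs hopfD) | apply: (linear_comp antiL)
  | apply: (linear_comp epsL) | apply: (linear_comp copL)
  | apply: (linear_comp (pairL _))
  | apply: (linear_comp (pair2_linearl _ _)) | apply: (linear_comp (pair2_linearr _ _))].

(** * The universal R-matrix as a form on the dual *)

Section Rmatrix.
Variables (R Rinv : H2) (quasitriangular : is_universal_Rmatrix cop R Rinv).
Notation r := (fun a b => pair2 tK pair a b R).
Notation rb := (fun a b => pair2 tK pair a b Rinv).

Lemma Rmatrix_coquasitriangular : is_coquasitriangular copD epsD r rb.
Proof.
split=> [b|a|b|a|a b c|a b c|a b|a b|a b] /=.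
- exact: pair2_linearl.
- exact: pair2_linearr.
- exact: pair2_linearl.
- exact: pair2_linearr.
(* Pairing with R_13 R_23 leaves a counit on b_1 from the first factor and one on a_2 from the
   second; the right side is expanded by the same two counits. *)
- rewrite -pair3_cop_l (Rmatrix_copl quasitriangular) pair3_mul.
  rewrite -[RHS](sum_counit1r hopfD a (f := fun x => \sum_(s <- legs 1 c)
    pair2 tK pair x (s 0%N) R * pair2 tK pair b (s 1%N) R : K^o)); last by linearity.
  apply: eq_bigr => s _.
  rewrite -(sum_counit1l hopfD b (f := fun x => \sum_(u <- legs 1 c)
    pair2 tK pair (s 0%N) (u 0%N) R * pair2 tK pair x (u 1%N) R : K^o)); last by linearity.
  rewrite scaler_sumr; apply: eq_bigr => t _; rewrite !scaler_sumr.
  apply: eq_bigr => u _; rewrite pair3_leg13 pair3_leg23 /GRing.scale /=; ring.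
- rewrite -pair3_cop_r (Rmatrix_copr quasitriangular) pair3_mul.
  apply: eq_bigr => s _.
  rewrite -(sum_counit1l hopfD b (f := fun x =>
    pair2 tK pair (s 0%N) c R * pair2 tK pair (s 1%N) x R : K^o)); last by linearity.
  apply: eq_bigr => t _.
  rewrite -(sum_counit1r hopfD c (f := fun x =>
    pair2 tK pair (s 0%N) x R * pair2 tK pair (s 1%N) (t 1%N) R : K^o)); last by linearity.
  rewrite scaler_sumr; apply: eq_bigr => u _.
  rewrite pair3_leg13 pair3_leg12 /GRing.scale /=; ring.
- by rewrite -pair2_mul (Rmatrix_mulV quasitriangular) [LHS]evE !pair_one.
- by rewrite -pair2_mul (Rmatrix_mulVl quasitriangular) [LHS]evE !pair_one.
(* This axiom is an identity in [D], so nondegeneracy of the pairing reduces it to scalars for each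
   [x] in [H]. *)
- apply/eqP; rewrite -subr_eq0; apply/eqP/(dual_inj dualD) => x.
  have pairD := linear_add (pairL x); have pairZ := linear_scale (pairL x).
  rewrite -scaleN1r pairD pairZ !(linear_fun_sum _ _ (pairL x)).
  transitivity (pair2 tK pair a b (mul2 R (cop x)) -
    pair2 tK pair a b (mul2 (flip (cop x)) R)); last first.
    by rewrite (Rmatrix_cop quasitriangular) subrr.
  rewrite !pair2_mul [_ *: _]scaleN1r; congr (_ - _).
    apply: eq_bigr => s _; rewrite (linear_fun_sum _ _ (pairL x)); apply: eq_bigr => t _.
    by rewrite pairZ pair2_cop.
  apply: eq_bigr => s _; rewrite (linear_fun_sum _ _ (pairL x)); apply: eq_bigr => t _.
  by rewrite pairZ pair2_flip pair2_cop mulrC.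
Qed.

Let cqt := Rmatrix_coquasitriangular.

Let contract_bilin T : bilin (contract tK (tH := tH) pair T).
Proof.
have inner (u1 u2 : D) : bilin (fun v1 v2 : D => pair2 tK pair u2 v2 T *: (u1 ⊗ v1)).
  by split=> x; linearity.
split=> [v|u]; last first.
  by apply: linear_bigop => p; exact: (tensor_lift_linear (inner p.1 p.2)).
apply: tensor_lift_linear; split=> x; apply: linear_bigop => p; linearity.
Qed.

Let act_bilin T (u v : D -> tensor D D) : linear u -> linear v ->
  bilin (fun a b => contract tK (tH := tH) pair T (u a) (v b)).
Proof.
move=> ul vl; split=> x.
  exact: (linear_comp ((contract_bilin T).1 _) ul).
exact: (linear_comp ((contract_bilin T).2 _) vl).
Qed.

Let contractE T (u v : D -> tensor D D) a b : linear u -> linear v ->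
  tensor_lift (fun a b => contract tK (tH := tH) pair T (u a) (v b)) (a ⊗ b) =
  contract tK pair T (u a) (v b).
Proof. by move=> ul vl; apply: tensor_lift_tens; exact: act_bilin. Qed.

Let tflip_bilin : bilin (fun a b : D => b ⊗ a).
Proof. by split=> x; linearity. Qed.

Let tflip_copL : linear (fun b => tflip (copD b)).
Proof. exact: (linear_tensor_lift tflip_bilin copL). Qed.

Let lift_tflip (M : lmodType K) (f : D -> D -> M) z : bilin f ->
  tensor_lift f (tflip z) = tensor_lift (fun a b => f b a) z.
Proof.
move=> fb; rewrite (linear_lift _ _ (tensor_lift_linear fb)).
by apply: eq_tensor_lift => a b; rewrite tensor_lift_tens.
Qed.

Let contract_inner_bilin T (u1 u2 : D) :
  bilin (fun v1 v2 : D => pair2 tK (tH := tH) pair u2 v2 T *: (u1 ⊗ v1)).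
Proof. by split=> x; linearity. Qed.

Let contract_outer_bilin T v : bilin (fun u1 u2 : D =>
  tensor_lift (fun v1 v2 : D => pair2 tK (tH := tH) pair u2 v2 T *: (u1 ⊗ v1)) v).
Proof. by split=> x; apply: linear_bigop => p; linearity. Qed.

Lemma act_llE T a b : act_ll tK copD pair T (a ⊗ b) =
  \sum_(s <- legs 1 a) \sum_(t <- legs 1 b)
    pair2 tK (tH := tH) pair (s 1%N) (t 1%N) T *: (s 0%N ⊗ t 0%N).
Proof.
rewrite /act_ll contractE // sum_legs1; apply: eq_tensor_lift => u1 u2.
by rewrite sum_legs1.
Qed.

Lemma act_lrE T a b : act_lr tK copD pair T (a ⊗ b) =
  \sum_(s <- legs 1 a) \sum_(t <- legs 1 b)
    pair2 tK (tH := tH) pair (s 1%N) (t 0%N) T *: (s 0%N ⊗ t 1%N).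
Proof.
rewrite /act_lr (contractE _ _ _ copL tflip_copL) sum_legs1; apply: eq_tensor_lift => u1 u2.
by rewrite sum_legs1 lift_tflip.
Qed.

Lemma act_rrE T a b : act_rr tK copD pair T (a ⊗ b) =
  \sum_(s <- legs 1 a) \sum_(t <- legs 1 b)
    pair2 tK (tH := tH) pair (s 0%N) (t 0%N) T *: (s 1%N ⊗ t 1%N).
Proof.
rewrite /act_rr (contractE _ _ _ tflip_copL tflip_copL) /contract lift_tflip // sum_legs1.
apply: eq_tensor_lift => u1 u2; by rewrite sum_legs1 lift_tflip.
Qed.

Let act_rrL T : linear (act_rr tK (tH := tH) copD pair T).
Proof. exact: (tensor_lift_linear (act_bilin T tflip_copL tflip_copL)). Qed.

Let act_llL T : linear (act_ll tK (tH := tH) copD pair T).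
Proof. exact: (tensor_lift_linear (act_bilin T copL copL)). Qed.

(** The inner action pairs the last leg of [a] with S of the first leg of [b], which gives r(a_3, S
    b_1). The outer one pairs the first legs of what remains, which gives r(a_1, b_2). *)
Lemma re_mulE a b : re_mul tK copD pair anti R a b = re_prod copD antiD r a b.
Proof.
have mulL := tensor_lift_linear (@bilin_mul K D).
rewrite /re_mul act_lrE !(linear_fun_sum _ _ (act_rrL _)) (linear_fun_sum _ _ mulL) /re_prod.
symmetry; under [LHS]eq_bigr => s _ do split_at b 1%N 1%N 1%N.
split_at a 0%N 1%N 1%N; apply: eq_bigr => s _.
rewrite exchange_big !(linear_fun_sum _ _ (act_rrL _)) (linear_fun_sum _ _ mulL).
apply: eq_bigr => t _; rewrite (linear_scale (act_rrL _)) (linear_scale mulL) act_rrE.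
rewrite (linear_fun_sum _ _ mulL) scaler_sumr; apply: eq_bigr => x _.
rewrite (linear_fun_sum _ _ mulL) scaler_sumr; apply: eq_bigr => y _.
rewrite (linear_scale mulL) (tensor_lift_tens _ _ (@bilin_mul K D)) scalerA.
by rewrite pair2_anti_r mulrC.
Qed.

Let twisted_inner al xi : bilin (fun be' et' : D => (al * et') ⊗ (be' * xi)).
Proof. by split=> x; linearity. Qed.

Let twisted_pure al be et xi : tensor D D :=
  tensor_lift (fun be' et' => (al * et') ⊗ (be' * xi))
    (act_rr tK copD pair Rinv (act_ll tK copD pair R (be ⊗ et))).

Let twisted_bilin1 al be : bilin (twisted_pure al be).
Proof.
split=> [xi|et]; last by apply: linear_bigop => p; linearity.
apply: (linear_comp (tensor_lift_linear (twisted_inner al xi))).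
apply: (linear_comp (act_rrL _)); apply: (linear_comp (act_llL _)); linearity.
Qed.

Let twisted_bilin2 w : bilin (fun al be => tensor_lift (twisted_pure al be) w).
Proof.
split=> [be|al]; apply: linear_bigop => p.
  by apply: linear_bigop => q; linearity.
apply: (linear_comp (tensor_lift_linear (twisted_inner al p.2))).
apply: (linear_comp (act_rrL _)); apply: (linear_comp (act_llL _)); linearity.
Qed.

Lemma twisted_mul_bilin : bilin (twisted_mul tK copD pair R Rinv).
Proof.
split=> [w|z]; first exact: (tensor_lift_linear (twisted_bilin2 w)).
by apply: linear_bigop => p; exact: (tensor_lift_linear (twisted_bilin1 p.1 p.2)).
Qed.

(** Left actions read the last legs and right actions the first, so R contributes r on legs 2 and
    its inverse contributes [rb] on legs 0. *)
Lemma twisted_mulE al be et xi :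
  twisted_mul tK copD pair R Rinv (al ⊗ be) (et ⊗ xi) =
  \sum_(s <- legs 2 be) \sum_(t <- legs 2 et)
    (rb (s 0%N) (t 0%N) * r (s 2%N) (t 2%N)) *: ((al * t 1%N) ⊗ (s 1%N * xi)).
Proof.
have liftL := tensor_lift_linear (twisted_inner al xi).
have -> : twisted_mul tK copD pair R Rinv (al ⊗ be) (et ⊗ xi) = twisted_pure al be et xi.
  rewrite [LHS](tensor_lift_tens _ _ (twisted_bilin2 _)).
  exact: (tensor_lift_tens _ _ (twisted_bilin1 _ _)).
rewrite /twisted_pure act_llE (linear_fun_sum _ _ (act_rrL _)) (linear_fun_sum _ _ liftL).
symmetry; under [LHS]eq_bigr => s _ do split_at et 0%N 1%N 1%N.
split_at be 0%N 1%N 1%N; apply: eq_bigr => s _.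
rewrite exchange_big !(linear_fun_sum _ _ (act_rrL _)) (linear_fun_sum _ _ liftL).
apply: eq_bigr => t _; rewrite (linear_scale (act_rrL _)) (linear_scale liftL) act_rrE.
rewrite (linear_fun_sum _ _ liftL) scaler_sumr; apply: eq_bigr => x _.
rewrite (linear_fun_sum _ _ liftL) scaler_sumr; apply: eq_bigr => y _.
by rewrite (linear_scale liftL) (tensor_lift_tens _ _ (twisted_inner _ _)) scalerA mulrC.
Qed.

Lemma reflection_equation_comodule_algebra :
  is_right_comodule_algebra (re_mul tK copD pair anti R) 1
    (twisted_mul tK copD pair R Rinv) (1 ⊗ 1) (square_cop copD) (square_eps epsD)
    (re_coaction copD antiD).
Proof.
have -> : re_mul tK copD pair anti R = re_prod copD antiD r.
  by do 2!apply/funext => ?; exact: re_mulE.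
exact: (re_comodule_algebra hopfD cqt twisted_mul_bilin twisted_mulE).
Qed.

End Rmatrix.
End Duality.

Theorem proposition4p14
    (F : fieldType) (char0 : [pchar F] =i pred0) (K : comAlgType F)
    (tK : lintop (K^o : lmodType K))
    (H : algType K) (tH : lintop H)
    (cop : H -> ctensor tH tH) (eps : H -> K) (anti : H -> H)
    (hopfH : is_top_hopf tK cop eps anti)
    (R Rinv : ctensor tH tH) (quasitriangular : is_universal_Rmatrix cop R Rinv)
    (D : algType K) (copD : D -> tensor D D) (epsD : D -> K) (antiD : D -> D)
    (pair : D -> H -> K)
    (dualD : is_dual_hopf tK cop eps anti copD epsD antiD pair) :
  is_right_comodule_algebra
    (re_mul tK copD pair anti R) 1
    (twisted_mul tK copD pair R Rinv) (tens 1 1) (square_cop copD)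
    (square_eps epsD)
    (re_coaction copD antiD).
Proof. exact: (reflection_equation_comodule_algebra hopfH dualD quasitriangular). Qed.
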